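(* Let $\{X(t),\,-\infty<t<\infty\}$ be a real-valued, zero mean, mean square continuous, wide sense stationary stochastic process with covariance function $C(\cdot)$ and spectral density $\phi(\cdot)$, and let $\widehat{\phi}_n(\cdot)$ be the estimator of $\phi(\cdot)$ defined in the context from a kernel $K$, window widths $b_n>0$ and sampling rates $\rho_n>0$. Suppose that: (1A) for some number $q>1$, the function $h_q(t)=\sup_{s\ge|t|}|s|^q|C(s)|$ is integrable over the real line; (1B) the spectral density is such that, for some $p>1$, $\phi(\lambda)$ is $O(|\lambda|^{-p})$, in the sense that $\lim_{\lambda\to\infty}|\lambda|^p\phi(\lambda)=A$ for some positive $A$; (2) $K(\cdot)$ is continuous, even, square integrable and bounded (in absolute value) by a non-negative, even and integrable function having a unique maximum at $0$; further, $K(0)=1$; (2A) the characteristic exponent of $K(\cdot)$ (defined in the context) is equal to the number $q$ for which (1A) is assumed to hold; (3) $b_n\to0$ and $nb_n\to\infty$ as $n\to\infty$; (4) $\rho_n\to\infty$ and $\rho_nb_n\to0$ as $n\to\infty$; (5) the fourth moment $E|X(t)|^4$ exists for every $t$, the fourth moment function $E[X(t)X(t+v_1)X(t+v_2)X(t+v_3)]$ is a function only of the lags $v_1,v_2,v_3$, and the fourth order cumulant function $Q(v_1,v_2,v_3)$ (defined in the context) satisfies $|Q(v_1,v_2,v_3)|\le\prod_{i=1}^3g_i(v_i)$, where $g_1,g_2,g_3$ are continuous, even, nonnegative and integrable functions over the real line which are non-increasing over $[0,\infty)$. Then the optimal rate of convergence of the mean squared error of the estimator $\widehat{\phi}_n(\lambda)$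 is given by $$MSE[\widehat{\phi}_n(\lambda)]=O\left(n^{-\frac{2pq}{p+q+2pq}}\right),$$ which corresponds to the optimal choices $$\rho_n=P\,n^{\frac{q}{p+q+2pq}}\qquad\text{and}\qquad b_n=Q\,n^{-\frac{p+q}{p+q+2pq}},$$ for some positive constants $P$ and $Q$.
   Context: The covariance function is $C(t)=E[X(s)X(s+t)]$ and the spectral density is $\phi(\lambda)=\frac1{2\pi}\int_{-\infty}^\infty C(t)e^{-it\lambda}\,dt$. The process is sampled uniformly at rate $\rho_n$, the sample size being $n$. The estimator is $$\widehat{\phi}_n(\lambda)=\frac{1}{2\pi\rho_n}\sum_{|v|<n}\widehat{\gamma}_n(v)K(b_nv)e^{-\frac{iv\lambda}{\rho_n}}\,1_{[-\pi\rho_n,\pi\rho_n]}(\lambda),$$ where $v$ ranges over integers, $1_A$ is the indicator function of the set $A$, and $$\widehat{\gamma}_n(v)=\frac1n\sum_{j=1}^{n-|v|}X\left(\frac{j}{\rho_n}\right)X\left(\frac{j+|v|}{\rho_n}\right),\qquad |v|\le n-1.$$ The mean squared error is $MSE[\widehat{\phi}_n(\lambda)]=E\big[(\widehat{\phi}_n(\lambda)-\phi(\lambda))^2\big]$, i.e. squared bias plus variance. For a kernel $K(\cdot)$, let $k_r=\lim_{x\to0}\frac{1-K(x)}{|x|^r}$ for each positive number $r$ such that the limit exists. The characteristic exponent of $K$ is the largest number $r$ such that this limit exists and is non-zero. The fourth order cumulant function is $Q(v_1,v_2,v_3)=P(v_1,v_2,v_3)-P_G(v_1,v_2,v_3)$,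 where $P(v_1,v_2,v_3)=E[X(t)X(t+v_1)X(t+v_2)X(t+v_3)]$ and $P_G(v_1,v_2,v_3)=C(v_1)C(v_3-v_2)+C(v_2)C(v_3-v_1)+C(v_3)C(v_1-v_2)$. (The functions $P(\cdot,\cdot,\cdot)$, $Q(\cdot,\cdot,\cdot)$ are unrelated to the constants $P$, $Q$ in the claim.)
   Formalization: In (2) the bounding function is also taken to be non-increasing on [0,∞): with only a unique global maximum at 0, spiked kernels K break the rate for every P, Q. ''Optimal'' means: no b_n, ρ_n satisfying (3)-(4) give a better rate at all λ simultaneously. *)

(* Defs.v *)
From mathcomp Require Import all_boot all_order all_algebra.
From mathcomp Require Import complex.
From mathcomp Require Import all_classical all_reals all_analysis.
From mathcomp Require Import measurable_realfun.

Set Implicit Arguments.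
Unset Strict Implicit.
Unset Printing Implicit Defensive.

Import Order.TTheory GRing.Theory Num.Theory.
Import numFieldNormedType.Exports.

Local Open Scope classical_set_scope.
Local Open Scope complex_scope.
Local Open Scope ring_scope.

Section Complex_valued.
Context {R : realType}.

Definition expi (x : R) : R[i] := cos x +i* sin x.

Definition cintegral (f : R -> R[i]) : R[i] :=
  (\int[lebesgue_measure]_(t in setT) complex.Re (f t)) +i*
  (\int[lebesgue_measure]_(t in setT) complex.Im (f t)).

Definition spectral_densityC (C : R -> R) (lam : R) : R[i] :=
  ((2 * pi)^-1)%:C * cintegral (fun t => (C t)%:C * expi (- (t * lam))).

(* The imaginary part vanishes, see Im_spectral_densityC. *)
Definition spectral_density (C : R -> R) (lam : R) : R :=
  complex.Re (spectral_densityC C lam).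

Lemma Rintegral_odd (f : R -> R) : measurable_fun [set: R] f ->
  (forall x, f (- x) = - f x) -> \int[lebesgue_measure]_(x in setT) f x = 0.
Proof.
move=> mf fodd; rewrite /Rintegral integralE.
pose F := EFin \o f.
have mF : measurable_fun [set: R] F by exact/measurable_EFinP.
suff -> : (\int[lebesgue_measure]_(x in setT) F^\+ x =
          \int[lebesgue_measure]_(x in setT) F^\- x)%E.
  case: (\int[lebesgue_measure]_(x in setT) F^\- x)%E => //= r.
  by rewrite subrr.
have -> : (F^\- = F^\+ \o -%R)%E.
  by apply/funext => x; rewrite /= funeposE funenegE /F /= fodd.
rewrite -[in RHS](preimage_setT (-%R : R -> measurableTypeR R)).
rewrite -[RHS]ge0_integral_pushforward//=.
- by apply: eq_measure_integral => //= B mB _; exact/esym/lebesgue_measureN.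
- exact: measurable_funepos.
Qed.

Lemma Im_spectral_densityC (C : R -> R) (lam : R) :
  measurable_fun [set: R] C -> (forall x, C (- x) = C x) ->
  complex.Im (spectral_densityC C lam) = 0.
Proof.
move=> mC Ceven; rewrite /spectral_densityC /cintegral /=.
under [X in _ * X + _]eq_Rintegral do rewrite mul0r addr0.
rewrite mul0r addr0 Rintegral_odd ?mulr0//.
- apply: measurable_funM => //.
  apply: (measurableT_comp (continuous_measurable_fun (@continuous_sin R))).
  by apply: measurableT_comp => //; exact: measurable_funM.
- by move=> x; rewrite Ceven mulNr opprK sinN mulrN opprK.
Qed.

End Complex_valued.

Section Process.
Context {d : measure_display} {T : measurableType d} {R : realType}.
Variables (Pr : probability T R) (X : R -> {RV Pr >-> R}).

Record wide_sense_stationary (C : R -> R) : Prop := WideSenseStationary {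
  wss_L2 : forall t, ('E_Pr[fun w => (X t w ^+ 2)%R] < +oo)%E ;
  wss_mean0 : forall t, 'E_Pr[X t]%E = 0%E ;
  wss_cov : forall s t, 'E_Pr[fun w => (X s w * X (s + t) w)%R]%E = (C t)%:E }.

Definition mean_square_continuous : Prop :=
  forall t, 'E_Pr[fun w => ((X s w - X t w) ^+ 2)%R]%E @[s --> t] --> 0%E.

Definition moment4 (t v1 v2 v3 : R) : \bar R :=
  'E_Pr[fun w => (X t w * X (t + v1) w * X (t + v2) w * X (t + v3) w)%R]%E.

Definition gaussian_moment4 (C : R -> R) (v1 v2 v3 : R) : R :=
  C v1 * C (v3 - v2) + C v2 * C (v3 - v1) + C v3 * C (v1 - v2).

(* Only used when moment4 is finite and independent of its base time, which is
   taken to be 0 here. *)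
Definition cumulant4 (C : R -> R) (v1 v2 v3 : R) : R :=
  fine (moment4 0 v1 v2 v3) - gaussian_moment4 C v1 v2 v3.

Definition cumulant_envelope (g : R -> R) : Prop :=
  [/\ continuous g, (forall x, g (- x) = g x), (forall x, 0 <= g x),
      lebesgue_measure.-integrable setT (EFin \o g)
    & forall x y, 0 <= x -> x <= y -> g y <= g x].

Record fourth_order_condition (C : R -> R) : Prop := FourthOrderCondition {
  foc_moment : forall t, ('E_Pr[fun w => (`|X t w| ^+ 4)%R] < +oo)%E ;
  foc_stationary : forall t t' v1 v2 v3,
    moment4 t v1 v2 v3 = moment4 t' v1 v2 v3 ;
  foc_cumulant : exists g1 g2 g3 : R -> R,
    [/\ cumulant_envelope g1, cumulant_envelope g2, cumulant_envelope g3
      & forall v1 v2 v3,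
          `|cumulant4 C v1 v2 v3| <= g1 v1 * g2 v2 * g3 v3] }.

Definition sample_cov (rho : R) (n : nat) (v : int) (w : T) : R :=
  n%:R^-1 * \sum_(1 <= j < (n - `|v|%N).+1)
              X (j%:R / rho) w * X ((j + `|v|%N)%:R / rho) w.

Definition estimatorC (K : R -> R) (b rho : R) (n : nat) (lam : R) (w : T)
    : R[i] :=
  ((2 * pi * rho)^-1)%:C *
  (\sum_(v \in [set v : int | (`|v| < n)%N])
      (sample_cov rho n v w * K (b * v%:~R))%:C * expi (- (v%:~R * lam / rho))) *
  (\1_(`[- (pi * rho), pi * rho]%classic) lam)%:C.

(* The imaginary part vanishes for an even kernel, see Im_estimatorC. *)
Definition estimator (K : R -> R) (b rho : R) (n : nat) (lam : R) (w : T) : R :=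
  complex.Re (estimatorC K b rho n lam w).

(* The expectation is finite as soon as the process has fourth moments. *)
Definition mse (C K : R -> R) (b rho : nat -> R) (lam : R) (n : nat) : R :=
  fine 'E_Pr[fun w =>
    ((estimator K (b n) (rho n) n lam w - spectral_density C lam) ^+ 2)%R]%E.

(* Window widths and sampling rates; index 0 is irrelevant. *)
Record admissible (b rho : nat -> R) : Prop := Admissible {
  adm_pos : forall n, (0 < n)%N -> 0 < b n /\ 0 < rho n ;
  adm_b : b @ \oo --> (0 : R) ;
  adm_nb : (fun n => n%:R * b n) @ \oo --> +oo ;
  adm_rho : rho @ \oo --> +oo ;
  adm_rhob : (fun n => rho n * b n) @ \oo --> (0 : R) }.

Definition mse_rate (C K : R -> R) (b rho : nat -> R) (a : nat -> R) : Prop :=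
  forall lam : R, (mse C K b rho lam : nat -> R^o) =O_\oo (a : nat -> R^o).

(* r is attained by some choice of widths and rates, and no choice has a rate
   of smaller order than r at all frequencies.  At one fixed frequency the
   leading bias terms may cancel or vanish, so that the comparison of rates is
   over all frequencies. *)
Definition optimal_mse_rate (C K : R -> R) (r : nat -> R) : Prop :=
  (exists b rho, admissible b rho /\ mse_rate C K b rho r) /\
  (forall b rho, admissible b rho ->
    forall a, mse_rate C K b rho a ->
      (r : nat -> R^o) =O_\oo (a : nat -> R^o)).

Lemma finite_set_absz_lt (n : nat) : finite_set [set v : int | (`|v| < n)%N].
Proof.
apply: (@sub_finite_set _ _ (Posz @` `I_n `|` (fun k => - Posz k) @` `I_n)).
  by move=> [k|k] /= kn; [left; exists k | right; exists k.+1; rewrite ?NegzE].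
by rewrite finite_setU; split; exact/finite_image/finite_II.
Qed.

Lemma Im_estimatorC (K : R -> R) (b rho : R) (n : nat) (lam : R) (w : T) :
  (forall x, K (- x) = K x) -> complex.Im (estimatorC K b rho n lam w) = 0.
Proof.
move=> Keven; rewrite /estimatorC.
set S := (X in _ * X * _).
suff S0 : complex.Im S = 0.
  by case: S S0 => a c /= ->; rewrite !(mulr0, mul0r, addr0, add0r, mulr0).
have SJ : S = S^*%C.
  have fin := finite_set_absz_lt n.
  rewrite /S; set A := [set v : int | _] in fin *.
  rewrite [in RHS]fsbig_finite// (raddf_sum conjc) -fsbig_finite//.
  rewrite (reindex_fsbig (fun v : int => - v) A); last first.
    split.
    - by move=> v; rewrite /A /= abszN.
    - by move=> u v _ _; exact: oppr_inj.
    - by move=> v vA; exists (- v); rewrite /A /= ?abszN ?opprK.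
  apply: eq_fsbigr => v _.
  have expiN x : expi (- x) = (expi x)^*%C by rewrite /expi cosN sinN.
  have conjM (x y : R[i]) : (x * y)^*%C = x^*%C * y^*%C by exact: rmorphM.
  rewrite [RHS]conjM conjc_real [in RHS]expiN conjcK /sample_cov abszN.
  by rewrite !rmorphN/= mulrN Keven !mulNr opprK.
by case: S SJ => a c [] /eqP; rewrite -addr_eq0 -mulr2n mulrn_eq0 /= => /eqP.
Qed.

End Process.

Section Conditions.
Context {R : realType}.

(* h_q, with values in the extended reals so that it is a genuine supremum. *)
Definition decay_envelope (C : R -> R) (q t : R) : \bar R :=
  ereal_sup [set (`|s| `^ q * `|C s|)%:E | s in [set s | `|t| <= s]].

Definition has_kernel_coef (K : R -> R) (r k : R) : Prop :=
  (1 - K x) / (`|x| `^ r) @[x --> 0^'] --> k.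

Definition characteristic_exponent (K : R -> R) (q : R) : Prop :=
  [/\ 0 < q, (exists2 k, k != 0 & has_kernel_coef K q k)
    & forall r, 0 < r -> (exists2 k, k != 0 & has_kernel_coef K r k) -> r <= q].

(* "Unique maximum at 0" is unimodality: without monotonicity on either side of
   0 the sums of K over the grids b_n v are not controlled by its integral. *)
Definition kernel_envelope (M : R -> R) : Prop :=
  [/\ (forall x, 0 <= M x), (forall x, M (- x) = M x),
      lebesgue_measure.-integrable setT (EFin \o M),
      (forall x, x != 0 -> M x < M 0)
    & forall x y, 0 <= x -> x <= y -> M y <= M x].

Record kernel_condition (K : R -> R) : Prop := KernelCondition {
  ker_cont : continuous K ;
  ker_even : forall x, K (- x) = K x ;
  ker_sq : lebesgue_measure.-integrable setT (EFin \o (fun x => K x ^+ 2)) ;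
  ker_bound : exists2 M, kernel_envelope M & forall x, `|K x| <= M x ;
  ker_at0 : K 0 = 1 }.

End Conditions.

(* Main.v *)
Require Import Defs.
From mathcomp Require Import all_boot all_order all_algebra.
From mathcomp Require Import complex.
From mathcomp Require Import all_classical all_reals all_analysis.
From mathcomp Require Import measurable_realfun ring lra zify.
Import Order.TTheory GRing.Theory Num.Theory.
Import numFieldNormedType.Exports.

(** Write x = rho_n^(-p), y = (rho_n b_n)^q and z = 1 / (n b_n). The mean squared
    error is of the exact order x^2 + y^2 + z, in the following sense: it is
    O(x^2 + y^2 + z) at each frequency, and x^2 + y^2 + z is bounded by a
    multiple of its sum over three well-chosen frequencies ([risk_bounds]). With
    alpha = 2pq / (p + q + 2pq), the geometric mean of x^2, y^2 and z with
    weights alpha / 2p, alpha / 2q and alpha is n^(-alpha), whatever the widths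
    and the rates. So no choice does better than n^(-alpha) at all frequencies
    ([rate_le_max]), and the power choices, for which the three terms are of the
    same order, attain it ([power_scale]).

    Bias. The expected estimator differs from the spectral density phi in three
    ways ([expected_densityE], [bias_expansion]). Sampling adds the aliases of
    phi at distance 2 pi rho_n v, which behave like A (2 pi rho_n v)^(-p) and
    add up to Z x with Z > 0 ([aliasing]). The window replaces C(t) by
    K(b_n rho_n t) C(t), which costs k psi(lambda) y, where psi is the transform
    of |t|^q C(t), by a Riemann sum argument ([window_bias]). The triangular
    weights of the sample covariances cost O(rho_n / n), which is o(z).

    Aliasing rests on the Poisson summation formula. It is obtained by
    integrating C(t) cos(lambda t) against Fejer kernels of period 1 / rho_n:
    these concentrate on the lattice, and their expansion in cosines gives
    Cesaro sums of the aliases ([poisson], [fejer_cov]).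

    Variance. The estimator is a quadratic form in the sample, so its variance
    is a sum of fourth moments: a cumulant part, which is O(rho_n / n), and
    twice a Gaussian quadruple sum ([mse_decomposition]). This sum is O(z)
    after division by the normalization ([quad_upper]). It is also bounded below:
    the kernel varies slowly at the scale of the covariance, so it can be frozen
    at one lag, the inner sums become the square of the sampled density, and
    what remains is a sum of K^2 cos^2 over lags of order up to 1 / b_n, of size
    n / b_n at least ([quad_lower], [amp_sq_lower]).

    Non-cancellation. At one frequency the leading bias Z x - k psi(lambda) y may
    vanish. But Z is the same for all frequencies and psi is not constant: by
    Poisson summation again, a constant transform would force C to vanish off
    the origin ([cos_transform_const0], [psi_nonconstant]). At two frequencies
    with different values of psi, the two biases control both x and y
    ([two_bias_lower]); a third frequency, where phi is not zero, provides the
    lower bound z of the variance. *)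

Local Open Scope classical_set_scope.
Local Open Scope ring_scope.
Set Implicit Arguments.
Unset Strict Implicit.
Unset Printing Implicit Defensive.

(** * Dominated convergence for series, and sums over lags *)

Section Series.
Context {R : realType}.
Implicit Types (G f l T : nat -> R).

Lemma cvgn_near f (l : R) : f @ \oo --> l ->
  forall e, 0 < e -> \forall n \near \oo, `|f n - l| <= e.
Proof. by move=> /cvgrPdist_le fl e e0; under eq_near do rewrite distrC; exact: fl. Qed.

Lemma near_cvgn f (l : R) :
  (forall e, 0 < e -> \forall n \near \oo, `|f n - l| <= e) -> f @ \oo --> l.
Proof. by move=> fl; apply/cvgrPdist_le => e e0; under eq_near do rewrite distrC; exact: fl. Qed.

Lemma nonneg_series_cvg G (B : R) :
  (forall i, 0 <= G i) -> (forall n, \sum_(0 <= i < n) G i <= B) ->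
  cvgn (series G).
Proof.
move=> G0 GB; apply: nondecreasing_is_cvgn.
  by apply/nondecreasing_seqP => n; rewrite !seriesEnat /= big_nat_recr //= lerDl.
by exists B => _ [n _ <-]; rewrite seriesEnat; exact: GB.
Qed.

Lemma dominated_series_tail G f (L : R) V : cvgn (series G) ->
  (forall i, `|f i| <= G i) -> series f @ \oo --> L ->
  `|L - series f V| <= limn (series G) - series G V.
Proof.
move=> cG fG fL.
have h1 : (fun n => `|series f n - series f V|) @ \oo --> `|L - series f V|.
  by apply: cvg_norm; apply: cvgB => //; exact: cvg_cst.
have h2 : (fun n => series G n - series G V) @ \oo --> limn (series G) - series G V.
  by apply: cvgB; [exact: cG | exact: cvg_cst].
apply: (ler_cvg_to h1 h2); exists V => // W /= VW.
rewrite !sub_series_geq //; apply: le_trans (ler_norm_sum _ _ _) _.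
exact: ler_sum.
Qed.

(** Beyond a fixed rank both the approximating series and their limit are
    bounded by the tail of the dominating series, and below that rank the
    convergence is termwise. The limits [T n] of the series are data, so that
    the lemma applies to integrals that are not yet known to be sums. *)
Lemma tannery (a : nat -> nat -> R) l G T (B : R) :
  (forall n i, `|a n i| <= G i) ->
  (forall n, \sum_(0 <= i < n) G i <= B) ->
  (forall i, a ^~ i @ \oo --> l i) ->
  (forall n, series (a n) @ \oo --> T n) ->
  cvgn (series l) /\ T @ \oo --> limn (series l).
Proof.
move=> aG GB al aT.
have G0 i : 0 <= G i by apply: le_trans (aG 0%N i); rewrite normr_ge0.
have cG := nonneg_series_cvg G0 GB.
have lG i : `|l i| <= G i.
  have h : (fun n => `|a n i|) @ \oo --> `|l i| by exact: cvg_norm.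
  by apply: (ler_cvg_to h (cvg_cst (G i))); exact: nearW.
have cl : cvgn (series l).
  apply: normed_cvg; apply: (@series_le_cvg _ _ G) => // i; exact: normr_ge0.
split => //; apply: near_cvgn => e e0.
(* The two tails and the difference of the partial sums count for [e / 4]
   each. *)
have e4 : 0 < e / 4 by lra.
have [V _ HV] := cvgn_near cG e4.
have {}HV : limn (series G) - series G V <= e / 4.
  by apply: le_trans (HV V (leqnn V)); rewrite distrC ler_norm.
have cV : (fun n => series (a n) V) @ \oo --> series l V.
  elim: (V) => [|W IH].
    rewrite [X in _ --> X](_ : _ = 0) ?seriesEnat /= ?big_geq //.
    by rewrite [X in X @ _](_ : _ = cst 0); [exact: cvg_cst | apply/funext => n; rewrite seriesEnat /= big_geq].
  rewrite seriesSr [X in X @ _](_ : _ = (fun n => series (a n) W + a n W)).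
    exact: cvgD.
  by apply/funext => n; rewrite seriesSr.
have := cvgn_near cV e4.
apply: filterS => n Hn.
have t1 := dominated_series_tail V cG (aG n) (aT n).
have t2 := dominated_series_tail V cG lG cl.
move: Hn t1 t2 HV; set x := series l V; set y := series (a n) V.
move: (limn _) (limn _) => X Y; rewrite !ler_norml.
move=> /andP[? ?] /andP[? ?] /andP[? ?] ?; apply/andP; split; lra.
Qed.

End Series.

Section Toeplitz.
Context {R : comPzRingType}.

(** The estimator is a sum over lags, whereas its moments are computed on a
    quadratic form over pairs of sample points; this identity passes from one
    to the other. *)
Lemma sum_toeplitz (s : nat -> nat -> R) n : (forall j k, s j k = s k j) ->
  \sum_(0 <= j < n) \sum_(0 <= k < n) s j k =
  \sum_(0 <= j < n) s j j +
  \sum_(1 <= v < n) (\sum_(0 <= j < n - v) s j (j + v)%N) *+ 2.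
Proof.
move=> sC; elim: n => [|n IH]; first by rewrite !big_geq // addr0.
rewrite big_nat_recr //= [in RHS]big_nat_recr //=.
under eq_bigr do rewrite big_nat_recr //=.
rewrite big_split /= IH big_nat_recr //=.
under [X in _ + (X + _) = _]eq_bigr do rewrite sC.
have -> : \sum_(1 <= v < n.+1) (\sum_(0 <= j < n.+1 - v) s j (j + v)%N) *+ 2 =
  \sum_(1 <= v < n) (\sum_(0 <= j < n - v) s j (j + v)%N) *+ 2 +
   (\sum_(0 <= j < n) s j n) *+ 2; last by rewrite mulr2n; ring.
have -> : \sum_(1 <= v < n.+1) (\sum_(0 <= j < n.+1 - v) s j (j + v)%N) *+ 2 =
  \sum_(1 <= v < n.+1) ((\sum_(0 <= j < n - v) s j (j + v)%N) *+ 2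
     + s (n - v)%N n *+ 2).
  apply: eq_big_nat => v /andP[v1 vn].
  by rewrite subSn // big_nat_recr //= subnK // mulrnDl.
rewrite big_split /=; congr (_ + _).
  case: n {IH} => [|n]; first by rewrite !big_geq.
  by rewrite big_nat_recr //= subnn [X in _ + X *+ 2]big_geq // mul0rn addr0.
rewrite sumrMnl; congr (_ *+ 2).
rewrite big_add1 /= big_nat_rev /= add0n; apply: eq_big_nat => v /andP[_ vn].
by congr s; lia.
Qed.

End Toeplitz.

(** * Riemann sums on the half-line *)

Section Riemann.
Context {R : realType}.
Notation mu := (@lebesgue_measure R).
Implicit Types (H f : R -> R).

Lemma Rintegral_sum d (T : measurableType d) (nu : {measure set T -> \bar R})
    (D : set T) (I : Type) (s : seq I) (h : I -> T -> R) : measurable D ->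
  (forall i, nu.-integrable D (EFin \o h i)) ->
  (\int[nu]_(x in D) \sum_(i <- s) h i x)%R = \sum_(i <- s) (\int[nu]_(x in D) h i x)%R.
Proof.
move=> mD hi; elim: s => [|i s IH].
  rewrite big_nil; under eq_Rintegral do rewrite big_nil.
  by rewrite Rintegral_cst // mul0r.
rewrite big_cons -IH -RintegralD //.
  by apply: eq_Rintegral => x _; rewrite big_cons.
have := @integrable_sum _ _ _ nu D mD _ s xpredT (fun i => EFin \o h i) (fun i _ => hi i).
apply: eq_integrable => // x _.
by rewrite /= sumEFin.
Qed.

(** Every summation bound below compares a sum over a grid with an integral,
    which requires monotonicity and not only integrability. The majorants of
    the covariance, of the kernel and of the cumulant are all of this form. *)
Record tail_envelope H : Prop := TailEnvelope {
  env_ge0 : forall x, 0 <= H x ;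
  env_even : forall x, H (- x) = H x ;
  env_mono : forall x y, 0 <= x -> x <= y -> H y <= H x ;
  env_int : mu.-integrable setT (EFin \o H) }.

Lemma env_norm H x : tail_envelope H -> H `|x| = H x.
Proof. by move=> eH; case: (ger0P x) => // _; rewrite (env_even eH). Qed.

(** For [s] below [`|t|] the bound at [t] becomes a bound at [s]: a whole cell
    of a grid is controlled by the end of the cell nearer to the origin. *)
Lemma env_le H f : tail_envelope H -> (forall t, `|f t| <= H t) ->
  forall s t, 0 <= s -> s <= `|t| -> `|f t| <= H s.
Proof.
move=> eH fH s t s0 st; apply: le_trans (fH t) _.
by rewrite -(env_norm _ eH); apply: (env_mono eH).
Qed.

(** The step function whose integral is the Riemann sum of mesh [d]. *)
Definition step (d : R) (N : nat) (F : nat -> R) (t : R) : R :=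
  \sum_(0 <= v < N) F v * \1_(`[v%:R * d, v.+1%:R * d[%classic) t.

Lemma cell_eq (d t : R) (u v : nat) : 0 < d ->
  u%:R * d <= t < u.+1%:R * d -> v%:R * d <= t < v.+1%:R * d -> u = v.
Proof.
move=> d0 /andP[u1 u2] /andP[v1 v2].
have := le_lt_trans u1 v2; have := le_lt_trans v1 u2.
by rewrite !ltr_pM2r // !ltr_nat => ? ?; lia.
Qed.

Lemma step_in (d t : R) N (F : nat -> R) v : 0 < d -> (v < N)%N ->
  v%:R * d <= t < v.+1%:R * d -> step d N F t = F v.
Proof.
move=> d0 vN tv; rewrite /step (bigD1_seq v) ?mem_index_iota ?iota_uniq //=.
rewrite indicE mem_set ?mulr1; last by rewrite /= in_itv.
rewrite big1 ?addr0 // => u uv; rewrite indicE memNset ?mulr0 //=.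
by rewrite in_itv => /(cell_eq d0 tv) /eqP; rewrite eq_sym (negbTE uv).
Qed.

Lemma step_out (d t : R) N (F : nat -> R) :
  (forall v, (v < N)%N -> ~~ (v%:R * d <= t < v.+1%:R * d)) -> step d N F t = 0.
Proof.
move=> h; rewrite /step big_nat big1 // => v vN.
rewrite indicE memNset ?mulr0 //= in_itv /=; exact/negP/h.
Qed.

Lemma step_le (d t : R) N (F : nat -> R) H : 0 < d -> 0 <= t -> (forall x, 0 <= H x) ->
  (forall v (s : R), 0 <= s -> s <= v.+1%:R * d -> `|F v| <= H s) ->
  `|step d N F t| <= H t.
Proof.
move=> d0 t0 H0 FH.
have [[v [vN tv]]|nv] := pselect (exists v, (v < N)%N /\ v%:R * d <= t < v.+1%:R * d).
  by rewrite (step_in _ d0 vN tv) FH //; case/andP: tv => _ /ltW.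
by rewrite step_out ?normr0 // => v vN; apply/negP => tv; apply: nv; exists v.
Qed.

Lemma integrable_cell (D : set R) (d : R) (a : R) (v : nat) : measurable D ->
  mu.-integrable D (EFin \o (fun t => a * \1_(`[v%:R * d, v.+1%:R * d[%classic) t)).
Proof.
move=> mD; apply: (integrableS measurableT) => //.
apply: eq_integrable (integrableZl measurableT a (integrable_indic_itv _ _ _ _ )) => //.
Qed.

Lemma measurable_step (D : set R) (d : R) N (F : nat -> R) : measurable D ->
   measurable_fun D (step d N F).
Proof.
move=> mD; apply: measurable_sum => v.
by apply: measurable_funM => //; exact: measurable_indic.
Qed.

Lemma Rintegral_step (d : R) N (F : nat -> R) : 0 < d ->
  (\int[mu]_(t in `[0, +oo[) step d N F t)%R = d * \sum_(0 <= v < N) F v.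
Proof.
move=> d0; rewrite Rintegral_sum //; last by move=> v; exact: integrable_cell.
rewrite mulr_sumr; apply: eq_bigr => v _.
rewrite RintegralZl //; last first.
  apply: (integrableS measurableT) => //; exact: integrable_indic_itv.
rewrite mulrC; congr (_ * _); rewrite /Rintegral integral_indic //.
rewrite setIidl; last first.
  move=> x /=; rewrite !in_itv /= andbT => /andP[h _]; apply: le_trans h.
  by rewrite mulr_ge0 // ltW.
etransitivity; first by apply: (congr1 fine); exact: (lebesgue_measure_itv `[v%:R * d, v.+1%:R * d[).
rewrite /= lte_fin ltr_pM2r // ltr_nat ltnSn -EFinB /=.
by rewrite -mulrBl -natrB // subSnn mul1r.
Qed.

Lemma env_intD H (D : set R) : tail_envelope H -> measurable D ->
  mu.-integrable D (EFin \o H).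
Proof. by move=> eH mD; apply: integrableS (env_int eH). Qed.

(** The sum is the integral of a step function lying below [H], as [H] is
    sampled at the right end of each cell. *)
Lemma env_sum_le H (d : R) N : tail_envelope H -> 0 < d ->
  d * \sum_(0 <= v < N) H (v.+1%:R * d) <= (\int[mu]_(t in `[0, +oo[) H t)%R.
Proof.
move=> eH d0; rewrite -(Rintegral_step _ _ d0).
have mD : measurable (`[0, +oo[%classic : set R) by [].
have b t : `[0, +oo[%classic t -> `|step d N (fun v => H (v.+1%:R * d)) t| <= H t.
  rewrite /= in_itv /= andbT => t0; apply: step_le => //; first exact: (env_ge0 eH).
  by move=> v s s0 sv; rewrite ger0_norm ?env_ge0 // (env_mono eH).
apply: le_Rintegral => //.
- apply: le_integrable (env_intD eH mD) => //.
    apply/measurable_EFinP; exact: measurable_step.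
  by move=> t Dt /=; rewrite lee_fin (le_trans (b _ Dt)) // ler_norm.
- exact: env_intD.
by move=> t Dt; apply: le_trans (b t Dt); exact: ler_norm.
Qed.

(** Riemann sums whose summands vary with the mesh: the step functions
    converge pointwise and are dominated by [H], so that dominated convergence
    applies. The hypothesis on [F] along sequences of grid points tending to
    [t] is the form in which the kernel limit at the origin, evaluated at
    [b v], enters. *)
Lemma riemann (d : nat -> R) (N : nat -> nat) (F : nat -> nat -> R) f H :
  (forall n, 0 < d n) -> d @ \oo --> 0 -> (fun n => (N n)%:R * d n) @ \oo --> +oo ->
  tail_envelope H -> measurable_fun (`[0, +oo[%classic : set R) f ->
  (forall n v (s : R), 0 <= s -> s <= v.+1%:R * d n -> `|F n v| <= H s) ->
  (forall t : R, 0 <= t -> forall v : nat -> nat,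
     (fun n => (v n).+1%:R * d n) @ \oo --> t -> (fun n => F n (v n)) @ \oo --> f t) ->
  (fun n => d n * \sum_(0 <= v < N n) F n v) @ \oo -->
    (\int[mu]_(t in `[0, +oo[) f t)%R.
Proof.
move=> d0 dc Nd eH mf FH Ff.
have mD : measurable (`[0, +oo[%classic : set R) by [].
under eq_fun do rewrite -(Rintegral_step _ _ (d0 _)).
have [|||||i1 _ i2] := @dominated_convergence _ _ R mu `[0, +oo[%classic mD
  (fun n => EFin \o step (d n) (N n) (F n)) (EFin \o f) (EFin \o H).
- by move=> n; apply/measurable_EFinP; exact: measurable_step.
- exact/measurable_EFinP.
- apply/aeW => t /=; rewrite in_itv /= andbT => t0.
  pose v n := Num.truncn (t / d n).
  have vP n : (v n)%:R * d n <= t < (v n).+1%:R * d n.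
    by rewrite -ler_pdivlMr // -ltr_pdivrMr // truncn_itv // divr_ge0 // ltW.
  have vt : (fun n => (v n).+1%:R * d n) @ \oo --> t.
    apply: near_cvgn => e e0; have := cvgn_near dc e0.
    apply: filterS => n; rewrite subr0 => /(le_trans (ler_norm _)) de.
    have /andP[v1 v2] := vP n; rewrite ger0_norm; last by rewrite subr_ge0 ltW.
    by rewrite (le_trans _ de) // lerBlDr mulrSr mulrDl mul1r addrC lerD2l.
  have h : (fun n => (F n (v n))%:E) @ \oo --> (f t)%:E.
    by apply: cvg_EFin; [exact: nearW | exact: Ff].
  apply: cvg_trans h; apply: near_eq_cvg.
  move/cvgryPgt: (Nd) => /(_ t); apply: filterS => n Nt /=.
  rewrite (step_in _ (d0 n) _ (vP n)) //.
  have /andP[v1 v2] := vP n; have := le_lt_trans v1 Nt.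
  by rewrite ltr_pM2r // ltr_nat.
- exact: env_intD.
- apply/aeW => t n /=; rewrite in_itv /= andbT => t0; rewrite lee_fin.
  apply: step_le => //; [exact: (env_ge0 eH) | exact: FH].
apply: fine_cvg; rewrite fineK //; exact: integrable_fin_num.
Qed.

End Riemann.

(** * The Fejer kernel *)

Section Fejer.
Context {R : realType}.
Implicit Types (x y : R).

Lemma sin_natmul_pi n : sin (n%:R * pi) = 0 :> R.
Proof.
elim: n => [|n IH]; first by rewrite mul0r sin0.
by rewrite mulrSr mulrDl mul1r sinDpi IH oppr0.
Qed.

Lemma cosD_natmul2pi n x : cos (x + n%:R * (2 * pi)) = cos x.
Proof.
elim: n => [|n IH]; first by rewrite mul0r addr0.
rewrite mulrSr mulrDl mul1r addrA -[2 * pi]/(2%:R * pi) mulr_natl cosD2pi.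
by rewrite -mulr_natl IH.
Qed.

(** The squared modulus of a sum of exponentials divided by [N], that is, the
    Fejer kernel written without complex numbers. *)
Definition fejer (N : nat) (x : R) : R :=
  N%:R^-1 * ((\sum_(0 <= k < N) cos (k%:R * x)) ^+ 2 +
             (\sum_(0 <= k < N) sin (k%:R * x)) ^+ 2).

Lemma fejer_ge0 N x : 0 <= fejer N x.
Proof. by rewrite mulr_ge0 // addr_ge0 // sqr_ge0. Qed.

(** The expansion of the squared modulus over differences of indices: the
    nonnegativity of the left side and the triangular weights on the right are
    the two faces of the kernel used for Poisson summation. *)
Lemma fejer_sum N x :
  fejer N.+1 x = 1 + 2 * \sum_(1 <= v < N.+1) (1 - v%:R / N.+1%:R) * cos (v%:R * x).
Proof.
have cC y z : cos (y - z) = cos (z - y) :> R by rewrite -cosN opprB.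
have -> : fejer N.+1 x = N.+1%:R^-1 *
   \sum_(0 <= j < N.+1) \sum_(0 <= k < N.+1) cos (j%:R * x - k%:R * x).
  congr (_ * _); rewrite !expr2 !big_distrlr /= -big_split; apply: eq_bigr => j _.
  by rewrite -big_split; apply: eq_bigr => k _; rewrite cosB.
rewrite sum_toeplitz; last by move=> j k; exact: cC.
have N0 : N.+1%:R != 0 :> R by [].
under eq_bigr do rewrite subrr cos0.
rewrite big_const_nat iter_addr_0 subn0 mulrDr mulVf //; congr (_ + _).
rewrite !mulr_sumr; apply: eq_big_nat => v /andP[v1 vN].
rewrite (eq_bigr (fun=> cos (v%:R * x))); last first.
  by move=> j _; rewrite -cosN -mulrBl natrD; congr cos; ring.
rewrite big_const_nat iter_addr_0 subn0 -(mulr_natl (cos _) (N.+1 - v)) natrB; last exact: ltnW.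
by field.
Qed.

Lemma fejer_le N x : fejer N x <= 2 * N%:R.
Proof.
have b (g : R -> R) : (forall y, `|g y| <= 1) -> (\sum_(0 <= k < N) g (k%:R * x)) ^+ 2 <= N%:R ^+ 2.
  move=> g1; rewrite -real_normK ?num_real // lerXn2r ?nnegrE //.
  apply: le_trans (ler_norm_sum _ _ _) _.
  apply: (@le_trans _ _ (\sum_(0 <= k < N) 1)); first exact: ler_sum.
  by rewrite big_const_nat iter_addr_0 subn0.
have [->|N0] := eqVneq N 0%N; first by rewrite /fejer invr0 !mul0r mulr0.
have N0' : 0 < N%:R :> R by rewrite ltr0n lt0n.
rewrite /fejer ler_pdivrMl //; apply: le_trans (lerD (b _ (@cos_max R)) (b _ (@sin_max R))) _.
by rewrite le_eqVlt; apply/orP; left; apply/eqP; ring.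
Qed.

Lemma sin_half_sum N x :
  2 * sin (x / 2) * \sum_(0 <= k < N) cos (k%:R * x) =
  sin ((N%:R - 1 / 2) * x) + sin (x / 2) /\
  2 * sin (x / 2) * \sum_(0 <= k < N) sin (k%:R * x) =
  cos (x / 2) - cos ((N%:R - 1 / 2) * x).
Proof.
elim: N => [|N [IH1 IH2]].
  rewrite !big_geq // !mulr0 sub0r mulNr mul1r mulrC sinN cosN; split; ring.
have e1 : (N.+1%:R - 1 / 2) * x = N%:R * x + x / 2 by rewrite mulrSr; field.
have e2 : (N%:R - 1 / 2) * x = N%:R * x - x / 2 by field.
rewrite !big_nat_recr //= !mulrDr IH1 IH2 e1 e2 sinB cosB sinD cosD; split; ring.
Qed.

(** Multiplication by [2 sin (x / 2)] makes the two trigonometric sums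
    telescope; the squared modulus of the result is at most 4. *)
Lemma fejer_sin N x : fejer N x * sin (x / 2) ^+ 2 <= N%:R^-1.
Proof.
have [h1 h2] := sin_half_sum N x.
have -> : fejer N x * sin (x / 2) ^+ 2 = N%:R^-1 / 4 *
  ((2 * sin (x / 2) * \sum_(0 <= k < N) cos (k%:R * x)) ^+ 2 +
   (2 * sin (x / 2) * \sum_(0 <= k < N) sin (k%:R * x)) ^+ 2).
  by rewrite /fejer; move: (N%:R^-1) => c; field.
rewrite h1 h2 -mulrA ler_piMr //.
set y := (_ - _) * x; have := cos2Dsin2 y; have := cos2Dsin2 (x / 2).
have : 0 <= (sin y - sin (x / 2)) ^+ 2 by rewrite sqr_ge0.
have : 0 <= (cos y + cos (x / 2)) ^+ 2 by rewrite sqr_ge0.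
by rewrite !sqrrD !sqrrN; nra.
Qed.

Lemma fejerD N v x : fejer N (x + v%:R * (2 * pi)) = fejer N x.
Proof.
case: N => [|N]; first by rewrite /fejer invr0 !mul0r.
rewrite !fejer_sum; congr (_ + _ * _); apply: eq_bigr => k _.
by congr (_ * _); rewrite mulrDr mulrA -natrM cosD_natmul2pi.
Qed.

Lemma cvg_sum_nat (T : Type) (F : set_system T) {FF : Filter F}
    (f : nat -> T -> R) (l : nat -> R) m n :
  (forall k, f k @ F --> l k) ->
  (fun t => \sum_(m <= k < n) f k t) @ F --> \sum_(m <= k < n) l k.
Proof.
move=> fl; rewrite /index_iota; elim: (iota _ _) => [|k s IH].
  by rewrite big_nil; under eq_cvg do rewrite big_nil; exact: cvg_cst.
by rewrite big_cons; under eq_cvg do rewrite big_cons; exact: cvgD.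
Qed.

Lemma continuous_fejer N : continuous (fejer N).
Proof.
move=> x; apply: cvgMl_tmp.
have cs (g : R -> R) : continuous g ->
    (\sum_(0 <= k < N) g (k%:R * y)) ^+ 2 @[y --> x] --> (\sum_(0 <= k < N) g (k%:R * x)) ^+ 2.
  move=> cg; rewrite expr2; under eq_cvg do rewrite expr2.
  have h : (\sum_(0 <= k < N) g (k%:R * y)) @[y --> x] --> \sum_(0 <= k < N) g (k%:R * x).
    apply: cvg_sum_nat => k; apply: (continuous_cvg _ (cg _)).
    by apply: cvgMl_tmp; exact: cvg_id.
  exact: cvgM.
by apply: cvgD; apply: cs; [exact: continuous_cos | exact: continuous_sin].
Qed.

End Fejer.

(** * The Fejer kernel as an approximate identity on one period *)

Section FejerCells.
Context {R : realType}.
Notation mu := (@lebesgue_measure R).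
Implicit Types (f g H : R -> R) (a b c t : R).

Lemma continuous_itv_integrable g a b : continuous g ->
  mu.-integrable `[a, b] (EFin \o g).
Proof.
move=> cg; apply: continuous_compact_integrable; first exact: segment_compact.
exact: continuous_subspaceT.
Qed.

Lemma Rintegral_itv_cat g a b c : continuous g -> a <= b -> b <= c ->
  (\int[mu]_(t in `[a, b]) g t + \int[mu]_(t in `[b, c]) g t)%R =
  (\int[mu]_(t in `[a, c]) g t)%R.
Proof.
move=> cg ab bc.
have := @Rintegral_itvB _ g (BLeft a) (BRight c) b (continuous_itv_integrable _ _ cg).
rewrite !bnd_simp => /(_ ab bc) h; rewrite -(@Rintegral_itv_obnd_cbnd _ b).
  by rewrite -h addrC subrK.
apply: integrableS (continuous_itv_integrable b c cg) => //.
exact: subset_itv_oc_cc.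
Qed.

Lemma Rintegral_itv_cst a b c : a <= b ->
  (\int[mu]_(t in `[a, b]) c)%R = c * (b - a).
Proof.
move=> ab; rewrite Rintegral_cst //; congr (_ * _).
etransitivity; first by apply: (congr1 fine); exact: (lebesgue_measure_itv `[a, b]).
rewrite /= lte_fin; case: ltP => [_|ba]; first by rewrite -EFinB.
by rewrite (@le_anti _ _ a b) ?ab ?ba // subrr.
Qed.

Lemma Rintegral_exhaust g (u v : nat -> R) : mu.-integrable setT (EFin \o g) ->
  u @ \oo --> -oo -> v @ \oo --> +oo ->
  (fun n => \int[mu]_(t in `[u n, v n]) g t)%R @ \oo --> (\int[mu]_t g t)%R.
Proof.
move=> ig uy vy.
have mg : measurable_fun setT g by apply/measurable_EFinP; exact: measurable_int ig.
under eq_fun do rewrite Rintegral_mkcond.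
have [|||||i1 _ i2] := @dominated_convergence _ _ R mu setT measurableT
  (fun n => EFin \o (g \_ `[u n, v n])) (EFin \o g) (fun t => `|(g t)%:E|%E).
- move=> n; apply/measurable_EFinP.
  apply/(@measurable_restrictT _ _ _ _ `[u n, v n]%classic) => //; exact: measurable_funS mg.
- exact/measurable_EFinP.
- apply/aeW => t _; apply: cvg_near_cst.
  move/cvgrNyPle : (uy) => /(_ t) ut; move/cvgryPge : (vy) => /(_ t) vt.
  near=> n; rewrite /= patchE mem_set //= in_itv /=; apply/andP; split.
    by near: n; exact: ut.
  by near: n; exact: vt.
- exact: integrable_abse.
- apply/aeW => t n _ /=; rewrite patchE; case: ifP => // _.
  by rewrite normr0 lee_fin.
by apply: fine_cvg; rewrite fineK //; exact: integrable_fin_num.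
Unshelve. all: by end_near. Qed.

Lemma int_cos_cell (k : nat) c (L : R) : 0 < L -> (0 < k)%N ->
  (\int[mu]_(t in `[(c - L / 2)%R, (c + L / 2)%R]) cos (k%:R * (2 * pi * (t - c) / L)))%R = 0.
Proof.
move=> L0 k0; have kn0 : k%:R != 0 :> R by rewrite pnatr_eq0 -lt0n.
have pi0 : pi != 0 :> R by rewrite gt_eqF // pi_gt0.
pose w := k%:R * (2 * pi) / L : R.
have w0 : w != 0 by rewrite !mulf_neq0 // ?invr_eq0 ?gt_eqF.
have -> : (fun t => cos (k%:R * (2 * pi * (t - c) / L))) = (fun t => cos (w * (t - c))).
  by apply/funext => t; congr cos; rewrite /w; field; rewrite gt_eqF.
pose F t := w^-1 * sin (w * (t - c)).
have dF t : is_derive t 1 F (cos (w * (t - c))).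
  have : is_derive t 1 F (w^-1 *: (cos (w * (t - c)) *: (w *: (1 - 0)))).
    by apply: is_deriveZ.
  by move=> h; apply: is_derive_eq h _; rewrite subr0 /GRing.scale /=; field.
have cF t : {for t, continuous F}.
  by apply/differentiable_continuous/derivable1_diffP; exact: (@ex_derive _ _ _ _ _ _ _ (dF t)).
have e1 : w * (c + L / 2 - c) = k%:R * pi by rewrite /w; field; rewrite gt_eqF.
have e2 : w * (c - L / 2 - c) = - (k%:R * pi) by rewrite /w; field; rewrite gt_eqF.
rewrite /Rintegral (@continuous_FTC2 _ _ F).
- by rewrite /F e1 e2 sinN sin_natmul_pi /= oppr0 mulr0 subrr.
- by rewrite ltrD2l gtrN // divr_gt0.
- apply: continuous_subspaceT => t; apply: (continuous_cvg _ (@continuous_cos R _)).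
  by apply: cvgMl_tmp; apply: cvgB; [exact: cvg_id | exact: cvg_cst].
- split.
  + by move=> t _; exact: (@ex_derive _ _ _ _ _ _ _ (dF t)).
  + by apply: cvg_at_right_filter; exact: cF.
  + by apply: cvg_at_left_filter; exact: cF.
- by move=> t _; rewrite derive1E; exact: (@derive_val _ _ _ _ _ _ _ (dF t)).
Qed.

Let ang c (L : R) t : R := 2 * pi * (t - c) / L.

Lemma continuous_ang c L : continuous (ang c L).
Proof.
move=> t; apply: cvgMr_tmp; apply: cvgMl_tmp.
by apply: cvgB; [exact: cvg_id | exact: cvg_cst].
Qed.

Lemma continuous_fejer_ang N c L : continuous (fun t => fejer N (2 * pi * (t - c) / L)).
Proof.
move=> t; apply: (continuous_cvg _ (@continuous_fejer R N _)).
exact: continuous_ang.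
Qed.

Lemma fejer_cell_int N c (L : R) : 0 < L ->
  (\int[mu]_(t in `[(c - L / 2)%R, (c + L / 2)%R]) fejer N.+1 (2 * pi * (t - c) / L))%R = L.
Proof.
move=> L0; have cc : c - L / 2 <= c + L / 2 by rewrite lerD2l ge0_cp // divr_ge0 // ltW.
under eq_Rintegral do rewrite fejer_sum.
have ck k : continuous (fun t : R => (1 - k%:R / N.+1%:R) * cos (k%:R * (2 * pi * (t - c) / L))).
  move=> t; apply: cvgMl_tmp; apply: (continuous_cvg _ (@continuous_cos R _)).
  by apply: cvgMl_tmp; exact: continuous_ang.
have cs : continuous (fun t : R => \sum_(1 <= v < N.+1) (1 - v%:R / N.+1%:R) *
   cos (v%:R * (2 * pi * (t - c) / L))).
  by move=> t; apply: cvg_sum_nat => k; exact: ck.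
rewrite RintegralD //; last 2 first.
- exact: (@continuous_itv_integrable (cst 1)) (@cst_continuous _ _ _).
- apply: (@continuous_itv_integrable (fun t => 2 * _)) => t; apply: cvgMl_tmp; exact: cs.
rewrite Rintegral_itv_cst // RintegralZl //; last exact: continuous_itv_integrable cs.
rewrite Rintegral_sum //; last by move=> k; exact: continuous_itv_integrable (ck k).
rewrite big_nat_cond big1 ?mulr0 ?addr0; first by field.
move=> k /andP[/andP[k1 _] _]; rewrite RintegralZl //.
  by rewrite int_cos_cell ?mulr0.
apply: (@continuous_itv_integrable (fun t => cos _)) => t.
apply: (continuous_cvg _ (@continuous_cos R _)); apply: cvgMl_tmp; exact: continuous_ang.
Qed.

End FejerCells.

Section FejerLocalization.
Context {R : realType}.
Notation mu := (@lebesgue_measure R).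
Implicit Types (f g H : R -> R) (a b c t : R).

Lemma continuous_itv_bounded g a b : continuous g -> a <= b ->
  exists2 B, 0 <= B & forall t, a <= t <= b -> `|g t| <= B.
Proof.
move=> cg ab; have [|m mab mm] := @EVT_max _ (fun t => `|g t|) a b ab.
  by apply: continuous_subspaceT => t; apply: cvg_norm; exact: cg.
by exists `|g m| => // t tab; apply: mm; rewrite in_itv.
Qed.

Lemma sin_sqr_norm t : sin `|t| ^+ 2 = sin t ^+ 2.
Proof. by case: (ger0P t) => // _; rewrite sinN sqrrN. Qed.

Lemma ler_sin_sqr s t : 0 <= s -> s <= `|t| -> `|t| <= pi / 2 ->
  sin s ^+ 2 <= sin t ^+ 2.
Proof.
move=> s0 st tp; rewrite -(sin_sqr_norm t).
have pp : 0 <= pi :> R := pi_ge0 R.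
have s1 : s \in `[(- (pi / 2)), (pi / 2)] by rewrite in_itv /=; apply/andP; split; lra.
have t1 : `|t| \in `[(- (pi / 2)), (pi / 2)] by rewrite in_itv /=; apply/andP; split; lra.
rewrite lerXn2r ?nnegrE //.
- by apply: sin_ge0_pi; apply/andP; split; lra.
- by apply: sin_ge0_pi; apply/andP; split; lra.
by rewrite leNgt ltr_sin // -leNgt.
Qed.

(** On a period centred at [c] the kernel has mass [L], concentrates at [c]
    and is [O(1 / N)] away from it by [fejer_sin]; continuity of [f] at [c]
    gives the limit. *)
Lemma fejer_cell_cvg f c (L : R) : continuous f -> 0 < L ->
  (fun N => \int[mu]_(t in `[(c - L / 2)%R, (c + L / 2)%R])
     (f t * fejer N.+1 (2 * pi * (t - c) / L)))%R @ \oo --> L * f c.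
Proof.
move=> cf L0; apply: near_cvgn => e e0.
have cc : c - L / 2 <= c + L / 2 by rewrite lerD2l ge0_cp // divr_ge0 // ltW.
have [B B0 fB] := continuous_itv_bounded cf cc.
pose e' := e / (2 * L); have e'0 : 0 < e' by rewrite divr_gt0 // mulr_gt0.
have [d0 /= d00 fd0] : exists2 d0 : R, 0 < d0 & forall t, `|t - c| < d0 -> `|f t - f c| <= e'.
  have /cvgrPdist_le /(_ e' e'0) /nbhs_ballP [d0 /= d00 h] := cf c.
  by exists d0 => // t tc; rewrite distrC; apply: h; rewrite /ball /= distrC.
(* Within distance [d] of [c] continuity is used, beyond it the decay of the
   kernel; [s] bounds the squared sine below there. *)
pose d := Num.min d0 (L / 2).
have dd : 0 < d by rewrite lt_min d00 divr_gt0.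
have pi0 := pi_gt0 R.
pose s := sin (pi * d / L) ^+ 2.
have s0 : 0 < s.
  rewrite exprn_gt0 // sin_gt0_pi // divr_gt0 ?mulr_gt0 //= -mulrA gtr_pMr //.
  rewrite ltr_pdivrMr // mul1r; apply: (@le_lt_trans _ _ (L / 2)).
    by rewrite ge_min lexx orbT.
  by rewrite ltr_pdivrMr // mulr_natr mulr2n ltrDl.
have sB0 : 0 <= 2 * B / s by apply: divr_ge0; [apply: mulr_ge0 | apply: ltW].
have sB N : 0 <= 2 * B / s / N.+1%:R by apply: divr_ge0.
have cfe N := @continuous_fejer_ang R N c L.
have key N t : c - L / 2 <= t <= c + L / 2 ->
  `|(f t - f c) * fejer N.+1 (2 * pi * (t - c) / L)| <=
  e' * fejer N.+1 (2 * pi * (t - c) / L) + 2 * B / s / N.+1%:R.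
  move=> tc; set F := fejer _ _.
  have F0 : 0 <= F := fejer_ge0 _ _.
  rewrite normrM (ger0_norm F0).
  have [tcd|tcd] := ltP `|t - c| d.
    apply: (@le_trans _ _ (e' * F)).
      apply: ler_wpM2r => //; apply: fd0; apply: lt_le_trans tcd _.
      by rewrite ge_min lexx.
    by rewrite lerDl.
  apply: (@le_trans _ _ (2 * B / s / N.+1%:R)); last by rewrite lerDr mulr_ge0 // ltW.
  have fB2 : `|f t - f c| <= 2 * B.
    apply: le_trans (ler_normB _ _) _; rewrite mulr_natl mulr2n lerD ?fB //.
    by rewrite gerDl lerDl oppr_le0 andbb divr_ge0 // ltW.
  apply: le_trans (ler_wpM2r F0 fB2) _; rewrite -!mulrA ler_wpM2l // ler_wpM2l //.
  rewrite ler_pdivlMl //; apply: le_trans (fejer_sin N.+1 (2 * pi * (t - c) / L)).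
  rewrite -/F mulrC ler_wpM2l //.
  have -> : 2 * pi * (t - c) / L / 2 = pi * (t - c) / L by field; rewrite gt_eqF.
  have -> : pi * (t - c) / L = pi / L * (t - c) by rewrite mulrAC.
  rewrite /s; have -> : pi * d / L = pi / L * d by rewrite mulrAC.
  have pL : 0 < pi / L by rewrite divr_gt0.
  apply: ler_sin_sqr; first by rewrite mulr_ge0 // ltW.
    by rewrite normrM (gtr0_norm pL) ler_wpM2l // ltW.
  rewrite normrM (gtr0_norm pL).
  have -> : pi / 2 = pi / L * (L / 2) by field; rewrite gt_eqF.
  by rewrite ler_wpM2l ?(ltW pL) // ler_norml; case/andP: tc => ? ?; apply/andP; split; lra.
have int N : `|(\int[mu]_(t in `[(c - L / 2)%R, (c + L / 2)%R])
     (f t * fejer N.+1 (2 * pi * (t - c) / L)))%R - L * f c| <=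
     e' * L + 2 * B / s * L / N.+1%:R.
  have i1 g : continuous g -> mu.-integrable `[(c - L / 2)%R, (c + L / 2)%R]
     (EFin \o (fun t => g t * fejer N.+1 (2 * pi * (t - c) / L))).
    by move=> cg; apply: continuous_itv_integrable => t; apply: cvgM; [exact: cg | exact: cfe].
  have ic k : continuous (fun t : R => k : R) by move=> t; exact: cvg_cst.
  have -> : L * f c = (\int[mu]_(t in `[(c - L / 2)%R, (c + L / 2)%R])
     (f c * fejer N.+1 (2 * pi * (t - c) / L)))%R.
    by rewrite RintegralZl ?fejer_cell_int 1?mulrC //; exact: continuous_itv_integrable.
  rewrite -RintegralB //; [|exact: i1|exact: i1 (ic _)].
  have cB : continuous (fun t => f t - f c).
    by move=> t; apply: cvgB; [exact: cf | exact: cvg_cst].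
  under eq_Rintegral do rewrite -mulrBl.
  apply: le_trans (le_normr_Rintegral _ _) _ => //; first exact: i1 cB.
  have -> : e' * L + 2 * B / s * L / N.+1%:R = (\int[mu]_(t in `[(c - L / 2)%R, (c + L / 2)%R])
     (e' * fejer N.+1 (2 * pi * (t - c) / L) + 2 * B / s / N.+1%:R))%R.
    rewrite RintegralD //; [|exact: i1|exact: continuous_itv_integrable (ic _)].
    rewrite RintegralZl ?fejer_cell_int //; last exact: continuous_itv_integrable.
    rewrite Rintegral_itv_cst //; congr (_ + _).
    have -> : c + L / 2 - (c - L / 2) = L by field.
    by rewrite mulrAC.
  apply: le_Rintegral => //.
  - apply: (@continuous_itv_integrable _ (fun t => `|_|)) => t; apply: cvg_norm.
    by apply: cvgM; [exact: cB | exact: cfe].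
  - apply: continuous_itv_integrable => t; apply: cvgD; last exact: cvg_cst.
    by apply: cvgMl_tmp; exact: cfe.
  by move=> t; rewrite /= in_itv /=; exact: key.
have e2 : 0 < e / 2 by rewrite divr_gt0.
have c0 : (fun N => 2 * B / s * L / N.+1%:R) @ \oo --> 0.
  rewrite -[X in _ --> X](mulr0 (2 * B / s * L)); apply: cvgMl_tmp; exact: cvg_harmonic.
have := cvgn_near c0 e2; apply: filterS => N; rewrite subr0 => /(le_trans (ler_norm _)) hN.
apply: le_trans (int N) _; apply: le_trans (lerD (lexx _) hN) _.
have -> : e' * L = e / 2 by rewrite /e'; field; rewrite gt_eqF.
by rewrite -splitr.
Qed.

End FejerLocalization.

(** * Poisson summation *)

Section PoissonSummation.
Context {R : realType}.
Notation mu := (@lebesgue_measure R).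
Implicit Types (f g H : R -> R) (a b c t : R).

Lemma env_cvg_integrable H f : tail_envelope H -> continuous f ->
  (forall t, `|f t| <= H t) -> mu.-integrable setT (EFin \o f).
Proof.
move=> eH cf fH; apply: le_integrable (env_int eH) => //.
  by apply/measurable_EFinP; exact: continuous_measurable_fun.
by move=> t _ /=; rewrite lee_fin (le_trans (fH t)) // ler_norm.
Qed.

(** The cells of the lattice are numbered from [t0], which may be [m] cells
    away from the origin; only these first [m] cells escape the comparison
    with the integral. *)
Lemma env_shifted_sum_le H (d : R) m n : tail_envelope H -> 0 < d ->
  d * \sum_(0 <= i < n) H ((i - m)%N%:R * d) <=
  d * (m.+1%:R * H 0) + (\int[mu]_(t in `[0%R, +oo[) H t)%R.
Proof.
move=> eH d0.
apply: (@le_trans _ _ (d * \sum_(0 <= i < m.+1 + n) H ((i - m)%N%:R * d))).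
  rewrite ler_wpM2l ?(ltW d0) // [leRHS](big_cat_nat (leq0n n) (leq_addl _ _)) /=.
  by rewrite lerDl sumr_ge0 // => i _; exact: (env_ge0 eH).
rewrite (big_cat_nat (leq0n m.+1) (leq_addr _ _)) /= mulrDr lerD //.
  rewrite ler_wpM2l ?(ltW d0) //.
  rewrite big_nat (eq_bigr (fun=> H 0)); last first.
    by move=> i /andP[_ im]; rewrite (_ : (i - m)%N = 0%N) ?mul0r //; lia.
  by rewrite -big_nat big_const_nat iter_addr_0 subn0 mulr_natl.
rewrite -{1}[m.+1]add0n big_addn addKn.
rewrite (eq_bigr (fun i => H (i.+1%:R * d))); first exact: env_sum_le.
by move=> i _; rewrite (_ : (i + m.+1 - m)%N = i.+1) //; lia.
Qed.

Lemma natmul_cvgy (d : R) : 0 < d -> (fun n => n%:R * d) @ \oo --> +oo.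
Proof.
move=> d0; apply/cvgryPge => A; have := nbhs_infty_ger (A / d).
by apply: filterS => n; rewrite ler_pdivrMr.
Qed.

Lemma fejer_integrable H f N c (L : R) : tail_envelope H -> continuous f ->
  (forall t, `|f t| <= H t) ->
  mu.-integrable setT (EFin \o (fun t => f t * fejer N (2 * pi * (t - c) / L))).
Proof.
move=> eH cf fH.
apply: (@le_integrable _ _ _ mu setT measurableT _ (fun t => (2 * N%:R)%:E * (H t)%:E)%E).
- apply/measurable_EFinP; apply: continuous_measurable_fun => t.
  by apply: cvgM; [exact: cf | exact: continuous_fejer_ang].
- move=> t _; rewrite /= lee_fin (mulrC (f t)) normrM [X in _ <= X]normrM ler_pM //.
    by rewrite ger0_norm ?fejer_ge0 // (le_trans (fejer_le _ _)) // ler_norm.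
  by rewrite (le_trans (fH t)) // ler_norm.
exact: integrableZl (env_int eH).
Qed.

(** Poisson summation in a form that involves no transform: a Fejer kernel of
    period [L] is an approximate identity on each cell centred at a lattice
    point, and the cells are summed by [tannery]. Expanding the same kernel in
    cosines, as in [fejer_expansion], turns the left side into means of
    transforms. The lattice points are paired as [t0 + i L] and
    [t0 - (i + 1) L]. *)
Theorem poisson f H (t0 L : R) : continuous f -> tail_envelope H ->
  (forall t, `|f t| <= H t) -> 0 < L ->
  let l i := L * (f (t0 + i%:R * L) + f (t0 - i.+1%:R * L)) in
  cvgn (series l) /\
  (fun N => \int[mu]_t (f t * fejer N.+1 (2 * pi * (t - t0) / L)))%R @ \oo
     --> limn (series l).
Proof.
move=> cf eH fH L0 l.
pose g N t := f t * fejer N.+1 (2 * pi * (t - t0) / L).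
have cg N : continuous (g N).
  by move=> t; apply: cvgM; [exact: cf | exact: continuous_fejer_ang].
pose J N c := (\int[mu]_(t in `[(c - L / 2)%R, (c + L / 2)%R]) g N t)%R.
(* The cells numbered [i] are at distance at least [(i - m) L] from the
   origin, whichever side of [t0] they are on. *)
pose m := (Num.truncn (`|t0| / L)).+2.
have tm : `|t0| <= m%:R * L - L / 2.
  have := truncnS_gt (`|t0| / L); rewrite ltr_pdivrMr // => /ltW h.
  by apply: le_trans h _; rewrite /m [in leRHS]mulrSr; lra.
pose S i := H ((i - m)%N%:R * L).
have mL i : (i - m)%N%:R * L <= i%:R * L - m%:R * L \/ (i - m)%N = 0%N.
  have [im|im] := leqP m i; last by right; lia.
  by left; rewrite natrB // mulrBl.
have Sb i t : (i%:R - 1 / 2) * L - `|t0| <= `|t| -> `|f t| <= S i.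
  move=> h; apply: (env_le eH fH); first by rewrite mulr_ge0 // ltW.
  case: (mL i) => [e|->]; last by rewrite mul0r.
  by apply: le_trans e _; apply: le_trans h; lra.
have per N c i : (c = t0 + i%:R * L \/ c = t0 - i.+1%:R * L) ->
   forall t, g N t = f t * fejer N.+1 (2 * pi * (t - c) / L).
  move=> ci t; rewrite /g; congr (_ * _); case: ci => ->.
    rewrite -(fejerD _ i (2 * pi * (t - (t0 + i%:R * L)) / L)); congr fejer; field.
    by rewrite gt_eqF.
  rewrite -(fejerD _ i.+1 (2 * pi * (t - t0) / L)); congr fejer; field.
  by rewrite gt_eqF.
have Jb N c i : (c = t0 + i%:R * L \/ c = t0 - i.+1%:R * L) -> `|J N c| <= L * S i.
  move=> ci.
  rewrite /J; under eq_Rintegral do rewrite (per N c i ci).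
  have cfe := @continuous_fejer_ang R N.+1 c L.
  have cgf : continuous (fun t => f t * fejer N.+1 (2 * pi * (t - c) / L)).
    by move=> t; apply: cvgM; [exact: cf | exact: cfe].
  apply: le_trans (le_normr_Rintegral _ _) _ => //; first exact: continuous_itv_integrable.
  have -> : L * S i = (\int[mu]_(t in `[(c - L / 2)%R, (c + L / 2)%R])
      (S i * fejer N.+1 (2 * pi * (t - c) / L)))%R.
    rewrite RintegralZl //; last exact: continuous_itv_integrable.
    by rewrite fejer_cell_int // mulrC.
  apply: le_Rintegral => //.
  - apply: (@continuous_itv_integrable _ (fun t => `|_|)) => t; apply: cvg_norm; exact: cgf.
  - by apply: continuous_itv_integrable => t; apply: cvgMl_tmp; exact: cfe.
  move=> t; rewrite /= in_itv /= => /andP[t1 t2].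
  rewrite normrM (ger0_norm (fejer_ge0 _ _)) ler_wpM2r ?fejer_ge0 //; apply: Sb.
  have n1 := ler_norm t0; have n2 := ler_normr t0; have n3 := ler_norm (- t0).
  rewrite normrN in n3; have n4 := ler_norm t; have n5 := ler_norm (- t).
  rewrite normrN in n5; case: ci => ci; rewrite {}ci in t1 t2; first lra.
  by rewrite mulrSr in t1 t2; lra.
have int0 := @fejer_integrable H f _ t0 L eH cf fH.
apply: (@tannery _ (fun N i => J N (t0 + i%:R * L) + J N (t0 - i.+1%:R * L)) l
  (fun i => 2 * (L * S i)) _
  (2 * (L * (m.+1%:R * H 0) + (\int[mu]_(t in `[0%R, +oo[) H t)%R))).
- move=> N i; apply: le_trans (ler_normD _ _) _.
  by rewrite (mulr_natl _ 2) mulr2n lerD // Jb //; [left | right].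
- move=> n; rewrite -mulr_sumr ler_wpM2l // -mulr_sumr; exact: env_shifted_sum_le.
- move=> i; rewrite /l mulrDr; apply: cvgD.
    rewrite /J; under eq_cvg do under eq_Rintegral do rewrite (per _ (t0 + i%:R * L) i (or_introl erefl)).
    exact: fejer_cell_cvg.
  rewrite /J; under eq_cvg do under eq_Rintegral do rewrite (per _ (t0 - i.+1%:R * L) i (or_intror erefl)).
  exact: fejer_cell_cvg.
move=> N.
have sE W : series (fun i => J N (t0 + i%:R * L) + J N (t0 - i.+1%:R * L)) W =
  (\int[mu]_(t in `[(t0 - L / 2 - W%:R * L)%R, (t0 - L / 2 + W%:R * L)%R]) g N t)%R.
  elim: W => [|W IH].
    by rewrite seriesEnat /= big_geq // mul0r subr0 addr0 set_itv1 Rintegral_set1.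
  rewrite seriesSr IH /J.
  have WS : W.+1%:R = W%:R + 1 :> R by rewrite -natr1.
  have WL : 0 <= W%:R * L by rewrite mulr_ge0 // ltW.
  rewrite -[RHS](@Rintegral_itv_cat _ _ _ (t0 - L / 2 + W%:R * L)) //; last 2 first.
  - by rewrite WS; lra.
  - by rewrite WS; lra.
  rewrite -[X in _ = X + _](@Rintegral_itv_cat _ _ _ (t0 - L / 2 - W%:R * L)) //; last 2 first.
  - by rewrite WS; lra.
  - by lra.
  have -> : t0 + W%:R * L - L / 2 = t0 - L / 2 + W%:R * L by ring.
  have -> : t0 + W%:R * L + L / 2 = t0 - L / 2 + W.+1%:R * L by rewrite WS; field.
  have -> : t0 - W.+1%:R * L - L / 2 = t0 - L / 2 - W.+1%:R * L by ring.
  have -> : t0 - W.+1%:R * L + L / 2 = t0 - L / 2 - W%:R * L by rewrite WS; field.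
  by ring.
rewrite (funext sE).
apply: Rintegral_exhaust; first exact: int0.
  apply/cvgrNyPle => A; move/cvgryPge : (natmul_cvgy L0) => /(_ (t0 - L / 2 - A)).
  by apply: filterS => n; lra.
apply/cvgryPge => A; move/cvgryPge : (natmul_cvgy L0) => /(_ (A - (t0 - L / 2))).
by apply: filterS => n; lra.
Qed.

End PoissonSummation.

(** * Cosine transforms and their uniqueness *)

Section Fourier.
Context {R : realType}.
Notation mu := (@lebesgue_measure R).
Implicit Types (f g H : R -> R) (a b c t lam : R).

Definition cos_transform f lam : R := (\int[mu]_t (f t * cos (t * lam)))%R.

Lemma continuous_cosl a b : continuous (fun t => cos (a * (t - b))).
Proof.
move=> t; apply: (continuous_cvg _ (@continuous_cos R _)); apply: cvgMl_tmp.
by apply: cvgB; [exact: cvg_id | exact: cvg_cst].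
Qed.

Lemma env_integrableM H f g : tail_envelope H -> continuous f ->
  (forall t, `|f t| <= H t) -> continuous g -> (forall t, `|g t| <= 1) ->
  mu.-integrable setT (EFin \o (fun t => f t * g t)).
Proof.
move=> eH cf fH cg g1; apply: (env_cvg_integrable eH).
  by move=> t; apply: cvgM; [exact: cf | exact: cg].
by move=> t; rewrite normrM -[leRHS]mulr1 ler_pM.
Qed.

(** The odd part of the shifted cosine integrates to zero against an even
    function. *)
Lemma cos_transform_shift H f a b : tail_envelope H -> continuous f ->
  (forall t, `|f t| <= H t) -> (forall t, f (- t) = f t) ->
  (\int[mu]_t (f t * cos (a * (t - b))))%R = cos (a * b) * cos_transform f a.
Proof.
move=> eH cf fH fev.
have cc c : continuous (fun t => cos (t * c)).
  move=> t; apply: (continuous_cvg _ (@continuous_cos R _)); apply: cvgMr_tmp; exact: cvg_id.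
have cs c : continuous (fun t => sin (t * c)).
  move=> t; apply: (continuous_cvg _ (@continuous_sin R _)); apply: cvgMr_tmp; exact: cvg_id.
have i1 := env_integrableM eH cf fH (cc a) (fun t => cos_max _).
have i2 := env_integrableM eH cf fH (cs a) (fun t => sin_max _).
transitivity (\int[mu]_t (cos (a * b) * (f t * cos (t * a)) + sin (a * b) * (f t * sin (t * a))))%R.
  by apply: eq_Rintegral => t _; rewrite mulrBr cosB (mulrC t); ring.
rewrite RintegralD //; last 2 first.
- exact: (@integrableZl _ _ _ mu setT measurableT (cos (a * b)) _ i1).
- exact: (@integrableZl _ _ _ mu setT measurableT (sin (a * b)) _ i2).
rewrite !RintegralZl // -/(cos_transform f a) [X in _ + _ * X = _]Rintegral_odd ?mulr0 ?addr0 //.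
  by apply/measurable_EFinP; exact: measurable_int i2.
by move=> t; rewrite fev mulNr sinN mulrN.
Qed.

Lemma fejer_expansion H f N t0 (L : R) : tail_envelope H -> continuous f ->
  (forall t, `|f t| <= H t) ->
  (\int[mu]_t (f t * fejer N.+1 (2 * pi * (t - t0) / L)))%R =
  (\int[mu]_t f t)%R + 2 * \sum_(1 <= v < N.+1) (1 - v%:R / N.+1%:R) *
     (\int[mu]_t (f t * cos (v%:R * (2 * pi / L) * (t - t0))))%R.
Proof.
move=> eH cf fH.
have i1 w : mu.-integrable setT (EFin \o (fun t => f t * cos (w * (t - t0)))).
  by apply: env_integrableM eH _ _ _ _ => //; [exact: continuous_cosl | move=> t; exact: cos_max].
have i2 k w : mu.-integrable setT (EFin \o (fun t => k * (f t * cos (w * (t - t0))))).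
  exact: (@integrableZl _ _ _ mu setT measurableT k _ (i1 w)).
transitivity (\int[mu]_t (f t + \sum_(1 <= v < N.+1) (2 * (1 - v%:R / N.+1%:R)) *
   (f t * cos (v%:R * (2 * pi / L) * (t - t0)))))%R.
  apply: eq_Rintegral => t _; rewrite fejer_sum mulrDr mulr1; congr (_ + _).
  rewrite mulrCA !mulr_sumr; apply: eq_bigr => v _.
  have -> : v%:R * (2 * pi * (t - t0) / L) = v%:R * (2 * pi / L) * (t - t0) by ring.
  by ring.
rewrite RintegralD //; last 2 first.
- exact: env_cvg_integrable eH cf fH.
- have := @integrable_sum _ _ _ mu setT measurableT _ (index_iota 1 N.+1) xpredT
    (fun v => EFin \o (fun t => (2 * (1 - v%:R / N.+1%:R)) *
     (f t * cos (v%:R * (2 * pi / L) * (t - t0))))) (fun i _ => i2 _ _).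
  by apply: eq_integrable => // x _; rewrite /= sumEFin.
rewrite Rintegral_sum //; congr (_ + _); rewrite mulr_sumr; apply: eq_bigr => v _.
by rewrite RintegralZl // [RHS]mulrA.
Qed.

(** If the transform is the constant [k], the Fejer integral at [t0] is [k]
    times the kernel at [t0 / L], which tends to 0 as soon as [t0] is not on
    the lattice of period [L]. By [poisson] the lattice sum of [f] through
    [t0] therefore vanishes. Its terms other than [f t0] have total size
    [O(1 / L)], hence so does [f t0], and [L] is arbitrary. *)
Lemma cos_transform_const0 H f t0 k : tail_envelope H -> continuous f ->
  (forall t, `|f t| <= H t) -> (forall t, f (- t) = f t) ->
  (forall lam, cos_transform f lam = k) -> 0 < t0 -> f t0 = 0.
Proof.
move=> eH cf fH fev fk t00.
pose I := (\int[mu]_(t in `[0%R, +oo[) H t)%R.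
have I0 : 0 <= I by apply: Rintegral_ge0 => t _; exact: (env_ge0 eH).
have key L : 2 * t0 <= L -> L * `|f t0| <= 6 * I.
  move=> tL; have L0 : 0 < L by lra.
  pose l i := L * (f (t0 + i%:R * L) + f (t0 - i.+1%:R * L)).
  have [cl Tl] : cvgn (series l) /\ (fun N => \int[mu]_t
      (f t * fejer N.+1 (2 * pi * (t - t0) / L)))%R @ \oo --> limn (series l).
    exact: poisson cf eH fH L0.
  have l0 : limn (series l) = 0.
    rewrite -(cvg_lim (@norm_hausdorff _ R) Tl); apply: cvg_lim => //.
    have -> : (fun N => \int[mu]_t (f t * fejer N.+1 (2 * pi * (t - t0) / L)))%R =
        (fun N => k * fejer N.+1 (2 * pi * t0 / L)).
      apply/funext => N; rewrite (fejer_expansion _ _ _ eH cf fH) fejer_sum.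
      have -> : (\int[mu]_t f t)%R = k.
        by rewrite -(fk 0); apply: eq_Rintegral => t _; rewrite mulr0 cos0 mulr1.
      rewrite [RHS]mulrDr mulr1; congr (_ + _).
      rewrite [RHS]mulrCA; congr (_ * _); rewrite mulr_sumr; apply: eq_bigr => v _.
      rewrite (cos_transform_shift _ _ eH cf fH fev) fk.
      have -> : v%:R * (2 * pi * t0 / L) = v%:R * (2 * pi / L) * t0 by ring.
      by ring.
    rewrite -[X in _ --> X](mulr0 k); apply: cvgMl_tmp.
    pose s := sin (2 * pi * t0 / L / 2) ^+ 2.
    have s0 : 0 < s.
      rewrite exprn_gt0 // sin_gt0_pi //.
      have -> : 2 * pi * t0 / L / 2 = pi * (t0 / L) by field; rewrite gt_eqF.
      rewrite mulr_gt0 ?pi_gt0 ?divr_gt0 //= gtr_pMr ?pi_gt0 //.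
      by rewrite ltr_pdivrMr // mul1r; lra.
    have h : (fun N => s^-1 * N.+1%:R^-1) @ \oo --> 0.
      by rewrite -[X in _ --> X](mulr0 s^-1); apply: cvgMl_tmp; exact: cvg_harmonic.
    apply: (squeeze_cvgr _ (cvg_cst 0) h); apply: nearW => N.
    by rewrite fejer_ge0 /= ler_pdivlMl // mulrC fejer_sin.
  (* The points of the lattice other than [t0] and [t0 - L] are compared with the
     grid of mesh [L / 2] because [t0] is at most [L / 2]. *)
  have L20 : 0 <= L / 2 by rewrite divr_ge0 // ltW.
  have HL i : L * H (i.+1%:R * (L / 2)) <= 2 * I.
    have := env_sum_le i.+1 eH (divr_gt0 L0 (ltr0n _ 2)); rewrite -/I => h.
    have : L / 2 * H (i.+1%:R * (L / 2)) <= I.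
      apply: le_trans h; rewrite ler_wpM2l // big_nat_recr //= lerDr.
      by rewrite sumr_ge0 // => j _; exact: (env_ge0 eH).
    lra.
  have lb W : `|series l W.+1 - l 0%N| <= 4 * I.
    rewrite seriesEnat /= big_nat_recl // addrC addKr.
    apply: le_trans (ler_norm_sum _ _ _) _.
    have h := env_sum_le W eH (divr_gt0 L0 (ltr0n _ 2)).
    apply: (@le_trans _ _ (4 * (L / 2 * \sum_(0 <= v < W) H (v.+1%:R * (L / 2)))));
      last by rewrite ler_wpM2l.
    rewrite !mulr_sumr; apply: ler_sum => i _; rewrite /l normrM (gtr0_norm L0).
    have n0 : `|t0| = t0 by rewrite gtr0_norm.
    have iL : 0 <= i%:R * L by rewrite mulr_ge0 // ltW.
    have h1 : `|f (t0 + i.+1%:R * L)| <= H (i.+1%:R * (L / 2)).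
      apply: (env_le eH fH); first by rewrite mulr_ge0.
      apply: le_trans (ler_norm _); rewrite -natr1 mulrDl mul1r; lra.
    have h2 : `|f (t0 - i.+2%:R * L)| <= H (i.+1%:R * (L / 2)).
      apply: (env_le eH fH); first by rewrite mulr_ge0.
      rewrite -normrN; apply: le_trans (ler_norm _).
      have e : i.+2%:R = i%:R + 2 :> R by rewrite -addn2 natrD.
      by rewrite e -(natr1 i); lra.
    have := ler_normD (f (t0 + i.+1%:R * L)) (f (t0 - i.+2%:R * L)).
    have -> : 4 * (L / 2 * H (i.+1%:R * (L / 2))) = L * (2 * H (i.+1%:R * (L / 2))) by field.
    by rewrite ler_pM2l //; lra.
  have l0b : `|l 0%N| <= 4 * I.
    have h : (fun W => `|series l W.+1 - l 0%N|) @ \oo --> `|0 - l 0%N|.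
      apply: cvg_norm; apply: cvgB; last exact: cvg_cst.
      by rewrite -l0 (cvg_shiftS (series l)); exact: cl.
    rewrite -normrN -sub0r; apply: (ler_cvg_to h (cvg_cst (4 * I))); exact: nearW.
  have ft : `|f (t0 - L)| <= H (1%:R * (L / 2)).
    apply: (env_le eH fH); first by rewrite mul1r.
    by rewrite -normrN; apply: le_trans (ler_norm _); rewrite mul1r; lra.
  have := HL 0%N; move: l0b ft; rewrite /l mul0r addr0 !mul1r normrM (gtr0_norm L0) => l0b ft hl.
  have : L * `|f t0| <= L * `|f t0 + f (t0 - L)| + L * `|f (t0 - L)|.
    by rewrite -mulrDr ler_wpM2l ?(ltW L0) // -{1}(addrK (f (t0 - L)) (f t0)) ler_normB.
  have : L * `|f (t0 - L)| <= L * H (L / 2) by rewrite ler_wpM2l // ltW.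
  lra.
apply/eqP; rewrite -normr_eq0 -[_ == 0]negbK; apply/negP => fn0.
have f0 : 0 < `|f t0| by rewrite lt_def fn0 normr_ge0.
(* A period that contradicts [L * `|f t0| <= 6 * I] if [f t0] is nonzero. *)
pose L := 2 * t0 + (6 * I + 1) / `|f t0|.
have := key L; rewrite lerDl divr_ge0 ?addr_ge0 ?mulr_ge0 // => /(_ isT).
rewrite /L mulrDl divfK //; have : 0 <= 2 * t0 * `|f t0| by rewrite !mulr_ge0 // ltW.
lra.
Qed.

End Fourier.

(** * Aliasing of the sampled spectral density *)

Section SpectralTail.
Context {R : realType}.
Notation mu := (@lebesgue_measure R).
Implicit Types (f g H C : R -> R) (a b c t lam p : R).

Lemma spectral_densityE C lam :
  spectral_density C lam = (2 * pi)^-1 * cos_transform C lam.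
Proof.
rewrite /spectral_density /spectral_densityC /cintegral /= mul0r subr0.
congr (_ * _); apply: eq_Rintegral => t _.
by rewrite mul0r subr0 cosN.
Qed.

(** Each term is at most a multiple of the increment of [v `^ (1 - p)], by the
    inequalities [1 + x <= exp x] and [ln (1 + x) <= x]; the sum
    telescopes. *)
Lemma psum_powR_bounded p : 1 < p ->
  exists B : R, forall n, \sum_(0 <= v < n) v.+1%:R `^ (- p) <= B.
Proof.
move=> p1; have pp : 0 < p - 1 by lra.
have step v : v.+2%:R `^ (- p) <= (p - 1)^-1 * (v.+1%:R `^ (1 - p) - v.+2%:R `^ (1 - p)) :> R.
  rewrite ler_pdivlMl //.
  have e : v.+1%:R = v.+2%:R * (1 - v.+2%:R^-1) :> R.
    by rewrite mulrBr mulr1 divff // -(natr1 v.+1) addrK.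
  have u0 : 0 < 1 - v.+2%:R^-1 :> R.
    by rewrite subr_gt0 invf_lt1 // ltr1n.
  rewrite {1}e powRM ?(ltW u0) // -{2}(mulr1 (v.+2%:R `^ (1 - p))) -mulrBr.
  have -> : v.+2%:R `^ (- p) = v.+2%:R `^ (1 - p) * v.+2%:R^-1 :> R.
    rewrite -[X in _ = _ * X]powR_inv1 // -powRD; last by rewrite pnatr_eq0 implybT.
    by congr (_ `^ _); lra.
  rewrite mulrCA ler_wpM2l ?powR_ge0 //.
  rewrite /powR (gt_eqF u0); apply: le_trans (lerB (expR_ge1Dx _) (lexx 1)).
  have -> : 1 + (1 - p) * ln (1 - v.+2%:R^-1) - 1 = (p - 1) * - ln (1 - v.+2%:R^-1 : R) by ring.
  rewrite ler_wpM2l ?(ltW pp) // lerNr; apply: le_ln1Dx.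
  by rewrite ltrN2 invf_lt1 // ltr1n.
exists (1 + (p - 1)^-1) => n; case: n => [|n].
  by rewrite big_geq // addr_ge0 // invr_ge0 (ltW pp).
rewrite big_nat_recl // powR1 lerD //.
apply: (@le_trans _ _ (\sum_(0 <= v < n)
   (p - 1)^-1 * (v.+1%:R `^ (1 - p) - v.+2%:R `^ (1 - p)))); first exact: ler_sum.
rewrite -mulr_sumr ler_piMr ?invr_ge0 ?(ltW pp) //.
rewrite (@telescope_sumr_eq _ 0 n (fun v => - (v.+1%:R `^ (1 - p)))) //.
  rewrite powR1 opprK; have := powR_ge0 (n.+1%:R : R) (1 - p); lra.
by move=> v _; rewrite opprK addrC.
Qed.

Lemma cvg_powR_ratio lam p :
  (mu0 / (lam + mu0)) `^ p @[mu0 --> +oo] --> (1 : R).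
Proof.
have c1 : {for 1, continuous (fun x : R => x `^ p)}.
  apply/differentiable_continuous/derivable1_diffP.
  exact: (@ex_derive _ _ _ _ _ _ _ (is_derive1_powR p ltr01)).
have h : mu0 / (lam + mu0) @[mu0 --> +oo] --> (1 : R).
  have h1 : (1 - lam * (lam + mu0)^-1) @[mu0 --> +oo] --> (1 : R).
    rewrite -[X in _ --> X]subr0; apply: cvgB; first exact: cvg_cst.
    rewrite -[X in _ --> X](mulr0 lam); apply: cvgMl_tmp.
    apply/gtr0_cvgV0; last exact: cvg_addrl.
    near=> x; rewrite -ltrBlDl sub0r; near: x; apply: nbhs_pinfty_gt; exact: num_real.
  apply: cvg_trans h1; apply: near_eq_cvg; near=> x.
  have x0 : lam + x != 0.
    rewrite gt_eqF // -ltrBlDl sub0r; near: x; apply: nbhs_pinfty_gt; exact: num_real.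
  by field.
by have := continuous_cvg _ c1 h; rewrite powR1; exact.
Unshelve. all: by end_near. Qed.

(** Shifting the frequency by a constant changes [`|lam| `^ p] by a factor
    that tends to 1. *)
Lemma shifted_tail (phi : R -> R) p (A : R) lam :
  `|x| `^ p * phi x @[x --> +oo] --> A ->
  mu0 `^ p * phi (lam + mu0) @[mu0 --> (+oo : set_system R)] --> A.
Proof.
move=> h.
have h1 : `|lam + mu0| `^ p * phi (lam + mu0) @[mu0 --> (+oo : set_system R)] --> A.
  exact: cvg_comp (cvg_addrl lam) h.
have h2 := cvgM (cvg_powR_ratio lam p) h1.
rewrite mul1r in h2; apply: (cvg_trans _ (h2 _)).
apply: near_eq_cvg; near=> x.
have x0 : 0 < x by near: x; apply: nbhs_pinfty_gt; exact: num_real.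
have lx : 0 < lam + x.
  by rewrite -ltrBlDl sub0r; near: x; apply: nbhs_pinfty_gt; exact: num_real.
by rewrite /= (gtr0_norm lx) mulrA -powRM ?divr_ge0 ?(ltW x0) ?(ltW lx) // divfK // gt_eqF.
Unshelve. all: by end_near. Qed.

End SpectralTail.

Section Aliasing.
Context {R : realType}.
Notation mu := (@lebesgue_measure R).
Implicit Types (f g H C : R -> R) (a b c t lam p q r : R).

(** The consequences of the decay of the covariance that the proof uses, with
    one envelope for the three weights 1, [`|t|] and [`|t| `^ q]. *)
Record decaying C H q : Prop := Decaying {
  dec_cont : continuous C ;
  dec_even : forall t, C (- t) = C t ;
  dec_env : tail_envelope H ;
  dec_0 : forall t, `|C t| <= H t ;
  dec_1 : forall t, `|t| * `|C t| <= H t ;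
  dec_q : forall t, `|t| `^ q * `|C t| <= H t }.

(** The spectral density of the process sampled at rate [r], that is, the
    discrete-time transform of the covariance truncated at lag [V]. *)
Definition sampled_density C r lam (V : nat) : R :=
  (2 * pi * r)^-1 * (C 0 + 2 * \sum_(1 <= v < V) C (v%:R / r) * cos (v%:R * lam / r)).

Let cosl lam : continuous (fun t => cos (t * lam)).
Proof.
move=> t; apply: (continuous_cvg _ (@continuous_cos R _)).
by apply: cvgMr_tmp; exact: cvg_id.
Qed.

Lemma cos_transform_mulcos C H q a b : decaying C H q ->
  (\int[mu]_t (C t * cos (t * a) * cos (b * (t - 0))))%R =
  (cos_transform C (a + b) + cos_transform C (- a + b)) / 2.
Proof.
move=> dC.
have i1 w : mu.-integrable setT (EFin \o (fun t => C t * cos (t * w))).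
  apply: env_integrableM (dec_env dC) (dec_cont dC) (dec_0 dC) (@cosl w) _ => t.
  exact: cos_max.
rewrite /cos_transform -RintegralD // mulrC -RintegralZl //; last first.
  exact: (@integrableD _ _ _ mu setT measurableT _ _ (i1 _) (i1 _)).
apply: eq_Rintegral => t _; rewrite subr0 !mulrDr mulrN !cosD cosN sinN (mulrC b).
by field.
Qed.

(** Testing the covariance at frequency [lam] against the Fejer kernel of
    period [r^-1] yields Cesaro sums of the aliases of [lam], the translates
    of the spectral density by multiples of [2 pi r]. *)
Lemma fejer_cov C H q N r lam : decaying C H q -> 0 < r ->
  (\int[mu]_t (C t * cos (t * lam) * fejer N.+1 (2 * pi * (t - 0) / r^-1)))%R =
  2 * pi * (spectral_density C lam + \sum_(1 <= v < N.+1) (1 - v%:R / N.+1%:R) *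
     (spectral_density C (lam + 2 * pi * r * v%:R) +
      spectral_density C (- lam + 2 * pi * r * v%:R))).
Proof.
move=> dC r0; have pi0 : pi != 0 :> R by rewrite gt_eqF // pi_gt0.
rewrite (@fejer_expansion _ H) //; [|exact: dec_env dC| |].
- rewrite -/(cos_transform C lam) [RHS]mulrDr {1}spectral_densityE mulVKf ?mulf_neq0 //.
  congr (_ + _); rewrite !mulr_sumr; apply: eq_bigr => v _.
  rewrite (cos_transform_mulcos _ _ dC) !spectral_densityE invrK.
  have -> : v%:R * (2 * pi * r) = 2 * pi * r * v%:R by ring.
  move: (cos_transform C _) (cos_transform C _) (1 - _) => x y w.
  by move: pi pi0 => P P0; field.
- by move=> t; apply: cvgM; [exact: (dec_cont dC) | exact: cosl].
- move=> t; rewrite normrM; apply: le_trans (dec_0 dC t).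
  by rewrite ler_piMr // cos_max.
Qed.

(** [Z] is the sum of the tails [A (2 pi v) `^ (- p)] over the nonzero
    integers [v]: the coefficient of the aliasing error. It is obtained as a
    Cesaro limit because the aliases are summed in that form in [fejer_cov];
    these means increase and are bounded. *)
Lemma alias_const A p : 0 < A -> 1 < p -> exists Z B : R, [/\ 0 < Z,
  (fun N => \sum_(1 <= v < N.+1) (1 - v%:R / N.+1%:R) *
     (2 * A * (2 * pi * v%:R) `^ (- p))) @ \oo --> Z, 0 <= B &
  forall n, \sum_(1 <= v < n) (2 * pi * v%:R) `^ (- p) <= B].
Proof.
move=> A0 p1; have pi2 : 0 < 2 * pi :> R by rewrite mulr_gt0 // pi_gt0.
have [B0 hB0] := psum_powR_bounded p1.
have bB n : \sum_(1 <= v < n) (2 * pi * v%:R) `^ (- p) <= (2 * pi) `^ (- p) * B0.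
  rewrite big_add1 /= (eq_bigr (fun v => (2 * pi) `^ (- p) * v.+1%:R `^ (- p))).
    by rewrite -mulr_sumr ler_wpM2l // powR_ge0.
  by move=> v _; rewrite powRM // ltW.
pose c v : R := 2 * A * (2 * pi * v%:R) `^ (- p).
have c0 v : 0 <= c v by rewrite mulr_ge0 ?powR_ge0 // mulr_ge0 // ltW.
pose z N : R := \sum_(1 <= v < N.+1) (1 - v%:R / N.+1%:R) * c v.
have nz : nondecreasing_seq z.
  apply/nondecreasing_seqP => N; rewrite /z [leRHS]big_nat_recr //=.
  apply: (@le_trans _ _ (\sum_(1 <= v < N.+1) (1 - v%:R / N.+2%:R) * c v)).
    apply: ler_sum => v _; apply: ler_wpM2r => //.
    by rewrite lerB // ler_wpM2l // lef_pV2 ?posrE // ler_nat.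
  by rewrite lerDl mulr_ge0 // subr_ge0 ler_pdivrMr // mul1r ler_nat.
have zb : has_ubound (range z).
  exists (2 * A * ((2 * pi) `^ (- p) * B0)) => _ [N _ <-].
  apply: (@le_trans _ _ (\sum_(1 <= v < N.+1) c v)).
    apply: ler_sum => v _; by rewrite ler_piMl // gerBl divr_ge0.
  by rewrite /c -mulr_sumr ler_wpM2l // mulr_ge0 // ltW.
have cz := nondecreasing_is_cvgn nz zb.
exists (limn z), ((2 * pi) `^ (- p) * B0); split => //.
- apply: lt_le_trans (nondecreasing_cvgn_le nz cz 1%N).
  rewrite /z big_nat1 mulr_gt0 //; last first.
    by rewrite mulr_gt0 ?powR_gt0 ?mulr1 // mulr_gt0.
  by rewrite subr_gt0 ltr_pdivrMr // mul1r ltr_nat.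
- by have := bB 0%N; rewrite big_geq.
Qed.

(** Poisson summation gives the full lattice sum. Its lags beyond [V] are a
    fraction [r / V] of an integrable sum because [`|t| * `|C t|] is dominated
    by the envelope. *)
Lemma sampled_tail C H q r lam : decaying C H q -> 1 <= r ->
  let l i := r^-1 * (C (0 + i%:R * r^-1) * cos ((0 + i%:R * r^-1) * lam) +
     C (0 - i.+1%:R * r^-1) * cos ((0 - i.+1%:R * r^-1) * lam)) in
  cvgn (series l) -> forall V, (0 < V)%N ->
  `|sampled_density C r lam V - (2 * pi)^-1 * limn (series l)| <=
   (H 0 + 2 * (\int[mu]_(t in `[0%R, +oo[) H t)%R) * r / V%:R.
Proof.
move=> dC r1 l cl V V0; have r0 : 0 < r by lra.
have V0' : 0 < V%:R :> R by rewrite ltr0n.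
pose I := (\int[mu]_(t in `[0%R, +oo[) H t)%R; rewrite -/I.
have eH := dec_env dC.
have I0 : 0 <= I by apply: Rintegral_ge0 => t _; exact: (env_ge0 eH).
have pi0 := pi_ge2 R.
pose f v : R := C (v%:R / r) * cos (v%:R * lam / r).
have lE i : l i = r^-1 * (f i + f i.+1).
  rewrite /l !add0r (dec_even dC) mulNr cosN /f; congr (_ * (_ * cos _ + _ * cos _)); ring.
have fH v : (0 < v)%N -> `|f v| <= r / v%:R * H (v%:R / r).
  move=> v0; have v0' : 0 < v%:R :> R by rewrite ltr0n.
  have vr : 0 < v%:R / r by rewrite divr_gt0.
  rewrite -ler_pdivrMl ?divr_gt0 // invf_div.
  apply: le_trans (dec_1 dC _); rewrite (gtr0_norm vr) ler_wpM2l ?(ltW vr) //.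
  by rewrite normrM ler_piMr // cos_max.
have fVH v : (V <= v)%N -> `|f v| <= r / V%:R * H (v%:R / r).
  move=> Vv; have v0 : (0 < v)%N by lia.
  apply: le_trans (fH v v0) _; apply: ler_wpM2r; first exact: (env_ge0 eH).
  by rewrite ler_wpM2l ?(ltW r0) // lef_pV2 ?posrE ?ltr0n // ler_nat.
have sl W : series l W = r^-1 * (\sum_(0 <= i < W) f i + \sum_(0 <= i < W) f i.+1).
  rewrite seriesEnat /= -big_split mulr_sumr; apply: eq_bigr => i _; exact: lE.
have slV : series l V = 2 * pi * sampled_density C r lam V + r^-1 * f V.
  rewrite sl /sampled_density.
  have -> : \sum_(0 <= i < V) f i.+1 = \sum_(1 <= v < V) f v + f V.
    by rewrite -(big_add1 _ _ 0 V.+1 xpredT) big_nat_recr.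
  rewrite big_ltn // {1}/f mul0r mul0r mul0r cos0 mulr1.
  have pn0 : pi != 0 :> R by rewrite gt_eqF //; lra.
  rewrite -/(f _) (eq_bigr f) //; move: (\sum_(1 <= v < V) f v) (f V) => x y.
  by move: pi pn0 => P P0; field; rewrite P0 gt_eqF.
(* A lag beyond [V] gains a factor [r / V] from the weight [`|t|]. *)
have tl W : (V <= W)%N -> `|series l W - series l V| <= 2 * I * r / V%:R.
  move=> VW; rewrite sub_series_geq //; apply: le_trans (ler_norm_sum _ _ _) _.
  apply: (@le_trans _ _ (2 / V%:R * \sum_(V <= v < W) H (v%:R / r))).
    rewrite mulr_sumr big_nat [leRHS]big_nat; apply: ler_sum => v /andP[Vv _].
    rewrite lE normrM gtr0_norm ?invr_gt0 // ler_pdivrMl //.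
    apply: le_trans (ler_normD _ _) _.
    have -> : r * (2 / V%:R * H (v%:R / r)) = r / V%:R * H (v%:R / r) + r / V%:R * H (v%:R / r).
      by field; rewrite gt_eqF.
    apply: lerD; first exact: fVH.
    apply: le_trans (fVH v.+1 _) _; first lia.
    rewrite ler_wpM2l ?divr_ge0 ?(ltW r0) //; apply: (env_mono eH).
      by rewrite divr_ge0 // ltW.
    by rewrite ler_wpM2r ?invr_ge0 ?(ltW r0) // ler_nat.
  have -> : 2 * I * r / V%:R = 2 / V%:R * (r * I) by field; rewrite gt_eqF.
  rewrite ler_wpM2l ?divr_ge0 //.
  have := env_sum_le W eH (_ : 0 < r^-1); rewrite invr_gt0 => /(_ r0).
  rewrite ler_pdivrMl // -/I; apply: le_trans.
  have -> : \sum_(0 <= v < W) H (v.+1%:R / r) = \sum_(1 <= v < W.+1) H (v%:R / r).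
    by rewrite big_add1.
  rewrite [leRHS](big_cat_nat V0 (leqW VW)) /= [X in _ <= _ + X]big_nat_recr //=.
  by rewrite addrCA lerDl addr_ge0 ?sumr_ge0 // => *; exact: (env_ge0 eH).
have lim_tl : `|limn (series l) - series l V| <= 2 * I * r / V%:R.
  have h : (fun W => `|series l W - series l V|) @ \oo --> `|limn (series l) - series l V|.
    by apply: cvg_norm; apply: cvgB; [exact: cl | exact: cvg_cst].
  by apply: (ler_cvg_to h (cvg_cst (2 * I * r / V%:R))); exists V.
have pn0 : 2 * pi != 0 :> R by rewrite gt_eqF //; lra.
have -> : sampled_density C r lam V - (2 * pi)^-1 * limn (series l) =
   (2 * pi)^-1 * ((series l V - limn (series l)) - r^-1 * f V).
  rewrite slV; move: (sampled_density _ _ _ _) (limn _) (r^-1 * f V) (2 * pi) pn0 => x1 x2 x3 x4 x40.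
  by field.
have p1 : 0 <= (2 * pi : R)^-1 <= 1.
  by rewrite invr_ge0 invf_le1 ?mulr_gt0 ?pi_gt0 //; apply/andP; split; lra.
case/andP: p1 => p10 p11; rewrite normrM (ger0_norm p10).
apply: le_trans (ler_wpM2r (normr_ge0 _) p11) _; rewrite mul1r.
apply: le_trans (ler_normB _ _) _; rewrite distrC.
have fV : `|r^-1 * f V| <= H 0 * r / V%:R.
  rewrite normrM gtr0_norm ?invr_gt0 //.
  apply: (@le_trans _ _ (1 * `|f V|)).
    by rewrite ler_wpM2r // invf_le1.
  rewrite mul1r; apply: le_trans (fVH V (leqnn V)) _.
  rewrite mulrC mulrA ler_wpM2r // ?invr_ge0 // ler_wpM2r ?(ltW r0) //.
  by apply: (env_mono eH) => //; rewrite divr_ge0 // ltW.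
apply: le_trans (lerD lim_tl fV) _.
by rewrite -mulrDl -mulrDl addrC.
Qed.

(** By Poisson summation the sampled density is the sum of all the aliases of
    the spectral density, and each alias is asymptotically its tail
    [A m `^ (- p)], where [m = 2 pi r v]. The constant [Z] does not depend on
    the frequency, since a shift by [lam] is negligible against [m]. *)
Lemma aliasing C H p q (A : R) : decaying C H q -> 1 < p -> 0 < A ->
  `|lam| `^ p * spectral_density C lam @[lam --> +oo] --> A ->
  exists Z B : R, [/\ 0 < Z, 0 <= B & forall lam (e : R), 0 < e ->
    exists2 r0 : R, 1 <= r0 & forall r V, r0 <= r -> (0 < V)%N ->
    `|sampled_density C r lam V - spectral_density C lam - Z * r `^ (- p)| <=
      e * r `^ (- p) + B * r / V%:R].
Proof.
move=> dC p1 A0 hA; have [Z [B0 [Z0 cZ B00 hB0]]] := alias_const A0 p1.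
have eH := dec_env dC; have pi0 := pi_gt0 R.
have pi2 := pi_ge2 R.
pose I := (\int[mu]_(t in `[0%R, +oo[) H t)%R.
have I0 : 0 <= I by apply: Rintegral_ge0 => t _; exact: (env_ge0 eH).
have H00 : 0 <= H 0 := env_ge0 eH 0.
exists Z, (H 0 + 2 * I); split => // [|lam e e0]; first by lra.
(* [2 * B0] bounds the sum of the weights of the two families of aliases. *)
pose e' := e / (2 * B0 + 1); have B1 : 0 < 2 * B0 + 1 by lra.
have e'0 : 0 < e' by rewrite divr_gt0.
have tailM lam' : exists2 M : R, 0 < M & forall m : R, M < m ->
    `|spectral_density C (lam' + m) - A * m `^ (- p)| <= e' * m `^ (- p).
  have /cvgrPdist_le /(_ e' e'0) [M [_ hM]] := shifted_tail lam' hA.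
  exists (Num.max M 1); first by rewrite lt_max ltr01 orbT.
  move=> m; rewrite gt_max => /andP[Mm m1]; have m0 : 0 < m by lra.
  have := hM m Mm; have mp : 0 < m `^ (- p) by rewrite powR_gt0.
  have -> : A - m `^ p * spectral_density C (lam' + m) =
     (A * m `^ (- p) - spectral_density C (lam' + m)) / m `^ (- p).
    by rewrite powRN; field; rewrite gt_eqF // powR_gt0.
  by rewrite normrM normfV (gtr0_norm mp) ler_pdivrMr // distrC.
have [M1 M10 hM1] := tailM lam; have [M2 M20 hM2] := tailM (- lam).
exists (1 + M1 + M2); first lra.
move=> r V rM V0; have r1 : 1 <= r by lra.
have r0 : 0 < r by lra.
pose f t := C t * cos (t * lam).
have [|||cl] := @poisson _ f H 0 r^-1 _ eH.
- by move=> t; apply: cvgM; [exact: (dec_cont dC) | exact: cosl].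
- by move=> t; rewrite normrM; apply: le_trans (dec_0 dC t); rewrite ler_piMr // cos_max.
- by rewrite invr_gt0.
set T := limn _ => cT; have st := sampled_tail dC r1 cl V0; rewrite -/T -/I in st.
suff hT : `|(2 * pi)^-1 * T - spectral_density C lam - Z * r `^ (- p)| <= e * r `^ (- p).
  apply: le_trans (lerD hT st); rewrite addrC.
  apply: le_trans (ler_normD _ _); rewrite le_eqVlt; apply/orP; left; apply/eqP.
  by congr (`|_|); ring.
have pn0 : 2 * pi != 0 :> R by rewrite gt_eqF //; lra.
pose zN N : R := \sum_(1 <= v < N.+1) (1 - v%:R / N.+1%:R) * (2 * A * (2 * pi * v%:R) `^ (- p)).
have h : (fun N => `|(2 * pi)^-1 * (\int[mu]_t (f t * fejer N.+1 (2 * pi * (t - 0) / r^-1)))%R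
     - spectral_density C lam - zN N * r `^ (- p)|) @ \oo -->
   `|(2 * pi)^-1 * T - spectral_density C lam - Z * r `^ (- p)|.
  apply: cvg_norm; apply: cvgB; last exact: cvgMr_tmp.
  by apply: cvgB; [apply: cvgMl_tmp | exact: cvg_cst].
apply: (ler_cvg_to h (cvg_cst (e * r `^ (- p)))); apply: nearW => N.
rewrite /f (fejer_cov _ _ dC r0) mulKf // (addrC (spectral_density C lam)) addrK /zN mulr_suml -sumrB.
apply: le_trans (ler_norm_sum _ _ _) _.
apply: (@le_trans _ _ (\sum_(1 <= v < N.+1) 2 * e' * r `^ (- p) * (2 * pi * v%:R) `^ (- p))).
  rewrite big_nat [leRHS]big_nat; apply: ler_sum => v /andP[v1 vN].
  have v1' : 1 <= v%:R :> R by rewrite (ler_nat _ 1).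
  set m := 2 * pi * r * v%:R.
  have rm : r <= m.
    rewrite /m -[leLHS]mulr1 ler_pM // ?(ltW r0) //.
    by rewrite -[leLHS]mul1r ler_pM // ?(ltW r0) //; lra.
  have mE : m `^ (- p) = r `^ (- p) * (2 * pi * v%:R) `^ (- p).
    rewrite -powRM ?(ltW r0) ?mulr_ge0 ?(ltW pi0) //; congr (_ `^ _); rewrite /m; ring.
  have w0 : 0 <= 1 - v%:R / N.+1%:R :> R.
    by rewrite subr_ge0 ler_pdivrMr // mul1r ler_nat ltnW.
  have w1 : 1 - v%:R / N.+1%:R <= 1 :> R by rewrite gerBl divr_ge0.
  have -> : (1 - v%:R / N.+1%:R) * (spectral_density C (lam + m) + spectral_density C (- lam + m))
     - (1 - v%:R / N.+1%:R) * (2 * A * (2 * pi * v%:R) `^ (- p)) * r `^ (- p) =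
    (1 - v%:R / N.+1%:R) * ((spectral_density C (lam + m) - A * m `^ (- p)) +
       (spectral_density C (- lam + m) - A * m `^ (- p))).
    by rewrite mE; ring.
  rewrite normrM (ger0_norm w0); apply: le_trans (ler_wpM2r (normr_ge0 _) w1) _.
  rewrite mul1r; apply: le_trans (ler_normD _ _) _.
  have -> : 2 * e' * r `^ (- p) * (2 * pi * v%:R) `^ (- p) = e' * m `^ (- p) + e' * m `^ (- p).
    by rewrite mE; ring.
  by apply: lerD; [apply: hM1 | apply: hM2]; lra.
rewrite -mulr_sumr.
have rp : 0 <= r `^ (- p) by rewrite powR_ge0.
apply: le_trans (ler_wpM2l _ (hB0 N.+1)) _.
  by rewrite mulr_ge0 // mulr_ge0 // ltW.
have -> : e = e' * (2 * B0 + 1) by rewrite /e' divfK // gt_eqF.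
have : 0 <= e' * r `^ (- p) by rewrite mulr_ge0 // ltW.
move=> h0; rewrite -subr_ge0.
by have -> : e' * (2 * B0 + 1) * r `^ (- p) - 2 * e' * r `^ (- p) * B0 = e' * r `^ (- p) by ring.
Qed.

End Aliasing.

(** * The bias due to the window *)

Section WindowBias.
Context {R : realType}.
Notation mu := (@lebesgue_measure R).
Implicit Types (f g H C K : R -> R) (lam p q k : R).

(** Adding the odd function [g * sg], whose integral is 0, moves all the mass
    of [g] to the positive half-line. *)
Lemma Rintegral_even g : mu.-integrable setT (EFin \o g) ->
  (forall x, g (- x) = g x) ->
  (\int[mu]_x g x)%R = 2 * (\int[mu]_(x in `[0%R, +oo[) g x)%R.
Proof.
move=> ig gev; pose h x := g x * Num.sg x.
have mg : measurable_fun setT g by apply/measurable_EFinP; exact: measurable_int ig.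
have msg : measurable_fun setT (@Num.sg R).
  rewrite (_ : Num.sg = fun x : R => \1_(`]0, +oo[%classic : set R) x - \1_(`]-oo, 0[%classic : set R) x).
    by apply: measurable_funB; exact: measurable_indic.
  apply/funext => x; rewrite !indicE; case: (ltgtP x 0) => x0.
  - by rewrite ltr0_sg // memNset ?mem_set ?sub0r //= in_itv /= ?x0 // andbT (ltNge 0) ltW.
  - by rewrite gtr0_sg // mem_set ?memNset ?subr0 //= in_itv /= ?x0 // ltNge ltW.
  by rewrite x0 sgr0 !memNset ?subrr //= in_itv /= ltxx.
have mh : measurable_fun setT h by exact: measurable_funM.
have ih : mu.-integrable setT (EFin \o h).
  apply: le_integrable ig => //; first exact/measurable_EFinP.
  move=> x _ /=; rewrite lee_fin /h normrM normr_sg ler_piMr //.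
  by case: (x != 0).
have h0 : (\int[mu]_x h x)%R = 0.
  apply: Rintegral_odd => // x; by rewrite /h gev sgrN mulrN.
have igh : mu.-integrable setT (EFin \o (fun x => g x + h x)).
  exact: (@integrableD _ _ _ mu setT measurableT _ _ ig ih).
have -> : (\int[mu]_x g x)%R = (\int[mu]_x (g x + h x))%R.
  by rewrite RintegralD // h0 addr0.
have T : setT = `]-oo, 0[%classic `|` `[0, +oo[%classic :> set R.
  apply/seteqP; split => // x _ /=; rewrite !in_itv /= andbT.
  by case: (ltP x 0) => ?; [left | right].
rewrite {1}T Rintegral_setU //; last 2 first.
- by rewrite -T.
- by apply/disj_setPS => x [] /=; rewrite !in_itv /= andbT => x0; rewrite leNgt x0.
rewrite [X in X + _](_ : _ = 0) ?add0r; last first.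
  rewrite -[RHS](mul0r (fine (mu `]-oo, 0[%classic))) -Rintegral_cst //.
  apply: eq_Rintegral => x; rewrite inE /= in_itv /= => x0.
  by rewrite /h ltr0_sg // mulrN1 subrr.
rewrite -!(@Rintegral_itv_obnd_cbnd _ 0 +oo%O); last 2 first.
- by apply: integrableS ig.
- by apply: integrableS igh.
rewrite -RintegralZl //; last by apply: integrableS ig.
apply: eq_Rintegral => x; rewrite inE /= in_itv /= andbT => x0.
by rewrite /h gtr0_sg // mulr1 mulr_natl mulr2n.
Qed.

Lemma continuous_absM_powR C q : 0 < q -> continuous C ->
  continuous (fun t => `|t| `^ q * C t).
Proof.
move=> q0 cC t; apply: cvgM; last exact: cC.
have [->|t0] := eqVneq t 0.
  rewrite normr0 powR0 ?gt_eqF //; apply/cvgrPdist_le => e e0.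
  have ea : 0 < e `^ q^-1 by rewrite powR_gt0.
  have eE : (e `^ q^-1) `^ q = e by rewrite -powRrM mulVf ?gt_eqF // powRr1 // ltW.
  near=> x.
  have xe : `|x| <= e `^ q^-1.
    near: x; apply/nbhs_ballP; exists (e `^ q^-1) => //= y.
    by rewrite /ball /= sub0r normrN => /ltW.
  rewrite sub0r normrN ger0_norm ?powR_ge0 // -[leRHS]eE.
  by apply: ge0_ler_powR; rewrite ?nnegrE ?powR_ge0 ?(ltW q0).
have c1 : {for `|t|, continuous (fun x : R => x `^ q)}.
  apply/differentiable_continuous/derivable1_diffP.
  by apply: (@ex_derive _ _ _ _ _ _ _ (is_derive1_powR q _)); rewrite normr_gt0.
by apply: (continuous_cvg _ c1); apply: cvg_norm; exact: cvg_id.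
Unshelve. all: by end_near. Qed.

Lemma window_span_cvgy (b rho : nat -> R) :
  (forall n, 0 < b n) -> (forall n, 0 < rho n) ->
  (fun n => n.+1%:R * b n) @ \oo --> +oo -> (fun n => (rho n)^-1) @ \oo --> 0 ->
  (fun n => rho n * b n) @ \oo --> 0 ->
  (fun n => n%:R / rho n) @ \oo --> +oo.
Proof.
move=> b0 r0 nb rV rb; apply/cvgryPge => A.
have h1 := cvgn_near rb ltr01; have h2 := cvgn_near rV ltr01.
move/cvgryPge : nb => /(_ (`|A| + 1)) h3.
near=> n.
have n1 : rho n * b n <= 1.
  apply: le_trans (ler_norm _) _; rewrite -[X in `|X|]subr0; near: n; exact: h1.
have n2 : (rho n)^-1 <= 1.
  apply: le_trans (ler_norm _) _; rewrite -[X in `|X|]subr0; near: n; exact: h2.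
have n3 : `|A| + 1 <= n.+1%:R * b n by near: n; exact: h3.
have rb0 : 0 < rho n * b n by rewrite mulr_gt0.
have : `|A| + 1 <= n.+1%:R / rho n.
  by apply: le_trans n3 _; rewrite ler_pM2l // -[leRHS]mul1r ler_pdivlMr // mulrC.
have -> : n%:R / rho n = n.+1%:R / rho n - (rho n)^-1 by rewrite -natr1; ring.
by have := ler_norm A; lra.
Unshelve. all: by end_near. Qed.

(** Up to sign, a derivative of order [q] of the spectral density, computed on
    the covariance: the factor of the smoothing bias that depends on the
    frequency. *)
Definition psi C q lam : R := (2 * pi)^-1 * cos_transform (fun t => `|t| `^ q * C t) lam.

(** Put [t = v / rho]. Then [1 - K (b v)] is [(rho b) `^ q] times [`|t| `^ q]
    times a factor which tends to [k] because [rho b] tends to 0, and which is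
    bounded because [K] is. What remains is a Riemann sum of mesh [rho^-1] for
    the cosine transform of [`|t| `^ q * C t]. *)
Lemma window_bias C H q K (M0 : R) k lam (b rho : nat -> R) :
  decaying C H q -> 0 < q -> (forall x, `|K x| <= M0) -> has_kernel_coef K q k ->
  (forall n, 0 < b n) -> (forall n, 0 < rho n) ->
  (fun n => n.+1%:R * b n) @ \oo --> +oo -> rho @ \oo --> +oo ->
  (fun n => rho n * b n) @ \oo --> 0 ->
  (fun n => ((rho n * b n) `^ q)^-1 * ((pi * rho n)^-1 *
     \sum_(1 <= v < n.+1) (1 - K (b n * v%:R)) * C (v%:R / rho n) *
        cos (v%:R * lam / rho n))) @ \oo --> k * psi C q lam.
Proof.
move=> dC q0 KM hk b0 r0 nb ry rb.
have pi0 := pi_gt0 R.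
pose kap x := (1 - K x) / `|x| `^ q.
have [d d0 hd] : exists2 d : R, 0 < d & forall x, 0 < `|x| -> `|x| < d -> `|kap x - k| <= 1.
  have /cvgrPdist_le /(_ 1 ltr01) /nbhs_ballP [d /= d0 h] := hk.
  exists d => // x x0 xd; rewrite distrC; apply: h.
    by rewrite /ball /= sub0r normrN.
  by rewrite -normr_gt0.
have M00 : 0 <= M0 by apply: le_trans (KM 0); exact: normr_ge0.
pose B := `|k| + 1 + (1 + M0) / d `^ q.
have dq : 0 < d `^ q by rewrite powR_gt0.
have kB x : 0 < `|x| -> `|kap x| <= B.
  move=> x0; have [xd|xd] := ltP `|x| d.
    have := hd x x0 xd; have := ler_normD (kap x - k) k; rewrite subrK => h1 h2.
    rewrite /B; have : 0 <= (1 + M0) / d `^ q by rewrite divr_ge0 ?(ltW dq) //; lra.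
    lra.
  rewrite /kap normrM normfV (ger0_norm (powR_ge0 _ _)).
  apply: (@le_trans _ _ ((1 + M0) / d `^ q)).
    rewrite ler_pM ?invr_ge0 ?powR_ge0 //.
      by apply: le_trans (ler_normB _ _) _; rewrite normr1 lerD2l.
    by rewrite lef_pV2 ?posrE ?powR_gt0 //; apply: ge0_ler_powR; rewrite ?nnegrE ?(ltW q0) ?(ltW d0).
  by rewrite lerDr addr_ge0.
have B0 : 0 <= B by rewrite !addr_ge0 // divr_ge0 ?(ltW dq) // addr_ge0.
have eH := dec_env dC.
(* [B] bounds the ratio [kap] everywhere: near 0 by its limit, elsewhere by the
   bound on the kernel. *)
pose H' t := B * H t.
have eH' : tail_envelope H'.
  split.
  - by move=> x; rewrite mulr_ge0 // (env_ge0 eH).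
  - by move=> x; rewrite /H' (env_even eH).
  - by move=> x y x0 xy; rewrite ler_wpM2l // (env_mono eH).
  - exact: (@integrableZl _ _ _ mu setT measurableT B _ (env_int eH)).
pose f t := k * (`|t| `^ q * C t * cos (t * lam)).
have cg : continuous (fun t => `|t| `^ q * C t) := continuous_absM_powR q0 (dec_cont dC).
have cl : continuous (fun t : R => cos (t * lam)).
  move=> t; apply: (continuous_cvg _ (@continuous_cos R _)).
  by apply: cvgMr_tmp; exact: cvg_id.
have cgc : continuous (fun t => `|t| `^ q * C t * cos (t * lam)).
  by move=> t; apply: cvgM; [exact: cg | exact: cl].
have gH t : `| `|t| `^ q * C t | <= H t.
  by rewrite normrM (ger0_norm (powR_ge0 _ _)); exact: (dec_q dC).
pose F n v := kap (b n * v.+1%:R) * (`|v.+1%:R / rho n| `^ q * C (v.+1%:R / rho n) *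
   cos (v.+1%:R / rho n * lam)).
have rV n : 0 < (rho n)^-1 by rewrite invr_gt0.
have dV : (fun n => (rho n)^-1) @ \oo --> 0.
  by apply/gtr0_cvgV0 => //; exact: nearW.
have X : (fun n => (rho n)^-1 * \sum_(0 <= v < n) F n v) @ \oo -->
    (\int[mu]_(t in `[0%R, +oo[) f t)%R.
  apply: (riemann (N := id) rV dV _ eH').
  - exact: window_span_cvgy.
  - have mf : measurable_fun (setT : set R) f.
      by apply: continuous_measurable_fun => t; apply: cvgMl_tmp; exact: cgc.
    exact: measurable_funS mf.
  - move=> n v s s0 sv; rewrite /F normrM /H' ler_pM // ?kB //.
      by rewrite normr_gt0 mulf_neq0 ?gt_eqF.
    rewrite normrM -[leRHS]mulr1 ler_pM ?cos_max //.
    by apply: (env_le eH gH) => //; apply: le_trans sv (ler_norm _).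
  - move=> t t0 v vt; apply: cvgM; last first.
      by apply: (continuous_cvg _ (cgc t)).
    have z0 : (fun n => b n * (v n).+1%:R) @ \oo --> 0.
      rewrite -(mul0r t).
      rewrite (_ : (fun n => _) = (fun n => rho n * b n * ((v n).+1%:R / rho n))).
        by apply: cvgM.
      by apply/funext => n; field; rewrite gt_eqF.
    apply: near_cvgn => e e0.
    move/cvgrPdist_le : hk => /(_ e e0) /nbhs_ballP [d1 /= d10 h1].
    have d2 : 0 < d1 / 2 by rewrite divr_gt0.
    have := cvgn_near z0 d2; apply: filterS => n; rewrite subr0 => h2.
    rewrite distrC; apply: h1; last by rewrite mulf_neq0 ?gt_eqF.
    by rewrite /ball /= sub0r normrN; apply: le_lt_trans h2 _; lra.
have pn : pi != 0 :> R by rewrite gt_eqF.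
have igc : mu.-integrable setT (EFin \o (fun t => `|t| `^ q * C t * cos (t * lam))).
  by apply: (env_integrableM eH cg gH cl) => t; exact: cos_max.
have -> : k * psi C q lam = pi^-1 * (\int[mu]_(t in `[0%R, +oo[) f t)%R.
  rewrite /psi /cos_transform Rintegral_even //; last first.
    by move=> t; rewrite normrN (dec_even dC) mulNr cosN.
  rewrite RintegralZl //; last by apply: integrableS igc.
  move: (\int[mu]_(x in _) _)%R => J.
  by move: pi pn => P P0; field.
rewrite (_ : (fun n => _) = (fun n => pi^-1 * ((rho n)^-1 * \sum_(0 <= v < n) F n v))).
  exact: cvgMl_tmp.
apply/funext => n; rewrite big_add1 /= !mulr_sumr; apply: eq_bigr => v _.
have rn : rho n != 0 by rewrite gt_eqF.
have rbp : 0 < (rho n * b n) `^ q by rewrite powR_gt0 // mulr_gt0.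
have vr : 0 < v.+1%:R / rho n by rewrite divr_gt0.
have vrq : 0 < (v.+1%:R / rho n) `^ q by rewrite powR_gt0.
rewrite /F /kap (gtr0_norm vr) gtr0_norm ?mulr_gt0 //.
have -> : b n * v.+1%:R = rho n * b n * (v.+1%:R / rho n) by field.
rewrite (@powRM _ (rho n * b n) (v.+1%:R / rho n)) ?(ltW vr) ?mulr_ge0 ?(ltW (r0 n)) ?(ltW (b0 n)) //.
have -> : v.+1%:R / rho n * lam = v.+1%:R * lam / rho n by ring.
move: (cos _) (C _) (K _) rbp vrq => c1 c2 c3.
move: (_ `^ q) ((_ / rho n) `^ q) => p1 p2 p10 p20.
by move: pi pn => P P0; field; rewrite P0 rn !gt_eqF.
Qed.

End WindowBias.

(** * Expansion of the bias *)

Section Bias.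
Context {R : realType}.
Notation mu := (@lebesgue_measure R).
Implicit Types (f g H C K : R -> R) (lam p q k : R).

(** The expectation of the estimator, see [expected_density_quad]. *)
Definition expected_density C K (b r lam : R) (n : nat) : R :=
  (2 * pi * r)^-1 * (C 0 + 2 * \sum_(1 <= v < n)
    (1 - v%:R / n%:R) * K (b * v%:R) * C (v%:R / r) * cos (v%:R * lam / r)).

(** The three sources of bias: aliasing, the window, and the triangular
    weights [1 - v / n] of the sample covariances. *)
Lemma expected_densityE C K (b r lam : R) n : 0 < r ->
  expected_density C K b r lam n = sampled_density C r lam n -
   (pi * r)^-1 * (\sum_(1 <= v < n) (1 - K (b * v%:R)) * C (v%:R / r) * cos (v%:R * lam / r)) -
   (pi * r)^-1 * (\sum_(1 <= v < n) v%:R / n%:R * K (b * v%:R) * C (v%:R / r) * cos (v%:R * lam / r)).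
Proof.
move=> r0; have pn : pi != 0 :> R by rewrite gt_eqF // pi_gt0.
have rn : r != 0 by rewrite gt_eqF.
rewrite /expected_density /sampled_density.
have -> : \sum_(1 <= v < n) (1 - v%:R / n%:R) * K (b * v%:R) * C (v%:R / r) * cos (v%:R * lam / r) =
   \sum_(1 <= v < n) C (v%:R / r) * cos (v%:R * lam / r) -
   \sum_(1 <= v < n) (1 - K (b * v%:R)) * C (v%:R / r) * cos (v%:R * lam / r) -
   \sum_(1 <= v < n) v%:R / n%:R * K (b * v%:R) * C (v%:R / r) * cos (v%:R * lam / r).
  by rewrite -!sumrB; apply: eq_bigr => v _; ring.
move: (\sum_(1 <= v < n) _) (\sum_(1 <= v < n) _) (\sum_(1 <= v < n) _) => x y z.
by move: pi pn => P P0; field; rewrite ?P0 ?rn.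
Qed.

(** The factor [v] of the triangular weight is absorbed by the envelope of
    [`|t| * `|C t|], which leaves [r / n]. *)
Lemma taper_bias C H q K (M0 b r lam : R) n : decaying C H q -> 1 <= r -> (0 < n)%N ->
  (forall x, `|K x| <= M0) ->
  `|(pi * r)^-1 * (\sum_(1 <= v < n) v%:R / n%:R * K (b * v%:R) * C (v%:R / r) *
     cos (v%:R * lam / r))| <= M0 * (\int[mu]_(t in `[0%R, +oo[) H t)%R * r / n%:R.
Proof.
move=> dC r1 n0 KM; have r0 : 0 < r by lra.
have n0' : 0 < n%:R :> R by rewrite ltr0n.
have eH := dec_env dC; set I := (\int[mu]_(t in _) _)%R.
have M00 : 0 <= M0 by apply: le_trans (KM 0); exact: normr_ge0.
have p2 := pi_ge2 R.
rewrite normrM ger0_norm; last by rewrite invr_ge0 mulr_ge0 // ?(ltW r0) //; lra.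
apply: (@le_trans _ _ ((pi * r)^-1 * (M0 * r / n%:R * \sum_(0 <= v < n) H (v.+1%:R * r^-1)))).
  rewrite ler_wpM2l //; first by rewrite invr_ge0 mulr_ge0 // ?(ltW r0) //; lra.
  apply: le_trans (ler_norm_sum _ _ _) _.
  have -> : \sum_(0 <= v < n) H (v.+1%:R * r^-1) = \sum_(1 <= v < n.+1) H (v%:R / r).
    by rewrite big_add1.
  apply: (@le_trans _ _ (M0 * r / n%:R * \sum_(1 <= v < n) H (v%:R / r))).
    rewrite mulr_sumr; apply: ler_sum => v _.
    have vr : 0 <= v%:R / r by rewrite divr_ge0 // ltW.
    have := dec_1 dC (v%:R / r); rewrite (ger0_norm vr) => h.
    rewrite !normrM normfV !normr_nat.
    apply: (@le_trans _ _ (v%:R / n%:R * M0 * `|C (v%:R / r)| * 1)).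
      rewrite ler_pM ?cos_max //; rewrite ?mulr_ge0 ?invr_ge0 //.
      by rewrite ler_wpM2r // ler_wpM2l // mulr_ge0 // invr_ge0.
    have -> : v%:R / n%:R * M0 * `|C (v%:R / r)| * 1 =
       M0 * r / n%:R * (v%:R / r * `|C (v%:R / r)|) by field; rewrite !gt_eqF.
    by rewrite ler_wpM2l // mulr_ge0 ?invr_ge0 // mulr_ge0 // ltW.
  rewrite ler_wpM2l //; first by rewrite mulr_ge0 ?invr_ge0 // mulr_ge0 // ltW.
  by rewrite [leRHS]big_nat_recr //= lerDl (env_ge0 eH).
have h := env_sum_le n eH (_ : 0 < r^-1); move: h; rewrite invr_gt0 => /(_ r0).
rewrite -/I => h.
have -> : (pi * r)^-1 * (M0 * r / n%:R * \sum_(0 <= v < n) H (v.+1%:R * r^-1)) =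
  pi^-1 * (M0 * r / n%:R * (r^-1 * \sum_(0 <= v < n) H (v.+1%:R * r^-1))).
  by rewrite invfM; ring.
apply: (@le_trans _ _ (1 * (M0 * r / n%:R * I))).
  have q0 : 0 <= M0 * r / n%:R by rewrite mulr_ge0 ?invr_ge0 // mulr_ge0 // ltW.
  rewrite ler_pM ?invr_ge0 ?pi_ge0 //; last by rewrite ler_wpM2l.
    rewrite mulr_ge0 // mulr_ge0 ?invr_ge0 ?(ltW r0) // sumr_ge0 // => v _.
    exact: (env_ge0 eH).
  by rewrite invf_le1 ?pi_gt0 //; lra.
by rewrite mul1r; have -> : M0 * r / n%:R * I = M0 * I * r / n%:R by ring.
Qed.

(** The expansion [Z x - k psi y + o(x + y + z)], where [x = rho `^ (- p)],
    [y = (rho b) `^ q] and [z = (n b)^-1]. The truncation and the triangular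
    weights cost [O(rho / n)], which is [o(z)] since [rho / n = rho b z].
    Sample sizes are [n + 1] from here on, so that widths and rates are
    positive at all indices. *)
Lemma bias_expansion C H q K (M0 : R) k p (Z B : R) (b rho : nat -> R) :
  decaying C H q -> 0 < q -> (forall x, `|K x| <= M0) -> has_kernel_coef K q k ->
  (forall lam (e : R), 0 < e -> exists2 r0 : R, 1 <= r0 & forall r V, r0 <= r -> (0 < V)%N ->
    `|sampled_density C r lam V - spectral_density C lam - Z * r `^ (- p)| <=
      e * r `^ (- p) + B * r / V%:R) ->
  (forall n, 0 < b n) -> (forall n, 0 < rho n) ->
  (fun n => n.+1%:R * b n) @ \oo --> +oo -> rho @ \oo --> +oo ->
  (fun n => rho n * b n) @ \oo --> 0 ->
  forall lam (e : R), 0 < e -> \forall n \near \oo,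
    `|expected_density C K (b n) (rho n) lam n.+1 - spectral_density C lam -
       (Z * rho n `^ (- p) - k * psi C q lam * (rho n * b n) `^ q)| <=
     e * (rho n `^ (- p) + (rho n * b n) `^ q + (n.+1%:R * b n)^-1).
Proof.
move=> dC q0 KM hk hZ b0 r0 nb ry rb lam e e0.
have [R0 R01 hR] := hZ lam e e0.
have W := cvgn_near (@window_bias R C H q K M0 k lam b rho dC q0 KM hk b0 r0 nb ry rb) e0.
pose I := (\int[mu]_(t in `[0%R, +oo[) H t)%R.
have I0 : 0 <= I by apply: Rintegral_ge0 => t _; exact: (env_ge0 (dec_env dC)).
have M00 : 0 <= M0 by apply: le_trans (KM 0); exact: normr_ge0.
pose D : R := `|B| + M0 * I + 1.
have D0 : 0 < D by rewrite ltr_wpDl // addr_ge0 // mulr_ge0.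
have eD : 0 < e / D by rewrite divr_gt0.
have h2 := cvgn_near rb eD.
move/cvgryPge : ry => /(_ R0) h3.
near=> n.
have rR : R0 <= rho n by near: n; exact: h3.
have r1 : 1 <= rho n by lra.
have rb1 : rho n * b n <= e / D.
  apply: le_trans (ler_norm _) _; rewrite -[X in `|X|]subr0; near: n; exact: h2.
have Wn : `|((rho n * b n) `^ q)^-1 * ((pi * rho n)^-1 *
     \sum_(1 <= v < n.+1) (1 - K (b n * v%:R)) * C (v%:R / rho n) *
        cos (v%:R * lam / rho n)) - k * psi C q lam| <= e by near: n; exact: W.
have A1 := hR (rho n) n.+1 rR isT.
have A2 := @taper_bias C H q K M0 (b n) (rho n) lam n.+1 dC r1 isT KM.
rewrite -/I in A2; rewrite expected_densityE //.
set x := rho n `^ (- p) in A1 *; set y := (rho n * b n) `^ q in Wn *.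
have y0 : 0 < y by rewrite powR_gt0 // mulr_gt0.
set w := (_^-1 * \sum_(1 <= v < n.+1) (1 - _) * _ * _) in Wn *.
set u := (_^-1 * \sum_(1 <= v < n.+1) _) in A2 *.
have A3 : `|w - k * psi C q lam * y| <= e * y.
  have -> : w - k * psi C q lam * y = y * (y^-1 * w - k * psi C q lam).
    by field; rewrite gt_eqF.
  by rewrite normrM (gtr0_norm y0) mulrC ler_wpM2r // ltW.
have zE : rho n / n.+1%:R = rho n * b n * (n.+1%:R * b n)^-1.
  by field; rewrite gt_eqF //= addrC natr1.
set z := (n.+1%:R * b n)^-1 in zE *.
have z0 : 0 < z by rewrite invr_gt0 mulr_gt0.
have A4 : D * (rho n / n.+1%:R) <= e * z.
  by rewrite zE mulrA ler_wpM2r ?(ltW z0) // mulrC -ler_pdivlMr.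
have A5 : B * rho n / n.+1%:R + M0 * I * rho n / n.+1%:R <= D * (rho n / n.+1%:R).
  rewrite -!(mulrA _ (rho n)) -mulrDl ler_wpM2r ?divr_ge0 ?(ltW (r0 n)) //.
  by rewrite /D; have := ler_norm B; lra.
move: A1 A2 A3; rewrite !ler_norml => /andP[a1 a2] /andP[a3 a4] /andP[a5 a6].
have A6 := le_trans A5 A4; clearbody x y w u z I; move: A6 a1 a2 a3 a4 a5 a6; clear.
move: (B * _ / _) (M0 * _ * _ / _) (k * _ * y) (sampled_density _ _ _ _) (spectral_density _ _) => t1 t2 t3 t4 t5.
move: (Z * x) => t6 *.
by apply/andP; split; lra.
Unshelve. all: by end_near. Qed.

End Bias.

(** * Convolution sums on a finite grid *)

Section Sums.
Context {R : realType}.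
Notation mu := (@lebesgue_measure R).
Implicit Types (f g H C K : R -> R).

Lemma row_sum_le H (d : R) N j : tail_envelope H -> 0 < d ->
  d * \sum_(0 <= l < N) H ((j%:R - l%:R) * d) <=
  d * H 0 + 2 * (\int[mu]_(t in `[0%R, +oo[) H t)%R.
Proof.
move=> eH d0; have Hp := env_ge0 eH.
have h1 := env_sum_le j eH d0; have h2 := env_sum_le N eH d0.
have -> : d * H 0 + 2 * (\int[mu]_(t in `[0%R, +oo[) H t)%R =
  d * H 0 + ((\int[mu]_(t in `[0%R, +oo[) H t)%R + (\int[mu]_(t in `[0%R, +oo[) H t)%R).
  by ring.
apply: le_trans (lerD (lexx _) (lerD h1 h2)); rewrite -!mulrDr ler_wpM2l ?(ltW d0) //.
apply: (@le_trans _ _ (\sum_(0 <= l < j.+1 + N) H ((j%:R - l%:R) * d))).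
  rewrite [leRHS](big_cat_nat (leq0n N) (leq_addl _ _)) /= lerDl.
  by rewrite sumr_ge0.
rewrite (big_cat_nat (leq0n j.+1) (leq_addr _ _)) /= addrA lerD //.
  rewrite big_nat_rev /= add0n big_nat_recl //= lerD //.
    by rewrite subSS subn0 subrr mul0r.
  rewrite big_nat [leRHS]big_nat; apply: ler_sum => i /andP[_ ij].
  by rewrite (_ : (j.+1 - i.+2)%N = (j - i.+1)%N) // natrB // opprB addrC subrK.
rewrite -{1}[j.+1]add0n big_addn addKn; apply: ler_sum => i _.
rewrite -(env_even eH) -mulNr opprB natrD -!natr1.
by have -> : i%:R + (j%:R + 1) - j%:R = i%:R + 1 :> R by ring.
Qed.

Lemma ler_subsum (f : nat -> R) m m' n' n : (m <= m')%N -> (n' <= n)%N ->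
  (forall i, 0 <= f i) -> \sum_(m' <= i < n') f i <= \sum_(m <= i < n) f i.
Proof.
move=> mm nn f0; have [nm|mn] := leqP n' m'.
  by rewrite big_geq // sumr_ge0.
rewrite (@big_cat_nat _ _ _ m' m n) //=; last by lia.
rewrite (@big_cat_nat _ _ _ n' m' n) //=; last by lia.
by rewrite addrCA lerDl addr_ge0 // sumr_ge0.
Qed.

Lemma exchange_nat (F : nat -> nat -> R) a b : \sum_(0 <= i < a) \sum_(0 <= j < b) F i j =
  \sum_(0 <= j < b) \sum_(0 <= i < a) F i j.
Proof. exact: exchange_big. Qed.

Section Edge.
Variables (C phi : R -> R) (r th : R) (N : nat).
Hypothesis phiE : forall x y, phi (x + y) + phi (x - y) = 2 * phi x * cos y.
Hypothesis phi1 : forall x, `|phi x| <= 1.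
Hypothesis Cev : forall t, C (- t) = C t.

(** The part of the covariance row of [j] that falls outside the sample, on
    its left and on its right. *)
Definition edge (j : nat) : R :=
  \sum_(j.+1 <= v < N) `|C (v%:R / r)| + \sum_(N - j <= v < N) `|C (v%:R / r)|.

Definition spectral_sum : R := C 0 + 2 * \sum_(1 <= v < N) C (v%:R / r) * cos (v%:R * th).

(** Translation-invariant convolution multiplies [cos] and [sin] by
    [spectral_sum]; on the finite grid the error is the missing part of the
    row. The functional equation [phiE], satisfied by both functions, replaces
    complex exponentials. *)
Lemma edge_bound j : (j < N)%N ->
  `|\sum_(0 <= l < N) C ((j%:R - l%:R) / r) * phi (l%:R * th) - spectral_sum * phi (j%:R * th)|
   <= edge j.
Proof.
move=> jN.
pose lo v := C (v%:R / r) * phi (j%:R * th - v%:R * th).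
pose hi v := C (v%:R / r) * phi (j%:R * th + v%:R * th).
have e1 : spectral_sum * phi (j%:R * th) = C 0 * phi (j%:R * th) +
    (\sum_(1 <= v < N) lo v + \sum_(1 <= v < N) hi v).
  rewrite mulrDl; congr (_ + _); rewrite mulr_sumr mulr_suml -big_split /=.
  apply: eq_bigr => v _; rewrite /lo /hi [RHS]addrC -mulrDr phiE; ring.
have e2 : \sum_(0 <= l < N) C ((j%:R - l%:R) / r) * phi (l%:R * th) =
   C 0 * phi (j%:R * th) + (\sum_(1 <= v < j.+1) lo v + \sum_(1 <= v < N - j) hi v).
  rewrite (@big_cat_nat _ _ _ j 0 N) //=; last exact: ltnW.
  rewrite [X in _ + X]big_ltn // subrr mul0r addrCA; congr (_ + (_ + _)).
    rewrite big_nat_rev /= add0n big_add1 /= big_nat [RHS]big_nat.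
    apply: eq_bigr => v /andP[_ vj]; rewrite /lo natrB // opprB addrC subrK.
    by congr (_ * phi _); ring.
  rewrite -{1}[j.+1]add1n big_addn; apply: eq_bigr => v _.
  rewrite /hi natrD -Cev; congr (C _ * phi _); ring.
rewrite e1 e2.
have s1 : \sum_(1 <= v < N) lo v = \sum_(1 <= v < j.+1) lo v + \sum_(j.+1 <= v < N) lo v.
  by rewrite (@big_cat_nat _ _ _ j.+1).
have s2 : \sum_(1 <= v < N) hi v = \sum_(1 <= v < N - j) hi v + \sum_(N - j <= v < N) hi v.
  by rewrite (@big_cat_nat _ _ _ (N - j)) //; lia.
have -> : C 0 * phi (j%:R * th) + (\sum_(1 <= v < j.+1) lo v + \sum_(1 <= v < N - j) hi v) -
   (C 0 * phi (j%:R * th) + (\sum_(1 <= v < N) lo v + \sum_(1 <= v < N) hi v)) =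
   - (\sum_(j.+1 <= v < N) lo v + \sum_(N - j <= v < N) hi v) by rewrite s1 s2; ring.
rewrite normrN; apply: le_trans (ler_normD _ _) _; rewrite /edge.
apply: lerD; apply: le_trans (ler_norm_sum _ _ _) _; apply: ler_sum => v _;
  by rewrite normrM ler_piMr.
Qed.

End Edge.

Lemma edge_ge0 C (r : R) N j : 0 <= edge C r N j.
Proof. by rewrite addr_ge0 // sumr_ge0. Qed.

(** The lag [v] is missing from [v] rows on each side, and the envelope of
    [`|t| * `|C t|] sums [v * `|C (v / r)|] to [O(r ^+ 2)]. *)
Lemma edge_sum_le C H q (r : R) N : decaying C H q -> 0 < r ->
  \sum_(0 <= j < N) edge C r N j <= 2 * (\int[mu]_(t in `[0%R, +oo[) H t)%R * r ^+ 2.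
Proof.
move=> dC r0; rewrite big_split /=; have eH := dec_env dC.
set I := (\int[mu]_(t in _) _)%R.
pose c v := `|C (v%:R / r)|.
have e1 : \sum_(0 <= j < N) \sum_(N - j <= v < N) c v = \sum_(0 <= j < N) \sum_(j.+1 <= v < N) c v.
  rewrite big_nat_rev /= add0n big_nat [RHS]big_nat; apply: eq_bigr => j /andP[_ jN].
  by rewrite (_ : (N - (N - j.+1))%N = j.+1) //; lia.
rewrite e1.
have b1 : \sum_(0 <= j < N) \sum_(j.+1 <= v < N) c v <= \sum_(0 <= v < N) v%:R * c v.
  have -> : \sum_(0 <= j < N) \sum_(j.+1 <= v < N) c v =
     \sum_(0 <= j < N) \sum_(0 <= v < N) (if (j < v)%N then c v else 0).
    rewrite big_nat [RHS]big_nat; apply: eq_bigr => j /andP[_ jN].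
    rewrite (@big_cat_nat _ _ _ j.+1 0 N) //=.
    rewrite [X in _ = X + _]big_nat [X in _ = X + _]big1 ?add0r; last first.
      by move=> v /andP[_ vj]; rewrite ltnNge -ltnS vj.
    by rewrite big_nat [RHS]big_nat; apply: eq_bigr => v /andP[jv _]; rewrite jv.
  rewrite exchange_nat big_nat [leRHS]big_nat; apply: ler_sum => v /andP[_ vN].
  rewrite (@big_cat_nat _ _ _ v 0 N) //=; last exact: ltnW.
  rewrite [X in _ + X]big_nat [X in _ + X]big1 ?addr0; last first.
    by move=> i /andP[vi _]; rewrite ltnNge vi.
  rewrite big_nat (eq_bigr (fun=> c v)); last by move=> i /andP[_ ->].
  by rewrite -big_nat big_const_nat iter_addr_0 subn0 mulr_natl.
have b2 : \sum_(0 <= v < N) v%:R * c v <= r ^+ 2 * I.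
  have h := @env_sum_le _ H r^-1 N eH; move: h; rewrite invr_gt0 => /(_ r0); rewrite -/I => h.
  rewrite -ler_pdivrMl ?exprn_gt0 //; apply: le_trans h.
  have -> : (r ^+ 2)^-1 = r^-1 * r^-1 by rewrite expr2 invfM.
  rewrite -mulrA ler_wpM2l ?invr_ge0 ?(ltW r0) // mulr_sumr.
  apply: (@le_trans _ _ (\sum_(1 <= v < N.+1) H (v%:R / r))); last by rewrite big_add1.
  case: (N) => [|n]; first by rewrite big_geq // sumr_ge0 // => *; exact: (env_ge0 eH).
  rewrite big_ltn // mul0r mulr0 add0r.
  apply: (@le_trans _ _ (\sum_(1 <= v < n.+1) H (v%:R / r))).
    apply: ler_sum => v _; apply: le_trans (dec_1 dC _).
    by rewrite normrM normr_nat ger0_norm ?invr_ge0 ?(ltW r0) // mulrA (mulrC r^-1).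
  by apply: ler_subsum => // i; exact: (env_ge0 eH).
have := le_trans b1 b2; rewrite (_ : 2 * I * r ^+ 2 = r ^+ 2 * I + r ^+ 2 * I); last by ring.
by move=> h; exact: lerD.
Qed.

End Sums.

(** * The Gaussian part of the variance *)

Section Quad.
Context {R : realType}.
Notation mu := (@lebesgue_measure R).
Implicit Types (f g H C K M : R -> R).

(** The coefficient of the pair [(j, k)] in the estimator. *)
Definition amp K (b th : R) (j k : nat) : R :=
  K (b * (j%:R - k%:R)) * cos ((j%:R - k%:R) * th).

Definition lagcov C (r : R) (j k : nat) : R := C ((j%:R - k%:R) / r).

(** One of the two equal crossed pairings of the fourth moment of a quadratic
    form with symmetric coefficients [a] in a Gaussian vector of covariance
    [c]. *)
Definition quad4 (N : nat) (a c : nat -> nat -> R) : R :=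
  \sum_(0 <= j < N) \sum_(0 <= k < N) a j k *
    \sum_(0 <= l < N) \sum_(0 <= m < N) a l m * (c j l * c k m).

Definition env_mass H : R := H 0 + 2 * (\int[mu]_(t in `[0%R, +oo[) H t)%R.

Lemma env_mass_ge0 H : tail_envelope H -> 0 <= env_mass H.
Proof.
move=> eH; rewrite addr_ge0 ?(env_ge0 eH) // mulr_ge0 // Rintegral_ge0 // => t _.
exact: (env_ge0 eH).
Qed.

Lemma row_mass_le H (d : R) N j : tail_envelope H -> 0 < d -> d <= 1 ->
  \sum_(0 <= l < N) H ((j%:R - l%:R) * d) <= env_mass H / d.
Proof.
move=> eH d0 d1; rewrite ler_pdivlMr // mulrC.
apply: le_trans (row_sum_le N j eH d0) _; rewrite lerD2r.
by rewrite ler_piMl // (env_ge0 eH).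
Qed.

Lemma env0_ge H x : tail_envelope H -> H x <= H 0.
Proof. by move=> eH; rewrite -(env_norm x eH); apply: (env_mono eH). Qed.

Lemma amp_le K M (b th : R) j k : (forall x, `|K x| <= M x) ->
  `|amp K b th j k| <= M ((j%:R - k%:R) * b).
Proof.
move=> KM; rewrite normrM (mulrC _ b) -[leRHS]mulr1 ler_pM ?cos_max //.
Qed.

Lemma sum_amp_le K M (b th : R) N : (forall x, `|K x| <= M x) ->
  tail_envelope M -> 0 < b -> b <= 1 ->
  \sum_(0 <= j < N) \sum_(0 <= k < N) `|amp K b th j k| <= N%:R * (env_mass M / b).
Proof.
move=> KM eM b0 b1.
apply: (@le_trans _ _ (\sum_(0 <= j < N) env_mass M / b)); last first.
  by rewrite big_const_nat iter_addr_0 subn0 mulr_natl.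
apply: ler_sum => j _; apply: le_trans (row_mass_le N j eM b0 b1).
by apply: ler_sum => k _; exact: amp_le.
Qed.

Lemma sum_prod (u v : nat -> R) N :
  \sum_(0 <= l < N) \sum_(0 <= m < N) u l * v m =
  (\sum_(0 <= l < N) u l) * (\sum_(0 <= m < N) v m).
Proof. by rewrite big_distrlr. Qed.

Section Bounds.
Variables (C H K M : R -> R) (q r b th : R) (N : nat).
Hypothesis dC : decaying C H q.
Hypothesis KM : forall x, `|K x| <= M x.
Hypothesis eM : tail_envelope M.
Hypotheses (b0 : 0 < b) (b1 : b <= 1) (r1 : 1 <= r).
Let r0 : 0 < r. Proof. exact: lt_le_trans r1. Qed.
Let eH : tail_envelope H. Proof. exact: dec_env dC. Qed.
Let Hjl j l := H ((j%:R - l%:R) / r).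
Let SH := env_mass H.
Let c := lagcov C r.
Let a := amp K b th.

Let rV0 : 0 < r^-1. Proof. by rewrite invr_gt0. Qed.
Let rV1 : r^-1 <= 1. Proof. by rewrite invf_le1. Qed.
Let SH0 : 0 <= SH. Proof. exact: env_mass_ge0. Qed.
Let SM0 : 0 <= env_mass M. Proof. exact: env_mass_ge0. Qed.
Let M00 : 0 <= M 0. Proof. exact: (env_ge0 eM). Qed.
Let Hjl0 j l : 0 <= Hjl j l. Proof. exact: (env_ge0 eH). Qed.

Lemma cov_le j l : `|c j l| <= Hjl j l.
Proof. exact: (dec_0 dC). Qed.

Lemma cov_lag_le j l : `|j%:R - l%:R| * `|c j l| <= r * Hjl j l.
Proof.
rewrite -ler_pdivrMl // mulrA; apply: le_trans (dec_1 dC _).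
by rewrite normrM (gtr0_norm rV0) (mulrC r^-1).
Qed.

Lemma row_cov_le j : \sum_(0 <= l < N) Hjl j l <= r * SH.
Proof.
apply: le_trans (row_mass_le N j eH rV0 rV1) _; by rewrite invrK mulrC.
Qed.

Lemma sum_cov2_le j k :
  \sum_(0 <= l < N) \sum_(0 <= m < N) Hjl j l * Hjl k m <= (r * SH) ^+ 2.
Proof.
rewrite sum_prod expr2; apply: ler_pM; rewrite ?row_cov_le //; exact: sumr_ge0.
Qed.

(** One amplitude is bounded by its maximum; the two covariances then sum to
    [O(r ^+ 2)] over [l] and [m], and the other amplitude to [O(N / b)]. *)
Lemma quad_upper : `|quad4 N a c| <= N%:R * (env_mass M / b) * (M 0 * (r * SH) ^+ 2).
Proof.
apply: le_trans (ler_norm_sum _ _ _) _.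
apply: le_trans (ler_wpM2r _ (sum_amp_le th N KM eM b0 b1)).
  rewrite mulr_suml; apply: ler_sum => j _.
  rewrite mulr_suml; apply: le_trans (ler_norm_sum _ _ _) _; apply: ler_sum => k _.
  rewrite normrM ler_wpM2l //.
  apply: (@le_trans _ _ (M 0 * \sum_(0 <= l < N) \sum_(0 <= m < N) Hjl j l * Hjl k m)).
    apply: le_trans (ler_norm_sum _ _ _) _; rewrite mulr_sumr; apply: ler_sum => l _.
    apply: le_trans (ler_norm_sum _ _ _) _; rewrite mulr_sumr; apply: ler_sum => m _.
    rewrite normrM; apply: ler_pM => //.
      by apply: le_trans (amp_le _ _ _ _ KM) _; exact: env0_ge.
    by rewrite normrM; apply: ler_pM => //; exact: cov_le.
  by rewrite ler_wpM2l // sum_cov2_le.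
by rewrite mulr_ge0 // sqr_ge0.
Qed.

Let S := spectral_sum C r th N.
Let P j := \sum_(0 <= l < N) c j l * cos (l%:R * th).
Let Q j := \sum_(0 <= l < N) c j l * sin (l%:R * th).
Let E j := edge C r N j.

Let row_abs (phi : R -> R) j : (forall x, `|phi x| <= 1) ->
  `|\sum_(0 <= l < N) c j l * phi (l%:R * th)| <= r * SH.
Proof.
move=> p1; apply: le_trans (ler_norm_sum _ _ _) _; apply: le_trans (row_cov_le j).
apply: ler_sum => l _; rewrite normrM -[leRHS]mulr1 ler_pM //; exact: cov_le.
Qed.

Lemma spectral_sum_le : `|S| <= r * SH.
Proof.
have h : `|S| <= H 0 + 2 * \sum_(0 <= v < N) H (v.+1%:R * r^-1).
  apply: le_trans (ler_normD _ _) _; apply: lerD; first exact: (dec_0 dC).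
  rewrite normrM gtr0_norm // ler_wpM2l //; apply: le_trans (ler_norm_sum _ _ _) _.
  apply: (@le_trans _ _ (\sum_(1 <= v < N) H (v%:R / r))).
    apply: ler_sum => v _; rewrite normrM -[leRHS]mulr1 ler_pM ?cos_max //; exact: (dec_0 dC).
  rewrite (_ : \sum_(0 <= v < N) H (v.+1%:R * r^-1) = \sum_(1 <= v < N.+1) H (v%:R / r)).
    by apply: ler_subsum => // i; exact: (env_ge0 eH).
  by rewrite big_add1.
apply: le_trans h _; rewrite mulrDr lerD //.
  by rewrite ler_peMl // (env_ge0 eH).
rewrite mulrCA ler_wpM2l // -ler_pdivrMl //; exact: env_sum_le.
Qed.

Let boundP j : (j < N)%N -> `|P j - S * cos (j%:R * th)| <= E j.
Proof.
move=> jN; apply: edge_bound => //; last exact: (dec_even dC).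
- by move=> x y; rewrite cosD cosB; ring.
- exact: cos_max.
Qed.

Let boundQ j : (j < N)%N -> `|Q j - S * sin (j%:R * th)| <= E j.
Proof.
move=> jN; apply: edge_bound => //; last exact: (dec_even dC).
- by move=> x y; rewrite sinD sinB; ring.
- exact: sin_max.
Qed.

Let prod_close (x y u v B e f : R) : `|x| <= B -> `|v| <= B -> `|x - u| <= e -> `|y - v| <= f ->
  `|x * y - u * v| <= B * (e + f).
Proof.
move=> xB vB xu yv.
have -> : x * y - u * v = x * (y - v) + (x - u) * v by ring.
apply: le_trans (ler_normD _ _) _; rewrite !normrM mulrDr addrC; apply: lerD.
  by rewrite mulrC; apply: ler_pM.
by apply: ler_pM.
Qed.

Let J j k := \sum_(0 <= l < N) \sum_(0 <= m < N)
   cos ((l%:R - m%:R) * th) * (c j l * c k m).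

Let JE j k : J j k = P j * P k + Q j * Q k.
Proof.
rewrite /P /Q -!sum_prod -big_split; apply: eq_bigr => l _ /=.
rewrite -big_split; apply: eq_bigr => m _ /=.
by rewrite mulrBl cosB; ring.
Qed.

Let J_close j k : (j < N)%N -> (k < N)%N ->
  `|J j k - S ^+ 2 * cos ((j%:R - k%:R) * th)| <= 2 * (r * SH) * (E j + E k).
Proof.
move=> jN kN; rewrite JE.
have -> : P j * P k + Q j * Q k - S ^+ 2 * cos ((j%:R - k%:R) * th) =
  (P j * P k - S * cos (j%:R * th) * (S * cos (k%:R * th))) +
  (Q j * Q k - S * sin (j%:R * th) * (S * sin (k%:R * th))).
  by rewrite mulrBl cosB; ring.
have Sphi (phi : R -> R) x : (forall x, `|phi x| <= 1) -> `|S * phi x| <= r * SH.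
  by move=> p1; rewrite normrM -[leRHS]mulr1 ler_pM // spectral_sum_le.
apply: le_trans (ler_normD _ _) _.
have -> : 2 * (r * SH) * (E j + E k) = r * SH * (E j + E k) + r * SH * (E j + E k) by ring.
apply: lerD; apply: prod_close.
- by apply: row_abs => x; exact: cos_max.
- by apply: Sphi => x; exact: cos_max.
- exact: boundP.
- exact: boundP.
- by apply: row_abs => x; exact: sin_max.
- by apply: Sphi => x; exact: sin_max.
- exact: boundQ.
- exact: boundQ.
Qed.

Variables (eps B : R).
Hypotheses (eps0 : 0 <= eps) (B0 : 0 <= B).
Hypothesis Kuc : forall x y, `|K x - K y| <= eps + B * `|x - y|.

Let T j k := \sum_(0 <= l < N) \sum_(0 <= m < N) a l m * (c j l * c k m).
Let kap j k := K (b * (j%:R - k%:R)).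

Let T_close j k : `|T j k - kap j k * J j k| <= (r * SH) ^+ 2 * (eps + 2 * B * b * r).
Proof.
rewrite [leRHS]mulrC; apply: le_trans (ler_wpM2l _ (sum_cov2_le j k)); last first.
  by rewrite addr_ge0 // !mulr_ge0 // ltW.
rewrite /T /J !mulr_sumr -sumrB; apply: le_trans (ler_norm_sum _ _ _) _.
apply: ler_sum => l _.
rewrite !mulr_sumr -sumrB; apply: le_trans (ler_norm_sum _ _ _) _.
apply: ler_sum => m _; rewrite /a /amp -/(kap l m).
have -> : kap l m * cos ((l%:R - m%:R) * th) * (c j l * c k m) -
    kap j k * (cos ((l%:R - m%:R) * th) * (c j l * c k m)) =
    (kap l m - kap j k) * cos ((l%:R - m%:R) * th) * (c j l * c k m) by ring.
rewrite 2!normrM.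
apply: (@le_trans _ _ ((eps + B * (b * (`|j%:R - l%:R| + `|k%:R - m%:R|))) * `|c j l * c k m|)).
  rewrite ler_wpM2r // -[leRHS]mulr1 ler_pM ?cos_max //.
  apply: le_trans (Kuc _ _) _; rewrite lerD2l ler_wpM2l //.
  rewrite -mulrBr normrM (gtr0_norm b0) ler_wpM2l ?(ltW b0) //.
  have -> : l%:R - m%:R - (j%:R - k%:R) = (k%:R - m%:R) - (j%:R - l%:R) :> R by ring.
  by rewrite [leRHS]addrC; exact: ler_normB.
have h1 := cov_lag_le j l; have h2 := cov_lag_le k m.
have h3 := cov_le j l; have h4 := cov_le k m.
rewrite normrM; set x := `|c j l| in h1 h3 *; set y := `|c k m| in h2 h4 *.
have x0 : 0 <= x by rewrite normr_ge0.
have y0 : 0 <= y by rewrite normr_ge0.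
have -> : (eps + B * (b * (`|j%:R - l%:R| + `|k%:R - m%:R|))) * (x * y) =
  eps * (x * y) + B * b * ((`|j%:R - l%:R| * x) * y + x * (`|k%:R - m%:R| * y)) by ring.
have -> : (eps + 2 * B * b * r) * (Hjl j l * Hjl k m) = eps * (Hjl j l * Hjl k m) +
   B * b * (r * Hjl j l * Hjl k m + Hjl j l * (r * Hjl k m)) by ring.
apply: lerD; first by rewrite ler_wpM2l // ler_pM.
rewrite ler_wpM2l //; first by rewrite mulr_ge0 // ltW.
by apply: lerD; apply: ler_pM => //; rewrite mulr_ge0.
Qed.

(** The covariances force [l] close to [j] and [m] close to [k] at scale [r],
    while the kernel varies at scale [b^-1], which is much larger. So the
    kernel can be frozen at the lag [j - k]; the first error term is its
    oscillation. The inner sums then factor into convolutions, equal to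
    [S ^+ 2 * cos ((j - k) th)] up to edge effects, the second error term.
    What is left is [S ^+ 2] times the sum of the squared amplitudes. *)
Lemma quad_lower :
  S ^+ 2 * \sum_(0 <= j < N) \sum_(0 <= k < N) a j k ^+ 2 -
  (N%:R * (env_mass M / b) * ((r * SH) ^+ 2 * (eps + 2 * B * b * r)) +
   8 * M 0 * (env_mass M / b) * SH * (\int[mu]_(t in `[0%R, +oo[) H t)%R * r ^+ 3)
  <= quad4 N a c.
Proof.
set E1 := (r * SH) ^+ 2 * (eps + _).
have E10 : 0 <= E1.
  by rewrite mulr_ge0 ?sqr_ge0 // addr_ge0 // !mulr_ge0 // ltW.
have E0 j : 0 <= E j by exact: edge_ge0.
have key j k : (j < N)%N -> (k < N)%N ->
  S ^+ 2 * a j k ^+ 2 - (`|a j k| * E1 + 2 * (r * SH) * M 0 * (`|a j k| * (E j + E k)))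
   <= a j k * T j k.
  move=> jN kN.
  have t1 := T_close j k; rewrite -/E1 in t1; have t2 := J_close jN kN.
  have -> : a j k * T j k = S ^+ 2 * a j k ^+ 2 + (a j k * (T j k - kap j k * J j k) +
     a j k * kap j k * (J j k - S ^+ 2 * cos ((j%:R - k%:R) * th))).
    by rewrite /a /amp -/(kap j k); ring.
  rewrite lerD2l lerNl.
  apply: le_trans (ler_norm _) _; rewrite normrN; apply: le_trans (ler_normD _ _) _.
  apply: lerD; first by rewrite normrM ler_wpM2l.
  rewrite (normrM (a j k * kap j k)) (normrM (a j k)).
  apply: (@le_trans _ _ (`|a j k| * M 0 * (2 * (r * SH) * (E j + E k)))).
    apply: ler_pM => //.
    by rewrite ler_wpM2l //; apply: le_trans (KM _) _; exact: env0_ge.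
  by rewrite le_eqVlt; apply/orP; left; apply/eqP; ring.
apply: (@le_trans _ _ (\sum_(0 <= j < N) \sum_(0 <= k < N) (S ^+ 2 * a j k ^+ 2 -
   (`|a j k| * E1 + 2 * (r * SH) * M 0 * (`|a j k| * (E j + E k)))))); last first.
  rewrite big_nat [leRHS]big_nat; apply: ler_sum => j /andP[_ jN].
  rewrite big_nat [leRHS]big_nat; apply: ler_sum => k /andP[_ kN].
  exact: key.
have -> : \sum_(0 <= j < N) \sum_(0 <= k < N) (S ^+ 2 * a j k ^+ 2 -
   (`|a j k| * E1 + 2 * (r * SH) * M 0 * (`|a j k| * (E j + E k)))) =
   S ^+ 2 * (\sum_(0 <= j < N) \sum_(0 <= k < N) a j k ^+ 2) -
   ((\sum_(0 <= j < N) \sum_(0 <= k < N) `|a j k|) * E1 + 2 * (r * SH) * M 0 *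
    \sum_(0 <= j < N) \sum_(0 <= k < N) (`|a j k| * (E j + E k))).
  rewrite mulr_sumr mulr_suml mulr_sumr -big_split -sumrB; apply: eq_bigr => j _ /=.
  by rewrite mulr_sumr mulr_suml mulr_sumr -big_split -sumrB.
rewrite lerB // lerD //; first by rewrite ler_wpM2r // sum_amp_le.
pose I := (\int[mu]_(t in `[0%R, +oo[) H t)%R.
have row j : \sum_(0 <= k < N) `|a j k| <= env_mass M / b.
  apply: le_trans (row_mass_le N j eM b0 b1).
  by apply: ler_sum => k _; exact: amp_le.
have col k : \sum_(0 <= j < N) `|a j k| <= env_mass M / b.
  apply: le_trans (row_mass_le N k eM b0 b1).
  apply: ler_sum => j _; apply: le_trans (amp_le _ _ _ _ KM) _.
  by rewrite -(env_even eM) -mulNr opprB.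
have SMb : 0 <= env_mass M / b by rewrite divr_ge0 // ltW.
have s1 : \sum_(0 <= j < N) \sum_(0 <= k < N) (`|a j k| * (E j + E k)) <=
    2 * (env_mass M / b * (2 * I * r ^+ 2)).
  have h := edge_sum_le N dC r0; rewrite -/I in h.
  have -> : \sum_(0 <= j < N) \sum_(0 <= k < N) (`|a j k| * (E j + E k)) =
    \sum_(0 <= j < N) E j * (\sum_(0 <= k < N) `|a j k|) +
    \sum_(0 <= k < N) E k * (\sum_(0 <= j < N) `|a j k|).
    have -> : \sum_(0 <= k < N) E k * (\sum_(0 <= j < N) `|a j k|) =
        \sum_(0 <= j < N) \sum_(0 <= k < N) E k * `|a j k|.
      by rewrite exchange_nat; apply: eq_bigr => k _; rewrite mulr_sumr.
    rewrite -big_split; apply: eq_bigr => j _ /=; rewrite mulr_sumr -big_split.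
    by apply: eq_bigr => k _ /=; ring.
  have half (u : nat -> R) : (forall j, u j <= env_mass M / b) ->
     \sum_(0 <= j < N) E j * u j <= env_mass M / b * (2 * I * r ^+ 2).
    move=> ub; apply: (@le_trans _ _ (env_mass M / b * \sum_(0 <= j < N) E j)).
      by rewrite mulr_sumr; apply: ler_sum => j _; rewrite mulrC ler_wpM2r.
    by rewrite ler_wpM2l.
  by rewrite [leRHS]mulr_natl mulr2n; apply: lerD; apply: half.
rewrite -/I; apply: le_trans (ler_wpM2l _ s1) _.
  by rewrite !mulr_ge0 // ltW.
by rewrite le_eqVlt; apply/orP; left; apply/eqP; ring.
Qed.

End Bounds.
End Quad.

(** * Lower bound on the total weight of the window *)

Section Kernel.
Context {R : realType}.
Notation mu := (@lebesgue_measure R).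
Implicit Types (f g H C K M : R -> R).

Lemma env_small M (e : R) : tail_envelope M -> 0 < e ->
  exists2 A : R, 0 < A & forall x, A <= `|x| -> M x <= e.
Proof.
move=> eM e0; pose I := (\int[mu]_(t in `[0%R, +oo[) M t)%R.
pose n := (Num.truncn (I / e)).+1.
exists n%:R => // x nx; rewrite -(env_norm x eM).
apply: (@le_trans _ _ (M n%:R)); first exact: (env_mono eM).
have h := env_sum_le n eM ltr01; rewrite mul1r -/I in h.
have h2 : n%:R * M n%:R <= I.
  apply: le_trans h; rewrite mulr_natl -[X in _ *+ X](subn0 n) -sumr_const_nat.
  rewrite big_nat [leRHS]big_nat; apply: ler_sum => i /andP[_ lin].
  by apply: (env_mono eM); rewrite ?mulr1 // ler_nat.
have n0 : 0 < n%:R :> R by rewrite ltr0n.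
rewrite -(ler_pM2l n0); apply: le_trans h2 _.
by have := truncnS_gt (I / e); rewrite ltr_pdivrMr // -/n => /ltW.
Qed.

(** [K] is uniformly continuous, being continuous and small at infinity. As it
    is also bounded, an affine term accounts for the distant pairs; such a
    bound holds for all pairs and can be averaged against the covariances. *)
Lemma kernel_modulus K M (e : R) : continuous K -> tail_envelope M ->
  (forall x, `|K x| <= M x) -> 0 < e ->
  exists2 B : R, 0 <= B & forall x y, `|K x - K y| <= e + B * `|x - y|.
Proof.
move=> cK eM KM e0; have e2 : 0 < e / 2 by rewrite divr_gt0.
have [A A0 hA] := env_small eM e2.
pose P (n : nat) (x : R) := forall y, `|x - y| <= n.+1%:R^-1 -> `|K x - K y| <= e.
have cmp : compact (`[(- A), A]%classic : set R) by exact: segment_compact.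
have tri (u v w d m : R) : `|u - v| < d / 2 -> m <= d / 4 -> `|v - w| <= m -> 0 < d ->
    `|u - v| < d /\ `|u - w| < d.
  move=> uv md vw d0; split; first lra.
  have -> : u - w = (u - v) + (v - w) by ring.
  by apply: le_lt_trans (ler_normD _ _) _; lra.
have [n hn] : exists n, `[(- A), A]%classic `<=` P n.
  have cov : forall x, `[(- A), A]%classic x -> \forall x' \near x & n \near \oo, P n x'.
    move=> x _.
    have /cvgrPdist_le /(_ _ e2) /nbhs_ballP [d /= d0 h] := cK x.
    have hb (z : R) : `|x - z| < d -> `|K x - K z| <= e / 2 by move=> xz; apply: h.
    have d2 : 0 < d / 2 by rewrite divr_gt0.
    have hN : \forall n \near \oo, (n.+1%:R^-1 : R) <= d / 4.
      have d4 : 0 < d / 4 by rewrite divr_gt0.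
      have := cvgn_near (@cvg_harmonic R) d4; apply: filterS => n.
      by rewrite subr0; apply: le_trans; rewrite ler_norm.
    exists (ball x (d / 2), [set n : nat | (n.+1%:R^-1 : R) <= d / 4]).
      by split => //=; exact: nbhsx_ballx.
    move=> [x' n] [/= xx' nd] y xy.
    have [t1 t2] := tri _ _ _ _ _ xx' nd xy d0.
    have hx := hb _ t1; have hy := hb _ t2.
    have -> : K x' - K y = (K x - K y) - (K x - K x') by ring.
    by apply: le_trans (ler_normB _ _) _; lra.
  have [cn _] := compact_near_coveringP `[(- A), A]%classic.
  have [n _ hn] := cn cmp nat \oo P _ cov.
  by exists n; apply: hn => /=.
(* Inside [[-A, A]] compactness gives a uniform step; outside, both values are at
   most [e / 2]. *)
pose eta : R := n.+1%:R^-1.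
have uc x y : `|x - y| <= eta -> `|K x - K y| <= e.
  move=> xy; have [xA|xA] := leP `|x| A.
    by apply: hn => //; rewrite /= in_itv /= -ler_norml.
  have [yA|yA] := leP `|y| A.
    by rewrite distrC; apply: hn; rewrite 1?distrC //= in_itv /= -ler_norml.
  apply: le_trans (ler_normB _ _) _; rewrite [leRHS]splitr; apply: lerD.
    by apply: le_trans (KM x) _; apply: hA; exact: ltW.
  by apply: le_trans (KM y) _; apply: hA; exact: ltW.
have eta0 : 0 < eta by rewrite invr_gt0.
have M00 : 0 <= M 0 := env_ge0 eM 0.
exists (2 * M 0 / eta) => [|x y]; first by rewrite divr_ge0 ?(ltW eta0) // mulr_ge0.
have [xy|xy] := leP `|x - y| eta.
  by apply: le_trans (uc _ _ xy) _; rewrite lerDl mulr_ge0 // divr_ge0 ?(ltW eta0) // mulr_ge0.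
apply: (@le_trans _ _ (2 * M 0)).
  apply: le_trans (ler_normB _ _) _; rewrite mulr_natl mulr2n; apply: lerD;
    by apply: le_trans (KM _) _; exact: env0_ge.
rewrite -[leLHS]add0r; apply: lerD; first exact: ltW.
by rewrite -mulrA ler_peMr ?mulr_ge0 // mulrC ler_pdivlMr // mul1r ltW.
Qed.

(** The two cosines cannot both be small, as
    [cos (2 x) = 2 cos x ^+ 2 - 1]. *)
Lemma cos2_double (x : R) : 1 / 4 <= cos x ^+ 2 + cos (2 * x) ^+ 2.
Proof.
rewrite mulr_natl cos_mulr2n; set t := cos x ^+ 2.
rewrite -subr_ge0.
have -> : t + (t *+ 2 - 1) ^+ 2 - 1 / 4 = (2 * t - 3 / 4) ^+ 2 + 3 / 16 by field.
by rewrite addr_ge0 // sqr_ge0.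
Qed.

Lemma sum_cos2_lower (th : R) L :
  L%:R / 8 <= \sum_(0 <= u < (2 * L).+1) cos (u%:R * th) ^+ 2.
Proof.
have p u : 0 <= cos (u%:R * th) ^+ 2 :> R by rewrite sqr_ge0.
have h1 : \sum_(0 <= u < L) cos (u.+1%:R * th) ^+ 2 <=
          \sum_(0 <= u < (2 * L).+1) cos (u%:R * th) ^+ 2.
  have -> : \sum_(0 <= u < L) cos (u.+1%:R * th) ^+ 2 = \sum_(1 <= u < L.+1) cos (u%:R * th) ^+ 2.
    by rewrite big_add1.
  by apply: ler_subsum => //; lia.
have h2 : \sum_(0 <= u < L) cos (2 * (u.+1%:R * th)) ^+ 2 <=
          \sum_(0 <= u < (2 * L).+1) cos (u%:R * th) ^+ 2.
  have -> : \sum_(0 <= u < L) cos (2 * (u.+1%:R * th)) ^+ 2 =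
      \sum_(0 <= u < L) cos ((2 * u.+1)%N%:R * th) ^+ 2.
    by apply: eq_bigr => u _; rewrite natrM mulrA.
  elim: L {h1} => [|L IH]; first by rewrite big_geq // sumr_ge0.
  rewrite big_nat_recr //= (_ : (2 * L.+1)%N = (2 * L).+2); last lia.
  rewrite [leRHS]big_nat_recr //= [X in _ <= X + _]big_nat_recr //=.
  by rewrite lerD2r; apply: le_trans IH _; rewrite lerDl.
have h3 : L%:R / 4 <= \sum_(0 <= u < L) (cos (u.+1%:R * th) ^+ 2 + cos (2 * (u.+1%:R * th)) ^+ 2).
  rewrite mulr_natl -[X in _ *+ X](subn0 L) -sumr_const_nat; apply: ler_sum => u _.
  by apply: le_trans (cos2_double _); rewrite mul1r.
by rewrite big_split /= in h3; lra.
Qed.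

(** [K] is at least 1/2 near the origin, that is, for lags up to a multiple of
    [b^-1], and on such a range the squared cosines have a mean bounded below
    whatever the frequency [th], by [cos2_double]. *)
Lemma amp_sq_lower K : continuous K -> K 0 = 1 -> exists2 d : R, 0 < d &
  forall (b th : R) N, 0 < b -> b <= d -> 8 * d <= N%:R * b ->
  d / 256 * (N%:R / b) <= \sum_(0 <= j < N) \sum_(0 <= k < N) amp K b th j k ^+ 2.
Proof.
move=> cK K0.
have [d1 d10 hd] : exists2 d : R, 0 < d & forall x, `|x| <= d -> 1 / 2 <= K x.
  have h2 : 0 < 1 / 2 :> R by rewrite divr_gt0.
  have /cvgrPdist_le /(_ _ h2) /nbhs_ballP [d /= d0 h] := cK 0.
  exists (d / 2) => [|x xd]; first by rewrite divr_gt0.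
  have := h x; rewrite /ball /= sub0r normrN K0 => /(_ _).
  have xd' : `|x| < d by apply: le_lt_trans xd _; lra.
  by move=> /(_ xd') /(le_trans (ler_norm _)); lra.
exists (d1 / 4) => [|b th N b0 bd Nb]; first by rewrite divr_gt0.
(* Up to lag [2 L] the argument of the kernel stays within [d1]. *)
pose L := Num.truncn (d1 / (2 * b)).
have b2 : 0 < 2 * b by rewrite mulr_gt0.
have /andP[L1 L2] := truncn_itv (divr_ge0 (ltW d10) (ltW b2)); rewrite -/L in L1 L2.
rewrite ler_pdivlMr // in L1; rewrite ltr_pdivrMr // in L2.
have Lb : d1 <= 4 * b * L%:R by rewrite -natr1 in L2; lra.
have LN : (4 * L <= N)%N.
  rewrite -(ler_nat R) natrM -(ler_pM2r b0); lra.
have L2' : (2 <= L)%N.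
  rewrite -ltnS -(ltr_nat R); have : d1 < L.+1%:R * (2 * b) by [].
  have : 2 * (2 * b) <= d1 by lra.
  by move=> h1 /(le_lt_trans h1); rewrite ltr_pM2r.
have hsq j u : (u < (2 * L).+1)%N -> 1 / 4 * cos (u%:R * th) ^+ 2 <= amp K b th j (u + j) ^+ 2.
  move=> uL; rewrite /amp natrD opprD addrCA subrr addr0 mulNr cosN exprMn.
  apply: ler_wpM2r; first exact: sqr_ge0.
  have : 1 / 2 <= K (b * - u%:R).
    apply: hd; rewrite mulrN normrN normrM gtr0_norm // normr_nat.
    have : u%:R <= (2 * L)%N%:R :> R by rewrite ler_nat; lia.
    rewrite natrM => h; apply: le_trans (ler_wpM2l (ltW b0) h) _; lra.
  move: (K _) => y y2; rewrite expr2; have : 0 <= (y - 1 / 2) * (y + 1 / 2) by apply: mulr_ge0; lra.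
  by rewrite -subr_ge0 => h; have -> : y * y - 1 / 4 = (y - 1 / 2) * (y + 1 / 2) by field.
have p j k : 0 <= amp K b th j k ^+ 2 by rewrite sqr_ge0.
(* Half of the rows contain the whole range of lags, as [4 L <= N]. *)
have h1 : \sum_(0 <= j < N./2) 1 / 4 * (L%:R / 8) <=
   \sum_(0 <= j < N) \sum_(0 <= k < N) amp K b th j k ^+ 2.
  apply: (@le_trans _ _ (\sum_(0 <= j < N./2) \sum_(0 <= k < N) amp K b th j k ^+ 2)); last first.
    by apply: ler_subsum => //; [lia | move=> i; exact: sumr_ge0].
  rewrite big_nat [leRHS]big_nat; apply: ler_sum => j /andP[_ jN].
  apply: (@le_trans _ _ (\sum_(0 + j <= k < (2 * L).+1 + j) amp K b th j k ^+ 2)); last first.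
    by apply: ler_subsum => //; lia.
  rewrite big_addn addnK.
  apply: (@le_trans _ _ (\sum_(0 <= u < (2 * L).+1) 1 / 4 * cos (u%:R * th) ^+ 2)).
    by rewrite -mulr_sumr ler_wpM2l ?sum_cos2_lower // divr_ge0.
  by apply: ler_sum_nat => u /andP[_ uL]; exact: hsq.
apply: le_trans h1; rewrite sumr_const_nat subn0 -(mulr_natl _ N./2).
have N4 : N%:R / 4 <= N./2%:R :> R.
  have : (N <= 4 * N./2)%N by lia.
  by rewrite -(ler_nat R) natrM; lra.
have : N%:R / 4 * (1 / 4 * (d1 / (4 * b) / 8)) <= N./2%:R * (1 / 4 * (L%:R / 8)).
  have Lb' : d1 / (4 * b) <= L%:R by rewrite ler_pdivrMr ?mulr_gt0 //; lra.
  have q1 : 0 <= N%:R / 4 :> R by rewrite divr_ge0.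
  have q2 : 0 <= d1 / (4 * b) by apply: divr_ge0; [exact: ltW | apply: mulr_ge0 => //; exact: ltW].
  by apply: ler_pM => //; lra.
move=> h3; apply: le_trans h3; rewrite -subr_ge0.
have -> : N%:R / 4 * (1 / 4 * (d1 / (4 * b) / 8)) - d1 / 4 / 256 * (N%:R / b) =
   d1 * (N%:R / b) * (1 / 512 - 1 / 1024) by field; rewrite gt_eqF.
apply: mulr_ge0; last lra.
by apply: mulr_ge0; [exact: ltW | apply: divr_ge0; [exact: ler0n | exact: ltW]].
Qed.

End Kernel.

(** * Second moments of the process *)

Section Moments.
Context {d : measure_display} {T : measurableType d} {R : realType}.
Variables (Pr : probability T R) (X : R -> {RV Pr >-> R}) (C : R -> R).
Hypothesis hX : wide_sense_stationary X C.

Lemma fine_expectation (f : T -> R) : fine 'E_Pr[f] = (\int[Pr]_w f w)%R.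
Proof. by rewrite unlock. Qed.

Lemma integrable_dominated (f g : T -> R) : measurable_fun setT f ->
  Pr.-integrable setT (EFin \o g) -> (forall w, `|f w| <= g w) ->
  Pr.-integrable setT (EFin \o f).
Proof.
move=> mf ig fg; apply: le_integrable ig => //; first exact/measurable_EFinP.
by move=> w _ /=; rewrite lee_fin (le_trans (fg w)) // ler_norm.
Qed.

Lemma measurable_X t : measurable_fun setT (X t : T -> R).
Proof. exact: measurable_funPT. Qed.

Lemma integrable_ge0_lty (f : T -> R) : measurable_fun setT f -> (forall w, 0 <= f w) ->
  ('E_Pr[f] < +oo)%E -> Pr.-integrable setT (EFin \o f).
Proof.
move=> mf f0; rewrite unlock => h.
have mE : measurable_fun setT (EFin \o f) by exact/measurable_EFinP.
apply/integrableP; split => //; apply: le_lt_trans h.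
under eq_integral => w _ do rewrite gee0_abs ?lee_fin //.
by [].
Qed.

Lemma integrable_sqr t : Pr.-integrable setT (EFin \o (fun w => X t w ^+ 2)).
Proof.
apply: integrable_ge0_lty; last exact: (wss_L2 hX).
  exact: measurable_funX (measurable_X t).
by move=> w; exact: sqr_ge0.
Qed.

Lemma integrable_XX s t : Pr.-integrable setT (EFin \o (fun w => X s w * X t w)).
Proof.
apply: (@integrable_dominated _ (fun w => X s w ^+ 2 + X t w ^+ 2)).
- by apply: measurable_funM; exact: measurable_X.
- exact: (@integrableD _ _ _ Pr setT measurableT _ _ (integrable_sqr s) (integrable_sqr t)).
move=> w; rewrite normrM -(real_normK (num_real (X s w))) -(real_normK (num_real (X t w))).
move: (normr_ge0 (X s w)) (normr_ge0 (X t w)).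
move: (`|X s w|) (`|X t w|) => x y x0 y0.
by have := sqr_ge0 (x - y); have := sqr_ge0 x; have := sqr_ge0 y; rewrite sqrrB; lra.
Qed.

Lemma cov_shift s t : (\int[Pr]_w (X s w * X t w))%R = C (t - s).
Proof.
have := wss_cov hX s (t - s); rewrite (addrC s) subrK unlock => h.
by rewrite /Rintegral h.
Qed.

Lemma cov_even t : C (- t) = C t.
Proof.
have h1 := cov_shift 0 t; have h2 := cov_shift t 0.
rewrite subr0 in h1; rewrite sub0r in h2; rewrite -h1 -h2.
by apply: eq_Rintegral => w _; rewrite mulrC.
Qed.

Lemma cov_abs_le t : `|C t| <= C 0.
Proof.
rewrite -{1}(subr0 t) -cov_shift.
apply: le_trans (le_normr_Rintegral measurableT (integrable_XX _ _)) _.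
have e2 s : (\int[Pr]_w (X s w ^+ 2))%R = C 0.
  by rewrite -(subrr s) -cov_shift; apply: eq_Rintegral => w _; rewrite expr2.
have i2 := integrable_sqr.
have ih s : Pr.-integrable setT (EFin \o (fun w => X s w ^+ 2 * (1 / 2))).
  apply: (@integrable_dominated _ (fun w => X s w ^+ 2)) => //.
    by apply: measurable_funM => //; exact: measurable_funX (measurable_X s).
  move=> w; move: (X s w) => x; have x0 := sqr_ge0 x.
  by rewrite ger0_norm; lra.
have -> : C 0 = (\int[Pr]_w (X 0 w ^+ 2 * (1 / 2) + X t w ^+ 2 * (1 / 2)))%R.
  by rewrite RintegralD // !RintegralZr // !e2; field.
apply: le_Rintegral => //.
- exact: (@integrable_norm _ _ _ Pr setT _ (integrable_XX 0 t)).
- exact: (@integrableD _ _ _ Pr setT measurableT _ _ (ih 0) (ih t)).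
move=> w _; rewrite normrM -(real_normK (num_real (X 0 w))) -(real_normK (num_real (X t w))).
move: (`|X 0 w|) (`|X t w|) => x y.
by have := sqr_ge0 (x - y); rewrite sqrrB; lra.
Qed.

(** Cauchy-Schwarz in its weighted arithmetic-geometric form bounds the
    increment of the covariance by the mean square increment of the
    process. *)
Lemma cov_continuous : mean_square_continuous X -> continuous C.
Proof.
move=> hc t; apply/cvgrPdist_le => e e0.
have C00 : 0 <= C 0 by apply: le_trans (cov_abs_le 0); exact: normr_ge0.
(* The weight that gives each of the two squares a share of at most [e / 2]. *)
pose eta := e / (C 0 + 1); have C1 : 0 < C 0 + 1 by lra.
have eta0 : 0 < eta by rewrite divr_gt0.
have := hc t; move=> /fine_cvgP [_ /cvgrPdist_le /(_ (e * eta))].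
rewrite mulr_gt0 // => /(_ isT); apply: filterS => s /=.
rewrite sub0r normrN fine_expectation => hs.
have i2 u v : Pr.-integrable setT (EFin \o (fun w => (X u w - X v w) ^+ 2)).
  apply: (@integrable_dominated _ (fun w => 2 * (X u w ^+ 2 + X v w ^+ 2))).
  - by apply: measurable_funX; apply: measurable_funB; exact: measurable_X.
  - have iD := @integrableD _ _ _ Pr setT measurableT _ _ (integrable_sqr u) (integrable_sqr v).
    exact: (@integrableZl _ _ _ Pr setT measurableT 2 _ iD).
  move=> w; rewrite ger0_norm ?sqr_ge0 //.
  by have := sqr_ge0 (X u w + X v w); rewrite sqrrD sqrrB; lra.
have iZ k f : Pr.-integrable setT (EFin \o f) -> Pr.-integrable setT (EFin \o (fun w => k * f w)).
  by move=> jf; exact: (@integrableZl _ _ _ Pr setT measurableT k _ jf).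
have -> : C t - C s = (\int[Pr]_w (X 0 w * X t w - X 0 w * X s w))%R.
  by rewrite RintegralB ?cov_shift ?subr0 //; exact: integrable_XX.
have iB : Pr.-integrable setT (EFin \o (fun w => X 0 w * X t w - X 0 w * X s w)).
  exact: (@integrableB _ _ _ Pr setT measurableT _ _ (integrable_XX 0 t) (integrable_XX 0 s)).
apply: le_trans (le_normr_Rintegral _ _) _ => //.
apply: (@le_trans _ _ (\int[Pr]_w (eta / 2 * X 0 w ^+ 2 + (2 * eta)^-1 * (X s w - X t w) ^+ 2))%R).
  apply: le_Rintegral => //.
  - exact: (@integrable_norm _ _ _ Pr setT _ iB).
  - exact: (@integrableD _ _ _ Pr setT measurableT _ _ (iZ _ _ (integrable_sqr 0)) (iZ _ _ (i2 s t))).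
  move=> w _; rewrite -mulrBr normrM distrC.
  rewrite -(real_normK (num_real (X 0 w))) -[leRHS]/(_ + _ * _).
  rewrite -(real_normK (num_real (X s w - X t w))).
  move: (`|X 0 w|) (`|X s w - X t w|) => x y.
  rewrite -subr_ge0 (_ : _ - _ = (2 * eta)^-1 * (eta * x - y) ^+ 2); last first.
    by field; rewrite gt_eqF.
  by rewrite mulr_ge0 ?sqr_ge0 // invr_ge0 mulr_ge0 // ltW.
rewrite RintegralD //; [|exact: iZ (integrable_sqr 0)|exact: iZ (i2 s t)].
rewrite !RintegralZl //; [|exact: integrable_sqr].
have -> : (\int[Pr]_w (X 0 w ^+ 2))%R = C 0.
  by have := cov_shift 0 0; rewrite subrr => <-; apply: eq_Rintegral => w _; rewrite expr2.
have h1 : (2 * eta)^-1 * (\int[Pr]_w ((X s w - X t w) ^+ 2))%R <= e / 2.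
  have eta2 : 0 < 2 * eta by lra.
  rewrite mulrC ler_pdivrMr //; apply: (le_trans (ler_norm _)); apply: (le_trans hs).
  by rewrite le_eqVlt; apply/orP; left; apply/eqP; field.
have h2 : eta / 2 * C 0 <= e / 2.
  have : eta * (C 0 + 1) = e by rewrite /eta divfK // gt_eqF.
  by rewrite mulrDr mulr1 => <-; lra.
by rewrite [leRHS]splitr; apply: lerD.
Qed.

End Moments.

Section Decaying.
Context {R : realType}.
Notation mu := (@lebesgue_measure R).

(** Outside [[-1, 1]] the weight [`|t| `^ q] dominates the other two and
    [decay_envelope] is an envelope; inside, the maximum [C 0] of the
    covariance is added. The supremum is finite: it is nonincreasing, so an
    infinite value at 1 would make its integral over [[0, 1]] infinite. *)
Lemma decaying_envelope (C : R -> R) (q : R) : 1 < q -> continuous C ->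
  (forall t, C (- t) = C t) -> (forall t, `|C t| <= C 0) ->
  mu.-integrable setT (decay_envelope C q) ->
  exists H, decaying C H q.
Proof.
move=> q1 cC Cev C0 ih; have q0 : 0 < q by lra.
have C00 : 0 <= C 0 by apply: le_trans (C0 0); exact: normr_ge0.
have one (x : R) : (1 : R) `^ x = 1 by rewrite powR1.
have ub (s t : R) : `|t| <= s -> ((`|s| `^ q * `|C s|)%:E <= decay_envelope C q t)%E.
  by move=> ts; apply: ereal_sup_ubound; exists s.
have h0 t : (0 <= decay_envelope C q t)%E.
  apply: le_trans (ub `|t| t (lexx _)); rewrite lee_fin mulr_ge0 // powR_ge0.
have mono (s t : R) : `|s| <= `|t| -> (decay_envelope C q t <= decay_envelope C q s)%E.
  move=> st; apply: ub_ereal_sup => _ [u /= tu <-]; apply: ub; exact: le_trans st tu.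
have fin1 : (decay_envelope C q 1 < +oo)%E.
  rewrite ltey; apply/negP => /eqP h1.
  have /integrableP[mh] := ih; apply/negP; rewrite -leNgt.
  apply: (@le_trans _ _ (\int[mu]_(x in `[0%R, 1%R]) +oo)%E).
    rewrite integral_cst //= ?lebesgue_measure_itv /= ?lte_fin ltr01 -EFinB subr0.
    by rewrite mule1.
  apply: (@le_trans _ _ (\int[mu]_(x in `[0%R, 1%R]) `|decay_envelope C q x|)%E).
    apply: ge0_le_integral => //=.
    - by apply: measurableT_comp => //; exact: measurable_funS mh.
    move=> x; rewrite in_itv /= => /andP[x0 x1]; rewrite gee0_abs //.
    by rewrite -h1; apply: mono; rewrite normr1 ger0_norm.
  by apply: ge0_subset_integral => //=; exact: measurableT_comp.
pose h1 := fine (decay_envelope C q 1).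
have fin t : decay_envelope C q t \is a fin_num.
  rewrite ge0_fin_numE //; apply: le_lt_trans (ltry (C 0 + h1)).
  apply: ub_ereal_sup => _ [u /= tu <-]; have u0 : 0 <= u := le_trans (normr_ge0 _) tu.
  rewrite lee_fin; have [u1|u1] := leP u 1.
    apply: (@le_trans _ _ (1 * C 0)).
      apply: ler_pM; rewrite ?powR_ge0 //.
      by rewrite -[leRHS](one q); apply: ge0_ler_powR; rewrite ?nnegrE ?(ltW q0) // ger0_norm.
    by rewrite mul1r lerDl fine_ge0.
  apply: (@le_trans _ _ h1); last by rewrite lerDr.
  rewrite -lee_fin /h1 fineK ?ge0_fin_numE //; apply: ub; rewrite normr1; exact: ltW.
pose H t := C 0 * \1_(`[(- 1), 1]%classic : set R) t + fine (decay_envelope C q t).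
have in1 (t : R) : (\1_(`[(- 1), 1]%classic : set R) t : R) = if `|t| <= 1 then 1 else 0.
  rewrite indicE; case: ifPn => t1; first by rewrite mem_set //= in_itv /= -ler_norml.
  by rewrite memNset //= in_itv /= -ler_norml; exact/negP.
have f0 t : 0 <= fine (decay_envelope C q t) by rewrite fine_ge0.
have big t (a : R) : 0 <= a <= q -> `|t| `^ a * `|C t| <= H t.
  move=> /andP[a0 aq]; rewrite /H in1; case: ifPn => [t1|]; last rewrite -ltNge => t1.
    apply: (@le_trans _ _ (C 0)); last by rewrite mulr1 lerDl.
    rewrite -[leRHS]mul1r; apply: ler_pM; rewrite ?powR_ge0 //.
    by rewrite -[leRHS](one a); apply: ge0_ler_powR; rewrite ?nnegrE.
  rewrite mulr0 add0r; apply: (@le_trans _ _ (`|t| `^ q * `|C t|)).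
    by rewrite ler_wpM2r // ler_powR // ltW.
  rewrite -lee_fin fineK //.
  have := ub `|t| t (lexx _); rewrite normr_id.
  by case: (ger0P t) => // _; rewrite Cev.
have Hev x : decay_envelope C q (- x) = decay_envelope C q x by rewrite /decay_envelope normrN.
exists H; split => //.
- split.
  + by move=> x; rewrite addr_ge0 // mulr_ge0 // indicE.
  + by move=> x; rewrite /H !in1 normrN Hev.
  + move=> x y x0 xy; have y0 := le_trans x0 xy; rewrite /H; apply: lerD.
      rewrite ler_wpM2l // !in1 !ger0_norm //; case: ifPn => y1; last by case: ifP.
      by rewrite (le_trans xy y1).
    by apply: fine_le => //; apply: mono; rewrite !ger0_norm.
  + have i1 : mu.-integrable setT (EFin \o (fun t => C 0 * \1_(`[(- 1), 1]%classic : set R) t)).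
      exact: (@integrableZl _ _ _ mu setT measurableT (C 0) _ (integrable_indic_itv _ _ _ _)).
    have i2 : mu.-integrable setT (EFin \o (fun t => fine (decay_envelope C q t))).
      by apply: eq_integrable ih => // x _ /=; rewrite fineK.
    exact: (@integrableD _ _ _ mu setT measurableT _ _ i1 i2).
- move=> t; have := big t 0; rewrite lexx (ltW q0) powRr0 mul1r; exact.
- move=> t; have := big t 1; rewrite ler01 (ltW q1) powRr1 //; exact.
- move=> t; apply: big; rewrite lexx andbT; exact: ltW.
Qed.

End Decaying.

(** * The estimator as a quadratic form in the sample *)

Section Estimator.
Local Open Scope complex_scope.
Context {d : measure_display} {T : measurableType d} {R : realType}.
Variables (Pr : probability T R) (X : R -> {RV Pr >-> R}).

Lemma fsum_absz (G : nat -> R) n :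
  \sum_(v \in [set v : int | (`|v| < n.+1)%N]) G `|v|%N = G 0%N + 2 * \sum_(1 <= v < n.+1) G v.
Proof.
elim: n => [|n IH].
  rewrite big_geq // mulr0 addr0.
  rewrite (_ : [set v : int | (`|v| < 1)%N] = [set 0]) ?fsbig_set1 //.
  by apply/seteqP; split => v /=; rewrite ltnS leqn0 absz_eq0 => /eqP.
have -> : [set v : int | (`|v| < n.+2)%N] =
   [set v : int | (`|v| < n.+1)%N] `|` ([set (n.+1 : int)] `|` [set (- (n.+1 : int))]).
  apply/seteqP; split => v /=.
    rewrite ltnS leq_eqVlt => /orP[/eqP vn|]; last by left.
    by right; case: (intP v) vn => [|m|m] /= vn; [|left|right]; lia.
  by move=> [|[->|->]]; lia.
rewrite fsbigU0; last 3 first.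
- exact: finite_set_absz_lt.
- by rewrite finite_setU; split; exact: finite_set1.
- by move=> v /= [v1 [v2|v2]]; lia.
rewrite IH fsbigU0; last 3 first.
- exact: finite_set1.
- exact: finite_set1.
- by move=> v /= [v1 v2]; lia.
rewrite !fsbig_set1 abszN /= [in RHS]big_nat_recr //=.
by ring.
Qed.

Lemma Re_fsum (F : int -> R[i]) n :
  complex.Re (\sum_(v \in [set v : int | (`|v| < n)%N]) F v) =
  \sum_(v \in [set v : int | (`|v| < n)%N]) complex.Re (F v).
Proof.
rewrite !fsbig_finite; [|exact: finite_set_absz_lt..].
have ReD : {morph (@complex.Re R) : z1 z2 / z1 + z2} by case=> a b [c e].
exact: (big_morph _ ReD).
Qed.

Lemma estimator_quadE (K : R -> R) (b rho lam : R) n (w : T) :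
  (forall x, K (- x) = K x) -> 0 < rho -> `|lam| <= pi * rho ->
  estimator X K b rho n.+1 lam w = (2 * pi * rho)^-1 * n.+1%:R^-1 *
    \sum_(0 <= j < n.+1) \sum_(0 <= k < n.+1) amp K b (lam / rho) j k *
       (X (j.+1%:R / rho) w * X (k.+1%:R / rho) w).
Proof.
move=> Kev r0 lr; rewrite /estimator /estimatorC.
have -> : \1_(`[- (pi * rho), pi * rho]%classic) lam = 1 :> R.
  by rewrite indicE mem_set //= in_itv /= -ler_norml.
have Remul (a : R) (z : R[i]) : complex.Re (a%:C * z * 1%:C) = a * complex.Re z.
  by case: z => x y /=; ring.
rewrite Remul Re_fsum -[RHS]mulrA; congr (_ * _).
pose x j := X (j.+1%:R / rho) w.
pose G v := n.+1%:R^-1 * (\sum_(0 <= j < n.+1 - v) x j * x (j + v)%N) *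
   (K (b * v%:R) * cos (v%:R * (lam / rho))).
transitivity (\sum_(v \in [set v : int | (`|v| < n.+1)%N]) G `|v|%N).
  apply: eq_fsbigr => v _; rewrite /= mul0r subr0 cosN.
  have kc : K (b * v%:~R) = K (b * (`|v|%N)%:R) /\
     cos (v%:~R * lam / rho) = cos ((`|v|%N)%:R * (lam / rho)).
    rewrite -[(v%:~R * lam) / rho]mulrA; case: (intP v) => [|m|m] /=; first by [].
      by [].
    by rewrite mulrNz mulrN Kev mulNr cosN.
  case: kc => -> ->; rewrite /G /sample_cov big_add1 /= -!mulrA; congr (_ * _).
rewrite fsum_absz sum_toeplitz; last first.
  move=> j k; rewrite /amp -(opprB (j%:R : R)) mulrN Kev mulNr cosN; ring.
rewrite mulrDr; congr (_ + _).
  rewrite /G subn0 mulr0 mul0r cos0 mulr1 -mulrA; congr (_ * _); rewrite mulr_suml.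
  by apply: eq_bigr => j _; rewrite addn0 /amp subrr mulr0 mul0r cos0 mulr1 mulrC.
rewrite !mulr_sumr; apply: eq_bigr => v _; rewrite mulrnAr -[RHS]mulr_natl.
congr (_ * _); rewrite /G -mulrA; congr (_ * _).
rewrite mulr_suml; apply: eq_bigr => j _; rewrite /amp natrD opprD addrA subrr sub0r.
by rewrite mulrN Kev mulNr cosN mulrC.
Qed.

End Estimator.

Section LinearIntegral.
Context {d : measure_display} {T : measurableType d} {R : realType}.
Variable nu : {measure set T -> \bar R}.

Lemma integrable_sumR (I : Type) (s : seq I) (h : I -> T -> R) :
  (forall i, nu.-integrable setT (EFin \o h i)) ->
  nu.-integrable setT (EFin \o (fun x => \sum_(i <- s) h i x)).
Proof.
move=> hi.
have := @integrable_sum _ _ _ nu setT measurableT _ s xpredT (fun i => EFin \o h i) (fun i _ => hi i).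
by apply: eq_integrable => // x _; rewrite /= sumEFin.
Qed.

Lemma integrable_ZlR (k : R) (h : T -> R) : nu.-integrable setT (EFin \o h) ->
  nu.-integrable setT (EFin \o (fun x => k * h x)).
Proof. by move=> ih; exact: (@integrableZl _ _ _ nu setT measurableT k _ ih). Qed.

Lemma Rintegral_sum2 N (a : nat -> nat -> R) (h : nat -> nat -> T -> R) :
  (forall j k, nu.-integrable setT (EFin \o h j k)) ->
  (\int[nu]_x (\sum_(0 <= j < N) \sum_(0 <= k < N) a j k * h j k x))%R =
  \sum_(0 <= j < N) \sum_(0 <= k < N) a j k * (\int[nu]_x h j k x)%R.
Proof.
move=> hi; rewrite Rintegral_sum //; last first.
  by move=> j; apply: integrable_sumR => k; exact: integrable_ZlR.
apply: eq_bigr => j _; rewrite Rintegral_sum //; last by move=> k; exact: integrable_ZlR.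
by apply: eq_bigr => k _; rewrite RintegralZl.
Qed.

Lemma integrable_sum2 N (a : nat -> nat -> R) (h : nat -> nat -> T -> R) :
  (forall j k, nu.-integrable setT (EFin \o h j k)) ->
  nu.-integrable setT (EFin \o (fun x => \sum_(0 <= j < N) \sum_(0 <= k < N) a j k * h j k x)).
Proof.
by move=> hi; do 2 (apply: integrable_sumR => ?); exact: integrable_ZlR.
Qed.

End LinearIntegral.

(** * Decomposition of the mean squared error *)

Section MeanSquare.
Context {d : measure_display} {T : measurableType d} {R : realType}.
Variables (Pr : probability T R).

Lemma quadratic_form_mse (x : nat -> T -> R) (a : nat -> nat -> R) (kap phi : R) N :
  (forall j k, Pr.-integrable setT (EFin \o (fun w => x j w * x k w))) ->
  (forall j k l m, Pr.-integrable setT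
     (EFin \o (fun w => x j w * x k w * (x l w * x m w)))) ->
  (\int[Pr]_w ((kap * (\sum_(0 <= j < N) \sum_(0 <= k < N) a j k * (x j w * x k w)) - phi) ^+ 2))%R =
  kap ^+ 2 * (\sum_(0 <= j < N) \sum_(0 <= k < N) a j k *
     \sum_(0 <= l < N) \sum_(0 <= m < N) a l m *
        (\int[Pr]_w (x j w * x k w * (x l w * x m w)))%R)
  - 2 * phi * kap * (\sum_(0 <= j < N) \sum_(0 <= k < N) a j k *
       (\int[Pr]_w (x j w * x k w))%R) + phi ^+ 2.
Proof.
move=> i2 i4.
pose S w := \sum_(0 <= j < N) \sum_(0 <= k < N) a j k * (x j w * x k w).
pose h j k w := \sum_(0 <= l < N) \sum_(0 <= m < N) a l m * (x j w * x k w * (x l w * x m w)).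
have ih j k : Pr.-integrable setT (EFin \o h j k) by apply: integrable_sum2 => l m; exact: i4.
have iS : Pr.-integrable setT (EFin \o S) by apply: integrable_sum2 => j k; exact: i2.
pose S4 w := \sum_(0 <= j < N) \sum_(0 <= k < N) a j k * h j k w.
have iS4 : Pr.-integrable setT (EFin \o S4) by exact: integrable_sum2.
have S4E w : S4 w = S w ^+ 2.
  rewrite expr2 {1}/S mulr_suml; apply: eq_bigr => j _; rewrite mulr_suml; apply: eq_bigr => k _.
  rewrite -mulrA; congr (_ * _); rewrite mulr_sumr; apply: eq_bigr => l _.
  by rewrite mulr_sumr; apply: eq_bigr => m _; ring.
transitivity (\int[Pr]_w (kap ^+ 2 * S4 w + (- (2 * phi * kap) * S w + phi ^+ 2)))%R.
  by apply: eq_Rintegral => w _; rewrite S4E -/(S w); ring.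
have ic : Pr.-integrable setT (EFin \o (fun=> phi ^+ 2)).
  exact: finite_measure_integrable_cst.
rewrite RintegralD //; last 2 first.
- exact: integrable_ZlR.
- exact: (@integrableD _ _ _ Pr setT measurableT _ _ (integrable_ZlR (- (2 * phi * kap)) iS) ic).
rewrite RintegralD //; last exact: integrable_ZlR.
have Ec : (\int[Pr]_(w in setT) (phi ^+ 2))%R = phi ^+ 2.
  by rewrite Rintegral_cst // [X in fine X]probability_setT mulr1.
rewrite Ec !RintegralZl //.
rewrite /S4 Rintegral_sum2 // /S Rintegral_sum2 // addrA mulNr; congr (_ * _ - _ + _).
apply: eq_bigr => j _; apply: eq_bigr => k _; congr (_ * _).
by rewrite /h Rintegral_sum2.
Qed.

Variables (X : R -> {RV Pr >-> R}) (C : R -> R).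
Hypothesis hX : wide_sense_stationary X C.
Hypothesis h5 : fourth_order_condition X C.

Lemma integrable_X4 t : Pr.-integrable setT (EFin \o (fun w => `|X t w| ^+ 4)).
Proof.
apply: integrable_ge0_lty; last exact: (foc_moment h5).
  by apply: measurable_funX; apply: measurableT_comp => //; exact: measurable_X.
by move=> w; exact: exprn_ge0.
Qed.

Lemma integrable_XXXX s t u v : Pr.-integrable setT
  (EFin \o (fun w => X s w * X t w * (X u w * X v w))).
Proof.
have iD (f g : T -> R) : Pr.-integrable setT (EFin \o f) -> Pr.-integrable setT (EFin \o g) ->
    Pr.-integrable setT (EFin \o (fun w => f w + g w)).
  by move=> jf jg; exact: (@integrableD _ _ _ Pr setT measurableT _ _ jf jg).
apply: (@integrable_dominated _ _ _ Pr _ (fun w => `|X s w| ^+ 4 + `|X t w| ^+ 4 + (`|X u w| ^+ 4 + `|X v w| ^+ 4))).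
- by apply: measurable_funM; apply: measurable_funM; exact: measurable_X.
- by apply: (iD _ _); apply: (iD _ _); exact: integrable_X4.
move=> w; rewrite !normrM.
have am (x y : R) : x * y <= (x ^+ 2 + y ^+ 2) / 2.
  by have := sqr_ge0 (x - y); rewrite sqrrB; lra.
move: (`|X s w|) (`|X t w|) (`|X u w|) (`|X v w|) => x1 x2 x3 x4.
have e4 (x : R) : (x ^+ 2) ^+ 2 = x ^+ 4 by rewrite -exprM.
have := am (x1 * x2) (x3 * x4); have := am (x1 ^+ 2) (x2 ^+ 2); have := am (x3 ^+ 2) (x4 ^+ 2).
rewrite (exprMn _ x1 x2) (exprMn _ x3 x4) !e4.
have p x : 0 <= x ^+ 4 :> R by rewrite -e4 sqr_ge0.
by have := p x1; have := p x2; have := p x3; have := p x4; lra.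
Qed.

(** The definition of the fourth order cumulant, moved to the base point [s]
    by stationarity. *)
Lemma moment4E s t u v : (\int[Pr]_w (X s w * X t w * (X u w * X v w)))%R =
  cumulant4 X C (t - s) (u - s) (v - s) + (C (t - s) * C (v - u) + C (u - s) * C (v - t) +
   C (v - s) * C (u - t)).
Proof.
rewrite /cumulant4 (foc_stationary h5 0 s) /gaussian_moment4 /moment4 fine_expectation.
rewrite !(addrC s) !subrK.
have -> : v - s - (u - s) = v - u by ring.
have -> : v - s - (t - s) = v - t by ring.
have -> : t - s - (u - s) = - (u - t) by ring.
rewrite (cov_even hX) subrK.
by apply: eq_Rintegral => w _; rewrite !mulrA.
Qed.

Lemma sum2_split N (F G : nat -> nat -> R) :
  \sum_(0 <= l < N) \sum_(0 <= m < N) (F l m + G l m) =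
  \sum_(0 <= l < N) \sum_(0 <= m < N) F l m + \sum_(0 <= l < N) \sum_(0 <= m < N) G l m.
Proof. by rewrite -big_split; apply: eq_bigr => l _; rewrite big_split. Qed.

(** The contribution to the variance of the departure from a Gaussian
    process. *)
Definition cumulant_sum (r : R) (N : nat) (a : nat -> nat -> R) : R :=
  \sum_(0 <= j < N) \sum_(0 <= k < N) a j k * \sum_(0 <= l < N) \sum_(0 <= m < N) a l m *
    cumulant4 X C ((k%:R - j%:R) / r) ((l%:R - j%:R) / r) ((m%:R - j%:R) / r).

Lemma expected_density_quad (K : R -> R) (b r lam : R) n :
  (forall x, K (- x) = K x) -> K 0 = 1 -> 0 < r ->
  (2 * pi * r)^-1 * n.+1%:R^-1 * (\sum_(0 <= j < n.+1) \sum_(0 <= k < n.+1)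
     amp K b (lam / r) j k * lagcov C r j k) = expected_density C K b r lam n.+1.
Proof.
move=> Kev K0 r0; rewrite sum_toeplitz; last first.
  move=> j k; rewrite /amp /lagcov -(opprB (j%:R : R)) mulrN Kev !mulNr cosN.
  by rewrite (cov_even hX).
rewrite /expected_density -mulrA; congr (_ * _).
have n0 : n.+1%:R != 0 :> R by [].
rewrite mulrDr; congr (_ + _).
  under eq_bigr do rewrite /amp /lagcov subrr mulr0 mul0r K0 cos0 !mul1r mul0r.
  by rewrite sumr_const_nat subn0 -(mulr_natl (C 0)) mulKf.
rewrite !mulr_sumr; apply: eq_big_nat => v /andP[v1 vn].
rewrite [LHS]mulrnAr -[LHS]mulr_natl; congr (_ * _).
rewrite (eq_bigr (fun=> K (b * v%:R) * C (v%:R / r) * cos (v%:R * lam / r))); last first.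
  move=> j _; rewrite /amp /lagcov natrD opprD addrA subrr sub0r mulrN Kev !mulNr cosN.
  rewrite (cov_even hX) (mulrA v%:R lam); ring.
rewrite sumr_const_nat subn0 -(mulr_natl _ (n.+1 - v)) natrB; last exact: ltnW.
have -> : 1 - v%:R / n.+1%:R = n.+1%:R^-1 * (n.+1%:R - v%:R) :> R.
  by rewrite mulrBr mulVf // mulrC.
by ring.
Qed.

(** Of the three pairings of the fourth moment, the one of [(j, k)] with
    [(l, m)] is the square of the mean, and the other two are exchanged by the
    symmetry of the kernel. The target [phi] is arbitrary: with the mean
    itself as target the identity shows that the first term is a variance,
    hence nonnegative. *)
Theorem mse_decomposition (K : R -> R) (b r lam phi : R) n :
  (forall x, K (- x) = K x) -> K 0 = 1 -> 0 < r -> `|lam| <= pi * r ->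
  let a := amp K b (lam / r) in
  fine 'E_Pr[fun w => (estimator X K b r n.+1 lam w - phi) ^+ 2] =
   ((2 * pi * r)^-1 * n.+1%:R^-1) ^+ 2 *
     (2 * quad4 n.+1 a (lagcov C r) + cumulant_sum r n.+1 a) +
   (expected_density C K b r lam n.+1 - phi) ^+ 2.
Proof.
move=> Kev K0 r0 lr a; rewrite fine_expectation.
set kap := _^-1 * _^-1.
under eq_Rintegral do rewrite (@estimator_quadE _ _ _ Pr X K b r lam n _ Kev r0 lr) -/kap.
rewrite (@quadratic_form_mse (fun j => X (j.+1%:R / r))); last 2 first.
- by move=> j k; exact: (integrable_XX hX).
- by move=> *; exact: integrable_XXXX.
rewrite -(@expected_density_quad K b r lam n Kev K0 r0) -/kap -/a.
set N := n.+1.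
have lagE j k : (k.+1%:R / r - j.+1%:R / r) = (k%:R - j%:R) / r.
  by rewrite -mulrBl -!natr1; congr (_ / _); ring.
have covE j k : C ((k%:R - j%:R) / r) = lagcov C r j k.
  by rewrite /lagcov -(opprB (j%:R : R)) mulNr (cov_even hX).
have -> : \sum_(0 <= j < N) \sum_(0 <= k < N) a j k *
   (\int[Pr]_w (X (j.+1%:R / r) w * X (k.+1%:R / r) w))%R =
   \sum_(0 <= j < N) \sum_(0 <= k < N) a j k * lagcov C r j k.
  by apply: eq_bigr => j _; apply: eq_bigr => k _; rewrite (cov_shift hX) lagE covE.
set S2 := \sum_(0 <= j < N) \sum_(0 <= k < N) a j k * lagcov C r j k.
have asym j k : a j k = a k j.
  by rewrite /a /amp -(opprB (j%:R : R)) mulrN Kev mulNr cosN.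
have -> : \sum_(0 <= j < N) \sum_(0 <= k < N) a j k *
     (\sum_(0 <= l < N) \sum_(0 <= m < N) a l m *
        (\int[Pr]_w (X (j.+1%:R / r) w * X (k.+1%:R / r) w *
            (X (l.+1%:R / r) w * X (m.+1%:R / r) w)))%R) =
   cumulant_sum r N a + S2 ^+ 2 + 2 * quad4 N a (lagcov C r).
  have -> : cumulant_sum r N a + S2 ^+ 2 + 2 * quad4 N a (lagcov C r) =
     \sum_(0 <= j < N) \sum_(0 <= k < N) a j k *
       ((\sum_(0 <= l < N) \sum_(0 <= m < N) a l m *
        cumulant4 X C ((k%:R - j%:R) / r) ((l%:R - j%:R) / r) ((m%:R - j%:R) / r)) +
        lagcov C r j k * S2 +
        2 * \sum_(0 <= l < N) \sum_(0 <= m < N) a l m * (lagcov C r j l * lagcov C r k m)).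
    rewrite /cumulant_sum expr2 {1}/S2 /quad4 mulr_suml mulr_sumr -!big_split.
    apply: eq_bigr => j _ /=; rewrite mulr_suml mulr_sumr -!big_split.
    by apply: eq_bigr => k _ /=; ring.
  apply: eq_bigr => j _; apply: eq_bigr => k _; congr (_ * _).
  have sw : \sum_(0 <= l < N) \sum_(0 <= m < N) a l m * (lagcov C r j m * lagcov C r k l) =
     \sum_(0 <= l < N) \sum_(0 <= m < N) a l m * (lagcov C r j l * lagcov C r k m).
    by rewrite exchange_nat; apply: eq_bigr => l _; apply: eq_bigr => m _; rewrite asym.
  transitivity (\sum_(0 <= l < N) \sum_(0 <= m < N)
     (a l m * cumulant4 X C ((k%:R - j%:R) / r) ((l%:R - j%:R) / r) ((m%:R - j%:R) / r) +
      (lagcov C r j k * (a l m * lagcov C r l m) +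
       (a l m * (lagcov C r j l * lagcov C r k m) + a l m * (lagcov C r j m * lagcov C r k l))))).
    apply: eq_bigr => l _; apply: eq_bigr => m _; rewrite moment4E !lagE !covE; ring.
  rewrite !sum2_split sw -!addrA; congr (_ + (_ + _)); last by ring.
  by rewrite mulr_sumr; apply: eq_bigr => l _; rewrite mulr_sumr.
by ring.
Qed.

End MeanSquare.

(** * Two-sided bounds on the variance *)

Section Variance.
Context {d : measure_display} {T : measurableType d} {R : realType}.
Variables (Pr : probability T R) (X : R -> {RV Pr >-> R}) (C : R -> R).
Hypothesis hX : wide_sense_stationary X C.
Hypothesis h5 : fourth_order_condition X C.
Notation mu := (@lebesgue_measure R).

Lemma cumulant_tail_envelope (g : R -> R) : cumulant_envelope g -> tail_envelope g.
Proof. by case=> ? ? ? ? ?; split. Qed.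

(** Three of the four indices are summed against the envelopes of the
    cumulant, each at the cost of a factor [r]. *)
Lemma cumulant_sum_le (K M : R -> R) : tail_envelope M -> (forall x, `|K x| <= M x) ->
  exists2 m : R, 0 <= m & forall (r b th : R) N, 1 <= r ->
    `|cumulant_sum X C r N (amp K b th)| <= m * (N%:R * r ^+ 3).
Proof.
move=> eM KM; have [g1 [g2 [g3 [/cumulant_tail_envelope e1 /cumulant_tail_envelope e2
  /cumulant_tail_envelope e3 Qg]]]] := foc_cumulant h5.
have M00 : 0 <= M 0 := env_ge0 eM 0.
have m1 := env_mass_ge0 e1; have m2 := env_mass_ge0 e2; have m3 := env_mass_ge0 e3.
exists (M 0 ^+ 2 * (env_mass g1 * env_mass g2 * env_mass g3)).
  by rewrite mulr_ge0 ?sqr_ge0 // !mulr_ge0.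
move=> r b th N r1; have r0 : 0 < r by lra.
have rV0 : 0 < r^-1 by rewrite invr_gt0.
have rV1 : r^-1 <= 1 by rewrite invf_le1.
have row g j : tail_envelope g -> \sum_(0 <= k < N) g ((k%:R - j%:R) / r) <= env_mass g * r.
  move=> eg; have := row_mass_le N j eg rV0 rV1; rewrite invrK; apply: le_trans.
  by apply: ler_sum => k _; rewrite -(env_even eg) -mulNr opprB.
have rge g j : tail_envelope g -> 0 <= \sum_(0 <= k < N) g ((k%:R - j%:R) / r).
  by move=> eg; rewrite sumr_ge0 // => k _; exact: (env_ge0 eg).
have aM j k : `|amp K b th j k| <= M 0.
  by apply: le_trans (amp_le _ _ _ _ KM) _; exact: env0_ge.
apply: (@le_trans _ _ (\sum_(0 <= j < N) M 0 ^+ 2 *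
  ((\sum_(0 <= k < N) g1 ((k%:R - j%:R) / r)) * ((\sum_(0 <= l < N) g2 ((l%:R - j%:R) / r)) *
   (\sum_(0 <= m < N) g3 ((m%:R - j%:R) / r)))))).
  apply: le_trans (ler_norm_sum _ _ _) _; apply: ler_sum => j _.
  apply: le_trans (ler_norm_sum _ _ _) _; rewrite mulr_suml mulr_sumr; apply: ler_sum => k _.
  rewrite normrM.
  have -> : M 0 ^+ 2 * (g1 ((k%:R - j%:R) / r) * ((\sum_(0 <= l < N) g2 ((l%:R - j%:R) / r)) *
   (\sum_(0 <= m < N) g3 ((m%:R - j%:R) / r)))) = M 0 * (M 0 * g1 ((k%:R - j%:R) / r) *
   ((\sum_(0 <= l < N) g2 ((l%:R - j%:R) / r)) * (\sum_(0 <= m < N) g3 ((m%:R - j%:R) / r)))).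
    by ring.
  apply: ler_pM => //; apply: le_trans (ler_norm_sum _ _ _) _.
  rewrite mulr_suml mulr_sumr; apply: ler_sum => l _.
  apply: le_trans (ler_norm_sum _ _ _) _; rewrite mulr_sumr mulr_sumr; apply: ler_sum => m _.
  rewrite normrM -!mulrA; apply: ler_pM => //.
  by rewrite mulrA; exact: Qg.
apply: (@le_trans _ _ (\sum_(0 <= j < N) M 0 ^+ 2 *
   (env_mass g1 * r * (env_mass g2 * r * (env_mass g3 * r))))).
  apply: ler_sum => j _; rewrite ler_wpM2l ?sqr_ge0 //.
  apply: ler_pM; rewrite ?rge ?mulr_ge0 ?rge ?row //.
  by apply: ler_pM; rewrite ?rge ?row.
rewrite sumr_const_nat subn0 -(mulr_natl _ N) le_eqVlt; apply/orP; left; apply/eqP; ring.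
Qed.

Definition var_part (K : R -> R) (b r lam : R) (N : nat) : R :=
  ((2 * pi * r)^-1 * N%:R^-1) ^+ 2 *
     (2 * quad4 N (amp K b (lam / r)) (lagcov C r) + cumulant_sum X C r N (amp K b (lam / r))).

Lemma var_part_ge0 K (b r lam : R) n :
  (forall x, K (- x) = K x) -> K 0 = 1 -> 0 < r -> `|lam| <= pi * r ->
  0 <= var_part K b r lam n.+1.
Proof.
move=> Kev K0 r0 lr.
have := mse_decomposition hX h5 b (expected_density C K b r lam n.+1) n Kev K0 r0 lr.
rewrite subrr expr0n /= addr0 -/(var_part K b r lam n.+1) => <-.
by rewrite fine_expectation; apply: Rintegral_ge0 => w _; exact: sqr_ge0.
Qed.

Lemma kap_sq_le (r : R) (n : nat) : 0 < r ->
  ((2 * pi * r)^-1 * n.+1%:R^-1) ^+ 2 <= (r ^+ 2 * n.+1%:R ^+ 2)^-1.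
Proof.
move=> r0; have p2 := pi_ge2 R; have n0 : 0 < n.+1%:R :> R by rewrite ltr0n.
rewrite -invfM exprVn -exprMn lef_pV2 ?posrE ?exprn_gt0 ?mulr_gt0 ?pi_gt0 //.
rewrite lerXn2r ?nnegrE ?mulr_ge0 ?pi_ge0 ?(ltW r0) // ler_wpM2r // ?(ltW n0) //.
by rewrite ler_peMl ?(ltW r0) //; lra.
Qed.

(** The Gaussian part is [O((n b)^-1)] by [quad_upper] and the cumulant part
    is [O(r / n)], smaller by the factor [r b]. *)
Lemma var_part_le (K M H : R -> R) q : decaying C H q -> tail_envelope M ->
  (forall x, `|K x| <= M x) ->
  exists2 D : R, 0 <= D & forall (b r lam : R) n, 1 <= r -> 0 < b -> b <= 1 -> r * b <= 1 ->
    var_part K b r lam n.+1 <= D * (n.+1%:R * b)^-1.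
Proof.
move=> dC eM KM; have [m m0 hm] := cumulant_sum_le eM KM.
have M00 : 0 <= M 0 := env_ge0 eM 0.
have SM0 := env_mass_ge0 eM; have SH0 := env_mass_ge0 (dec_env dC).
exists (2 * (env_mass M * M 0 * env_mass H ^+ 2) + m).
  by rewrite addr_ge0 // !mulr_ge0 // sqr_ge0.
move=> b r lam n r1 b0 b1 rb; have r0 : 0 < r by lra.
have n0 : 0 < n.+1%:R :> R by rewrite ltr0n.
have hq := @quad_upper R C H K M q r b (lam / r) n.+1 dC KM eM b0 b1 r1.
have hc := hm r b (lam / r) n.+1 r1.
rewrite /var_part; set k2 := _ ^+ 2; have k20 : 0 <= k2 by exact: sqr_ge0.
apply: (@le_trans _ _ (k2 * (2 * (n.+1%:R * (env_mass M / b) * (M 0 * (r * env_mass H) ^+ 2)) +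
   m * (n.+1%:R * r ^+ 3)))).
  rewrite ler_wpM2l // lerD //; last exact: le_trans (ler_norm _) hc.
  by rewrite ler_wpM2l //; exact: le_trans (ler_norm _) hq.
apply: le_trans (ler_wpM2r _ (kap_sq_le n r0)) _.
  rewrite addr_ge0 // !mulr_ge0 // ?sqr_ge0 ?invr_ge0 ?(ltW b0) ?exprn_ge0 ?(ltW r0) //.
have -> : (r ^+ 2 * n.+1%:R ^+ 2)^-1 *
  (2 * (n.+1%:R * (env_mass M / b) * (M 0 * (r * env_mass H) ^+ 2)) + m * (n.+1%:R * r ^+ 3)) =
  (2 * (env_mass M * M 0 * env_mass H ^+ 2) + m * (r * b)) * (n.+1%:R * b)^-1.
  by move: n0; move: (n.+1%:R : R) => N N0; field; rewrite !gt_eqF.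
rewrite ler_wpM2r ?invr_ge0 ?mulr_ge0 ?(ltW n0) ?(ltW b0) // lerD2l.
by rewrite ler_piMr.
Qed.

Lemma spectral_sumE (r lam : R) N : 0 < r ->
  spectral_sum C r (lam / r) N = 2 * pi * r * sampled_density C r lam N.
Proof.
move=> r0; rewrite /sampled_density mulrA divff ?mul1r; last first.
  by rewrite !mulf_neq0 ?gt_eqF ?pi_gt0.
congr (_ + _ * _); apply: eq_bigr => v _; congr (_ * cos _); ring.
Qed.

(** In [quad_lower] the spectral sum is [2 pi r] times the sampled density,
    which [s0] bounds below, and the squared amplitudes sum to a multiple of
    [n / b]. All the error terms, including the cumulant, are absorbed once
    the oscillation [ep] and then [b] and [r b] are small. *)
Lemma var_part_lower (K M H : R -> R) q (s0 : R) : decaying C H q -> tail_envelope M ->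
  (forall x, `|K x| <= M x) -> continuous K -> K 0 = 1 -> 0 < s0 ->
  exists c e D : R, [/\ 0 < c, 0 < e, 0 < D & forall (b r lam : R) n,
    1 <= r -> 0 < b -> b <= e -> r * b <= e -> D <= n.+1%:R * b ->
    s0 <= `|sampled_density C r lam n.+1| ->
    c * (n.+1%:R * b)^-1 <= var_part K b r lam n.+1].
Proof.
move=> dC eM KM cK K0 s00; have [m m0 hm] := cumulant_sum_le eM KM.
have [dl dl0 hdl] := amp_sq_lower cK K0.
have M00 : 0 <= M 0 := env_ge0 eM 0.
have SM0 := env_mass_ge0 eM; have SH0 := env_mass_ge0 (dec_env dC).
set SM := env_mass M in SM0 *; set SH := env_mass H in SH0 *.
pose I := (\int[mu]_(t in `[0%R, +oo[) H t)%R.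
have I0 : 0 <= I by apply: Rintegral_ge0 => t _; exact: (env_ge0 (dec_env dC)).
(* [c0] is the constant of the main term, which appears twice because of the two
   crossed pairings; the errors may use up one copy, half of it for the
   oscillation of the kernel and half for the terms carrying [r b]. *)
pose c0 := dl / 256 * s0 ^+ 2; have c00 : 0 < c0 by rewrite mulr_gt0 ?exprn_gt0 ?divr_gt0.
pose ep := c0 / (4 * (SM * SH ^+ 2 + 1)).
have D1 : 0 < SM * SH ^+ 2 + 1 by rewrite ltr_wpDl // mulr_ge0 // sqr_ge0.
have ep0 : 0 < ep by rewrite divr_gt0 // mulr_gt0.
have [B B0 hB] := kernel_modulus cK eM KM ep0.
pose E := 4 * B * SM * SH ^+ 2 + 16 * M 0 * SM * SH * I + m + 1.
have E0 : 0 < E.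
  by rewrite ltr_wpDl // !addr_ge0 // !mulr_ge0 // sqr_ge0.
pose e := Num.min (Num.min 1 dl) (c0 / (2 * E)).
have e0 : 0 < e by rewrite !lt_min ltr01 dl0 divr_gt0 // mulr_gt0.
exists c0, e, (8 * dl + 1); split => //; first by rewrite ltr_wpDl // mulr_ge0 // ltW.
move=> b r lam n r1 b0 be rbe Nb hs.
have b1 : b <= 1 by apply: le_trans be _; rewrite !ge_min lexx.
have bdl : b <= dl by apply: le_trans be _; rewrite !ge_min lexx !orbT.
have rbE : r * b <= c0 / (2 * E) by apply: le_trans rbe _; rewrite ge_min lexx !orbT.
have r0 : 0 < r by lra.
have n0 : 0 < n.+1%:R :> R by rewrite ltr0n.
have Nb8 : 8 * dl <= n.+1%:R * b by lra.
have Nb1 : 1 <= n.+1%:R * b by lra.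
have hQ := hdl b (lam / r) n.+1 b0 bdl Nb8.
have hL := @quad_lower R C H K M q r b (lam / r) n.+1 dC KM eM b0 b1 r1 ep B (ltW ep0) B0 hB.
have hc := hm r b (lam / r) n.+1 r1.
rewrite -/SM -/SH -/I spectral_sumE // in hL.
set Q2 := \sum_(0 <= j < _) _ in hQ hL.
set sd := sampled_density _ _ _ _ in hs hL.
set q4 := quad4 _ _ _ in hL; set cs := cumulant_sum _ _ _ _ _ in hc.
rewrite /var_part -/q4 -/cs.
have sd2 : s0 ^+ 2 <= sd ^+ 2.
  by rewrite -[leRHS]real_normK ?num_real // lerXn2r ?nnegrE ?(ltW s00).
set k2 := _ ^+ 2; have k20 : 0 <= k2 by exact: sqr_ge0.
have k2le : k2 <= (r ^+ 2 * n.+1%:R ^+ 2)^-1 := kap_sq_le n r0.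
have k2S : k2 * (2 * pi * r * sd) ^+ 2 = sd ^+ 2 / n.+1%:R ^+ 2.
  rewrite /k2; move: pi (pi_gt0 R) => P P0; move: n0; move: (n.+1%:R : R) => N N0.
  by field; rewrite !gt_eqF.
set er := _ + 8 * _ * _ * _ * _ * _ in hL.
have er0 : 0 <= er.
  have SMb : 0 <= SM / b by apply: divr_ge0 => //; exact: ltW.
  have r3 : 0 <= r ^+ 3 by apply: exprn_ge0; exact: ltW.
  have ebr : 0 <= ep + 2 * B * b * r by rewrite addr_ge0 ?(ltW ep0) // !mulr_ge0 // ltW.
  rewrite /er addr_ge0 //; last by do 5 (apply: mulr_ge0 => //).
  by apply: mulr_ge0; [exact: mulr_ge0 | apply: mulr_ge0 => //; exact: sqr_ge0].
have step1 : k2 * (2 * ((2 * pi * r * sd) ^+ 2 * Q2 - er) - m * (n.+1%:R * r ^+ 3)) <= k2 * (2 * q4 + cs).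
  rewrite ler_wpM2l // lerD //; first by rewrite ler_wpM2l.
  by rewrite lerNl; apply: le_trans hc; rewrite -normrN ler_norm.
apply: le_trans step1.
have step2 : k2 * (2 * ((2 * pi * r * sd) ^+ 2 * Q2 - er) - m * (n.+1%:R * r ^+ 3)) =
  2 * (sd ^+ 2 / n.+1%:R ^+ 2 * Q2) - k2 * (2 * er + m * (n.+1%:R * r ^+ 3)).
  by rewrite -k2S; ring.
rewrite step2.
have z0 : 0 < (n.+1%:R * b)^-1 by rewrite invr_gt0 mulr_gt0.
set z := (n.+1%:R * b)^-1 in z0 *.
have t1 : 2 * (c0 * z) <= 2 * (sd ^+ 2 / n.+1%:R ^+ 2 * Q2).
  rewrite ler_wpM2l //.
  have -> : c0 * z = s0 ^+ 2 / n.+1%:R ^+ 2 * (dl / 256 * (n.+1%:R / b)).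
    by rewrite /c0 /z; move: n0; move: (n.+1%:R : R) => N N0; field; rewrite !gt_eqF.
  apply: ler_pM => //.
  - by rewrite divr_ge0 ?sqr_ge0.
  - by rewrite mulr_ge0 // divr_ge0 ?(ltW dl0) ?(ltW b0) ?(ltW n0).
  - by rewrite ler_wpM2r ?invr_ge0 ?sqr_ge0.
have t2 : k2 * (2 * er + m * (n.+1%:R * r ^+ 3)) <= c0 * z; last first.
  by rewrite lerBrDr; apply: le_trans t1; rewrite [leRHS]mulr_natl mulr2n lerD2l.
apply: le_trans (ler_wpM2r _ k2le) _.
  by rewrite addr_ge0 // mulr_ge0 // mulr_ge0 ?exprn_ge0 ?(ltW r0).
have -> : (r ^+ 2 * n.+1%:R ^+ 2)^-1 * (2 * er + m * (n.+1%:R * r ^+ 3)) =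
  (2 * (SM * SH ^+ 2) * ep + (4 * B * SM * SH ^+ 2 + 16 * M 0 * SM * SH * I / n.+1%:R / b + m) * (r * b)) * z.
  rewrite /er /z; move: n0; move: (n.+1%:R : R) => N N0; move: (ep) => ep'.
  by field; rewrite !gt_eqF.
rewrite ler_wpM2r ?(ltW z0) //.
have u1 : 2 * (SM * SH ^+ 2) * ep <= c0 / 2.
  have : ep * (4 * (SM * SH ^+ 2 + 1)) = c0 by rewrite /ep divfK // gt_eqF // mulr_gt0.
  move: (SM * SH ^+ 2) (ep) (c0) (ltW ep0) => S1 e1 c1 e10 <-.
  by rewrite -subr_ge0 (_ : _ - _ = 2 * e1) ?mulr_ge0 //; field.
have u2 : 16 * M 0 * SM * SH * I / n.+1%:R / b <= 16 * M 0 * SM * SH * I.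
  by rewrite -mulrA -invfM ler_piMr ?invf_le1 ?mulr_gt0 // !mulr_ge0.
have u3 : (4 * B * SM * SH ^+ 2 + 16 * M 0 * SM * SH * I / n.+1%:R / b + m) * (r * b) <= E * (c0 / (2 * E)).
  have A0 : 0 <= 4 * B * SM * SH ^+ 2 by rewrite mulr_ge0 ?sqr_ge0 // !mulr_ge0.
  have w0 : 0 <= 16 * M 0 * SM * SH * I / n.+1%:R / b.
    by rewrite mulr_ge0 ?invr_ge0 ?(ltW b0) // mulr_ge0 ?invr_ge0 ?(ltW n0) // !mulr_ge0.
  apply: ler_pM => //.
  - by rewrite !addr_ge0.
  - by rewrite mulr_ge0 ?(ltW r0) ?(ltW b0).
  by rewrite /E -[leLHS]addr0 !lerD.
have u4 : E * (c0 / (2 * E)) = c0 / 2 by field; rewrite gt_eqF.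
by apply: le_trans (lerD u1 u3) _; rewrite u4 -splitr.
Qed.

End Variance.

(** * Frequencies at which the leading terms do not vanish *)

Section Spectrum.
Context {R : realType}.
Notation mu := (@lebesgue_measure R).
Implicit Types (C H : R -> R).

Lemma spectral_density_nonzero C p (A : R) : 0 < A ->
  `|lam| `^ p * spectral_density C lam @[lam --> +oo] --> A ->
  exists lam, spectral_density C lam != 0.
Proof.
move=> A0 hA; have /cvgrPdist_lt /(_ A A0) [M [_ hM]] := hA.
exists (M + 1); apply/eqP => phi0.
have := hM (M + 1); rewrite phi0 mulr0 subr0 gtr0_norm // ltxx ltrDl ltr01.
by move=> /(_ isT).
Qed.

(** A constant cosine transform of [`|t| `^ q * C t] would make [C] vanish off
    the origin by [cos_transform_const0], hence the spectral density would
    vanish identically. *)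
Lemma psi_nonconstant C H q p (A : R) : decaying C H q -> 0 < q -> 0 < A ->
  `|lam| `^ p * spectral_density C lam @[lam --> +oo] --> A ->
  exists l1 l2, psi C q l1 != psi C q l2.
Proof.
move=> dC q0 A0 hA; apply: contrapT => nex.
have psiE l : psi C q l = psi C q 0.
  by apply: contrapT => /eqP h; apply: nex; exists l, 0.
have pn : 2 * pi != 0 :> R by rewrite mulf_neq0 // gt_eqF // pi_gt0.
have Cpos t : 0 < t -> C t = 0.
  move=> t0; have gH u : `| `|u| `^ q * C u | <= H u.
    by rewrite normrM (ger0_norm (powR_ge0 _ _)); exact: (dec_q dC).
  have := @cos_transform_const0 R H (fun u => `|u| `^ q * C u) t (2 * pi * psi C q 0)
    (dec_env dC) (continuous_absM_powR q0 (dec_cont dC)) gH.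
  move=> /(_ _ _ t0) h; apply/eqP; have : `|t| `^ q * C t = 0.
    apply: h; first by move=> u; rewrite normrN (dec_even dC).
    by move=> lam; rewrite -(psiE lam) /psi mulVKf.
  by move/eqP; rewrite mulf_eq0 gt_eqF //= powR_gt0 // gtr0_norm.
have [lam] := spectral_density_nonzero A0 hA; rewrite spectral_densityE => /eqP; apply.
have ig : mu.-integrable setT (EFin \o (fun t => C t * cos (t * lam))).
  apply: env_integrableM (dec_env dC) (dec_cont dC) (dec_0 dC) _ _ => t.
    apply: (continuous_cvg _ (@continuous_cos R _)); apply: cvgMr_tmp; exact: cvg_id.
  exact: cos_max.
rewrite /cos_transform Rintegral_even //; last first.
  by move=> t; rewrite (dec_even dC) mulNr cosN.
rewrite -(@Rintegral_itv_obnd_cbnd _ 0 +oo%O); last by apply: integrableS ig.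
rewrite (@eq_Rintegral _ _ _ _ _ (fun=> 0)); last first.
  by move=> t; rewrite inE /= in_itv /= andbT => t0; rewrite Cpos // mul0r.
by rewrite Rintegral_cst // mul0r !mulr0.
Qed.

(** With [al = 2 p q / (p + q + 2 p q)], the weights [al / (2 p)],
    [al / (2 q)] and [al] add up to 1, and the corresponding weighted
    geometric mean of the three terms is exactly [N `^ (- al)]: the powers of
    [r] and [b] cancel. A geometric mean is at most the sum. *)
Lemma rate_le_max (p q r b N : R) : 0 < p -> 0 < q -> 0 < r -> 0 < b -> 0 < N ->
  N `^ (- (2 * p * q / (p + q + 2 * p * q))) <=
   (r `^ (- p)) ^+ 2 + ((r * b) `^ q) ^+ 2 + (N * b)^-1.
Proof.
move=> p0 q0 r0 b0 N0; set D := p + q + _.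
have D0 : 0 < D by rewrite !addr_gt0 // !mulr_gt0.
set x2 := _ ^+ 2; set y2 := (_ `^ q) ^+ 2; set z := (N * b)^-1.
have rb0 : 0 < r * b by rewrite mulr_gt0.
have Nb0 : 0 < N * b by rewrite mulr_gt0.
have x20 : 0 < x2 by rewrite exprn_gt0 // powR_gt0.
have y20 : 0 < y2 by rewrite exprn_gt0 // powR_gt0.
have z0 : 0 < z by rewrite invr_gt0.
pose s := x2 + y2 + z; rewrite -/s; have s0 : 0 < s by rewrite !addr_gt0.
pose al := 2 * p * q / D.
have al0 : 0 < al by rewrite divr_gt0 // !mulr_gt0.
have pn : p != 0 by rewrite gt_eqF.
have qn : q != 0 by rewrite gt_eqF.
have Dn : D != 0 by rewrite gt_eqF.
have x2E : x2 `^ (al / (2 * p)) = r `^ (- al).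
  rewrite /x2 -powR_mulrn ?powR_ge0 // -!powRrM; congr (_ `^ _); field.
  by rewrite pn.
have y2E : y2 `^ (al / (2 * q)) = (r * b) `^ al.
  rewrite /y2 -powR_mulrn ?powR_ge0 // -!powRrM; congr (_ `^ _); field.
  by rewrite qn.
have zE : z `^ al = (N * b) `^ (- al).
  by rewrite /z -powR_inv1 ?(ltW Nb0) // -powRrM mulN1r.
have e1 : al / (2 * p) + al / (2 * q) + al = 1.
  by rewrite /al /D; field; rewrite -/D Dn pn qn.
have prod : N `^ (- al) = x2 `^ (al / (2 * p)) * y2 `^ (al / (2 * q)) * z `^ al.
  rewrite x2E y2E zE !powRM ?(ltW r0) ?(ltW b0) ?(ltW N0) // !powRN.
  by field; rewrite !gt_eqF // powR_gt0.
have sE : s = s `^ (al / (2 * p)) * s `^ (al / (2 * q)) * s `^ al.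
  rewrite -!powRD ?e1 ?powRr1 ?(ltW s0) // ?(gt_eqF s0) ?implybT //.
have mono u e : 0 <= e -> 0 < u -> u <= s -> u `^ e <= s `^ e.
  by move=> e0 u0 us; apply: ge0_ler_powR; rewrite ?nnegrE // ltW.
have xs : x2 <= s by rewrite /s -addrA lerDl addr_ge0 // ltW.
have ys : y2 <= s by rewrite /s addrAC lerDr addr_ge0 // ltW.
have zs : z <= s by rewrite /s lerDr addr_ge0 // ltW.
have a1 : 0 <= al / (2 * p) by rewrite ltW // divr_gt0 // mulr_gt0.
have a2 : 0 <= al / (2 * q) by rewrite ltW // divr_gt0 // mulr_gt0.
rewrite -/al prod [leRHS]sE; apply: ler_pM; rewrite ?mulr_ge0 ?powR_ge0 //.
  by apply: ler_pM; rewrite ?powR_ge0 // mono.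
by rewrite mono // ltW.
Qed.

End Spectrum.

(** * Non-cancellation of the bias at two frequencies *)

Section Algebra.
Context {R : realFieldType}.

Lemma sqr_sum3 (x y z : R) : (x + y + z) ^+ 2 <= 3 * (x ^+ 2 + y ^+ 2 + z ^+ 2).
Proof.
rewrite -subr_ge0.
have -> : 3 * (x ^+ 2 + y ^+ 2 + z ^+ 2) - (x + y + z) ^+ 2 =
  (x - y) ^+ 2 + (y - z) ^+ 2 + (z - x) ^+ 2 by ring.
by rewrite !addr_ge0 // sqr_ge0.
Qed.

(** The matrix with rows [(Z, - a1)] and [(Z, - a2)] is invertible, so [x] and
    [y] are controlled by the two biases [t1] and [t2]; the relative error [e]
    is small enough to be absorbed. *)
Lemma two_bias_lower (Z a1 a2 : R) : 0 < Z -> a1 != a2 ->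
  exists e c : R, [/\ 0 < e, 0 <= c & forall x y z t1 t2 : R, 0 <= x -> 0 <= y -> 0 <= z -> z <= 1 ->
    `|t1 - (Z * x - a1 * y)| <= e * (x + y + z) -> `|t2 - (Z * x - a2 * y)| <= e * (x + y + z) ->
    x ^+ 2 + y ^+ 2 <= c * (t1 ^+ 2 + t2 ^+ 2 + z)].
Proof.
move=> Z0 a12; pose D := `|a1 - a2|; have D0 : 0 < D by rewrite normr_gt0 subr_eq0.
pose c1 := D^-1 * (1 + `|a1| / Z) + Z^-1.
have w0 : 0 <= `|a1| / Z by rewrite divr_ge0 // ltW.
have c10 : 0 < c1 by rewrite addr_gt0 ?invr_gt0 // mulr_gt0 ?invr_gt0 // ltr_wpDr.
pose e := (4 * c1)^-1; have e0 : 0 < e by rewrite invr_gt0 mulr_gt0.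
exists e, (16 * c1 ^+ 2 + 2); split => //.
  by rewrite addr_ge0 // mulr_ge0 // sqr_ge0.
move=> x y z t1 t2 x0 y0 z0 z1 h1 h2.
set s := x + y + z in h1 h2; have s0 : 0 <= s by rewrite !addr_ge0.
have es0 : 0 <= e * s by rewrite mulr_ge0 // ltW.
set b := `|t1| + `|t2|; have b0 : 0 <= b by rewrite addr_ge0.
have hy : y <= D^-1 * (b + 2 * (e * s)).
  rewrite ler_pdivlMl //; apply: (@le_trans _ _ `|(a1 - a2) * y|).
    by rewrite normrM (ger0_norm y0).
  have -> : (a1 - a2) * y = (t2 - t1) + ((t1 - (Z * x - a1 * y)) - (t2 - (Z * x - a2 * y))) by ring.
  apply: le_trans (ler_normD _ _) _; apply: lerD.
    by rewrite /b [leRHS]addrC; exact: ler_normB.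
  by apply: le_trans (ler_normB _ _) _; rewrite mulr_natl mulr2n lerD.
have hx : x <= Z^-1 * (b + `|a1| * y + e * s).
  rewrite ler_pdivlMl //.
  have -> : Z * x = t1 + a1 * y - (t1 - (Z * x - a1 * y)) by ring.
  apply: le_trans (ler_norm _) _; apply: le_trans (ler_normB _ _) _; apply: lerD => //.
  apply: le_trans (ler_normD _ _) _; rewrite normrM (ger0_norm y0) lerD2r /b.
  by rewrite lerDl.
have hxy : x + y <= c1 * (b + 2 * (e * s)).
  have q1 : x <= Z^-1 * (b + 2 * (e * s)) + `|a1| / Z * y.
    apply: le_trans hx _.
    have -> : Z^-1 * (b + `|a1| * y + e * s) = Z^-1 * (b + e * s) + `|a1| / Z * y by ring.
    rewrite lerD2r ler_wpM2l ?invr_ge0 ?(ltW Z0) // lerD2l mulr_natl mulr2n lerDl //.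
  have q2 : (1 + `|a1| / Z) * y <= (1 + `|a1| / Z) * (D^-1 * (b + 2 * (e * s))).
    by rewrite ler_wpM2l // addr_ge0.
  have -> : c1 * (b + 2 * (e * s)) = Z^-1 * (b + 2 * (e * s)) +
     (1 + `|a1| / Z) * (D^-1 * (b + 2 * (e * s))) by rewrite /c1; ring.
  move: q1 q2; move: (Z^-1 * _) ((1 + _) * (D^-1 * _)) => u v.
  rewrite mulrDl mul1r; move: (`|a1| / Z * y) => w; lra.
(* The choice of [e]: half of [x + y + z] moves to the left side. *)
have e2 : c1 * (2 * (e * s)) = s / 2.
  by rewrite /e; field; rewrite gt_eqF.
have hs : x + y <= 2 * c1 * b + z.
  rewrite mulrDr e2 in hxy; rewrite -mulrA; move: (c1 * b) hxy => u; rewrite /s; lra.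
have sq : (x + y) ^+ 2 <= (2 * c1 * b + z) ^+ 2.
  rewrite lerXn2r ?nnegrE ?addr_ge0 // !mulr_ge0 // ltW //.
have zz : z ^+ 2 <= z by rewrite expr2 ler_piMl.
have bb : b ^+ 2 <= 2 * (t1 ^+ 2 + t2 ^+ 2).
  rewrite /b -(real_normK (num_real t1)) -(real_normK (num_real t2)).
  by have := sqr_ge0 (`|t1| - `|t2|); rewrite sqrrB sqrrD; lra.
have xy : x ^+ 2 + y ^+ 2 <= (x + y) ^+ 2.
  by have := mulr_ge0 x0 y0; rewrite sqrrD; lra.
have s2 : (2 * c1 * b + z) ^+ 2 <= 8 * c1 ^+ 2 * b ^+ 2 + 2 * z ^+ 2.
  by rewrite -subr_ge0 (_ : _ - _ = (2 * c1 * b - z) ^+ 2) ?sqr_ge0 //; ring.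
apply: le_trans xy _; apply: le_trans sq _; apply: le_trans s2 _.
have c2 : 0 <= c1 ^+ 2 by rewrite sqr_ge0.
have bb' := ler_wpM2l c2 bb.
have tt : 0 <= t1 ^+ 2 + t2 ^+ 2 by rewrite addr_ge0 // sqr_ge0.
move: bb' zz tt z0 c2; move: (t1 ^+ 2 + t2 ^+ 2) (b ^+ 2) (c1 ^+ 2) (z ^+ 2) => tt bq cq zq bb' zz tt0 z0 cq0.
have cz : 0 <= cq * z by rewrite mulr_ge0.
have -> : (16 * cq + 2) * (tt + z) = 8 * (cq * (2 * tt)) + 16 * (cq * z) + 2 * tt + 2 * z by ring.
have -> : 8 * cq * bq = 8 * (cq * bq) by ring.
lra.
Qed.

End Algebra.

(** * Two-sided bounds on the risk *)

Section TwoSided.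
Context {d : measure_display} {T : measurableType d} {R : realType}.
Variables (Pr : probability T R) (X : R -> {RV Pr >-> R}) (C K : R -> R) (p q A : R).
Hypothesis hX : wide_sense_stationary X C.
Hypothesis hXcont : mean_square_continuous X.
Hypothesis hq : 1 < q.
Hypothesis h1A : lebesgue_measure.-integrable setT (decay_envelope C q).
Hypothesis hp : 1 < p.
Hypothesis hA : 0 < A.
Hypothesis h1B : `|lam| `^ p * spectral_density C lam @[lam --> +oo] --> A.
Hypothesis h2 : kernel_condition K.
Hypothesis h2A : characteristic_exponent K q.
Hypothesis h5 : fourth_order_condition X C.

(** Indexed so that widths and rates, positive only at positive sample sizes,
    are positive at every [n]. *)
Definition risk (b rho : nat -> R) (lam : R) (n : nat) : R :=
  fine 'E_Pr[fun w => (estimator X K (b n) (rho n) n.+1 lam w - spectral_density C lam) ^+ 2].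

(** Squared aliasing bias, squared smoothing bias and variance, up to
    constants. *)
Definition risk_scale (b rho : nat -> R) (n : nat) : R :=
  (rho n `^ (- p)) ^+ 2 + ((rho n * b n) `^ q) ^+ 2 + (n.+1%:R * b n)^-1.

(** The upper bound holds at each frequency. For the lower bound, [l0] is a
    frequency where the spectral density does not vanish, which bounds the
    variance below, while [l1] and [l2] have distinct values of [psi], so that
    the two bias terms cannot cancel at both. *)
Lemma risk_bounds (b rho : nat -> R) :
  (forall n, 0 < b n) -> (forall n, 0 < rho n) -> b @ \oo --> (0 : R) ->
  (fun n => n.+1%:R * b n) @ \oo --> +oo -> rho @ \oo --> +oo ->
  (fun n => rho n * b n) @ \oo --> (0 : R) ->
  (forall lam, exists2 D : R, 0 <= D &
     \forall n \near \oo, 0 <= risk b rho lam n <= D * risk_scale b rho n) /\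
  (exists l0 l1 l2 : R, exists2 D : R, 0 <= D & \forall n \near \oo,
     risk_scale b rho n <= D * (risk b rho l0 n + risk b rho l1 n + risk b rho l2 n)).
Proof.
move=> b0 r0 bc nb ry rb.
have q0 : 0 < q by apply: lt_trans hq.
have [H dC] := decaying_envelope hq (cov_continuous hX hXcont) (cov_even hX) (cov_abs_le hX) h1A.
have [M [M1 M2 M3 _ M5] KM] := ker_bound h2.
have eM : tail_envelope M by split.
have Kev := ker_even h2; have K0 := ker_at0 h2; have cK := ker_cont h2.
have KM0 x : `|K x| <= M 0 by apply: le_trans (KM x) _; exact: env0_ge.
have [_ [k kn hk] _] := h2A.
have [Z [B [Z0 B0 hZ]]] := aliasing dC hp hA h1B.
have bias := bias_expansion dC q0 KM0 hk hZ b0 r0 nb ry rb.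
have [Dv Dv0 hV] := var_part_le h5 dC eM KM.
pose x n := rho n `^ (- p); pose y n := (rho n * b n) `^ q; pose z n := (n.+1%:R * b n)^-1.
have x0 n : 0 <= x n by exact: powR_ge0.
have y0 n : 0 <= y n by exact: powR_ge0.
have z0 n : 0 <= z n by rewrite invr_ge0 mulr_ge0 // ltW.
have sE n : risk_scale b rho n = x n ^+ 2 + y n ^+ 2 + z n by [].
have ev (e R0 : R) : 0 < e -> \forall n \near \oo,
   [/\ b n <= e, rho n * b n <= e, R0 <= rho n & R0 <= n.+1%:R * b n].
  move=> e0; have h1 := cvgn_near bc e0; have h2' := cvgn_near rb e0.
  move/cvgryPge : (ry) => /(_ R0) h3; move/cvgryPge : (nb) => /(_ R0) h4.
  near=> n; split.
  - by apply: le_trans (ler_norm _) _; rewrite -[X in `|X|]subr0; near: n; exact: h1.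
  - by apply: le_trans (ler_norm _) _; rewrite -[X in `|X|]subr0; near: n; exact: h2'.
  - by near: n; exact: h3.
  - by near: n; exact: h4.
have zle1 n : 1 <= n.+1%:R * b n -> z n <= 1.
  by move=> h; rewrite /z invf_le1 // mulr_gt0.
have decomp lam n : `|lam| <= rho n -> 1 <= rho n -> risk b rho lam n =
   var_part X C K (b n) (rho n) lam n.+1 +
   (expected_density C K (b n) (rho n) lam n.+1 - spectral_density C lam) ^+ 2
   /\ 0 <= var_part X C K (b n) (rho n) lam n.+1.
  move=> lr r1; have pr : `|lam| <= pi * rho n.
    apply: le_trans lr _; rewrite ler_peMl ?(ltW (r0 n)) //.
    by have := pi_ge2 R; lra.
  split; first exact: (mse_decomposition hX h5).
  exact: var_part_ge0.
split.
  move=> lam.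
  pose c := `|Z| + `|k * psi C q lam| + 1; have c0 : 0 <= c by rewrite !addr_ge0.
  exists (Dv + 3 * c ^+ 2); first by rewrite addr_ge0 // mulr_ge0 // sqr_ge0.
  have E1 := ev 1 (Num.max 1 `|lam|) ltr01; have E2 := bias lam 1 ltr01.
  near=> n.
  have [b1 rb1 rM nM] : [/\ b n <= 1, rho n * b n <= 1, Num.max 1 `|lam| <= rho n &
     Num.max 1 `|lam| <= n.+1%:R * b n] by near: n; exact: E1.
  have r1 : 1 <= rho n by apply: le_trans rM; rewrite le_max lexx.
  have rl : `|lam| <= rho n by apply: le_trans rM; rewrite le_max lexx orbT.
  have n1 : 1 <= n.+1%:R * b n by apply: le_trans nM; rewrite le_max lexx.
  have tb : `|expected_density C K (b n) (rho n) lam n.+1 - spectral_density C lam -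
     (Z * x n - k * psi C q lam * y n)| <= 1 * (x n + y n + z n) by near: n; exact: E2.
  have [-> v0] := decomp lam n rl r1.
  have vb := hV (b n) (rho n) lam n r1 (b0 n) b1 rb1.
  apply/andP; split; first by rewrite addr_ge0 // sqr_ge0.
  set t := expected_density C K (b n) (rho n) lam n.+1 - spectral_density C lam in tb *.
  have tc : `|t| <= c * (x n + y n + z n).
    have -> : t = (t - (Z * x n - k * psi C q lam * y n)) + (Z * x n - k * psi C q lam * y n) by ring.
    apply: le_trans (ler_normD _ _) _; apply: le_trans (lerD tb (ler_normB _ _)) _.
    rewrite (normrM Z) (normrM (k * _)) (ger0_norm (x0 n)) (ger0_norm (y0 n)) /c.
    move: (x0 n) (y0 n) (z0 n); move: (x n) (y n) (z n) (`|Z|) (`|k * psi C q lam|) (normr_ge0 Z) (normr_ge0 (k * psi C q lam)).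
    move=> x' y' z' u v u0 v0' x0' y0' z0'.
    have := mulr_ge0 u0 y0'; have := mulr_ge0 u0 z0'; have := mulr_ge0 v0' x0'; have := mulr_ge0 v0' z0'.
    lra.
  have t2 : t ^+ 2 <= 3 * c ^+ 2 * risk_scale b rho n.
    rewrite -(real_normK (num_real t)).
    apply: (@le_trans _ _ ((c * (x n + y n + z n)) ^+ 2)).
      by rewrite lerXn2r ?nnegrE // mulr_ge0 // !addr_ge0.
    have -> : 3 * c ^+ 2 * risk_scale b rho n = c ^+ 2 * (3 * risk_scale b rho n) by ring.
    rewrite exprMn ler_wpM2l ?sqr_ge0 // sE.
    apply: le_trans (sqr_sum3 _ _ _) _; rewrite ler_wpM2l // lerD2l expr2 ler_piMl //.
    exact: zle1.
  rewrite mulrDl lerD //; apply: le_trans vb _; rewrite ler_wpM2l // sE lerDr.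
  by rewrite addr_ge0 // sqr_ge0.
have [l0 phi0] := spectral_density_nonzero hA h1B.
have [l1 [l2 psi12]] := psi_nonconstant dC q0 hA h1B.
pose s0 := `|spectral_density C l0| / 2.
have s00 : 0 < s0 by rewrite divr_gt0 // normr_gt0.
have [cv [ev0 [Dl [cv0 ev00 Dl0 hVl]]]] := var_part_lower h5 dC eM KM cK K0 s00.
have a12 : k * psi C q l1 != k * psi C q l2.
  by apply/eqP => /(mulfI kn) /eqP; rewrite (negbTE psi12).
have [e [c [e0 c0 two]]] := two_bias_lower Z0 a12.
exists l0, l1, l2, ((c + (c + 1) / cv)).
  by rewrite addr_ge0 // divr_ge0 ?(ltW cv0) // addr_ge0.
have [R0 R01 hR0] := hZ l0 1 ltr01.
pose eps := Num.min (Num.min 1 ev0) (s0 / (2 * (B + 1))).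
have B1 : 0 < B + 1 by rewrite ltr_wpDl.
have eps0 : 0 < eps by rewrite !lt_min ltr01 ev00 divr_gt0 // mulr_gt0.
pose Rb := 1 + R0 + `|l0| + `|l1| + `|l2| + Dl + (2 * (Z + 1)) / s0.
have Zs0 : 0 <= (2 * (Z + 1)) / s0 by rewrite divr_ge0 ?(ltW s00) // mulr_ge0 // addr_ge0 // ltW.
have E1 := ev eps Rb eps0; have E2 := bias l1 e e0; have E3 := bias l2 e e0.
near=> n.
have [b1 rb1 rM nM] : [/\ b n <= eps, rho n * b n <= eps, Rb <= rho n &
     Rb <= n.+1%:R * b n] by near: n; exact: E1.
have := normr_ge0 l0; have := normr_ge0 l1; have := normr_ge0 l2 => m2 m1 m0.
have r1 : 1 <= rho n by apply: le_trans rM; rewrite /Rb; lra.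
have rR0 : R0 <= rho n by apply: le_trans rM; rewrite /Rb; lra.
have rl0 : `|l0| <= rho n by apply: le_trans rM; rewrite /Rb; lra.
have rl1 : `|l1| <= rho n by apply: le_trans rM; rewrite /Rb; lra.
have rl2 : `|l2| <= rho n by apply: le_trans rM; rewrite /Rb; lra.
have rs : (2 * (Z + 1)) / s0 <= rho n by apply: le_trans rM; rewrite /Rb; lra.
have n1 : 1 <= n.+1%:R * b n by apply: le_trans nM; rewrite /Rb; lra.
have nD : Dl <= n.+1%:R * b n by apply: le_trans nM; rewrite /Rb; lra.
have be : b n <= ev0 by apply: le_trans b1 _; rewrite /eps !ge_min lexx !orbT.
have rbe : rho n * b n <= ev0 by apply: le_trans rb1 _; rewrite /eps !ge_min lexx !orbT.
have rbs : rho n * b n <= s0 / (2 * (B + 1)) by apply: le_trans rb1 _; rewrite /eps !ge_min lexx !orbT.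
have z1 := zle1 n n1.
have sl : s0 <= `|sampled_density C (rho n) l0 n.+1|.
  have h := hR0 (rho n) n.+1 rR0 isT; rewrite mul1r -/(x n) in h.
  have xs : (Z + 1) * x n <= s0 / 2.
    have xr : x n <= (rho n)^-1.
      rewrite -powR_inv1 ?(ltW (r0 n)) // /x ler_powR // lerN2; exact: ltW.
    have Z1 : 0 <= Z + 1 by rewrite addr_ge0 // ltW.
    apply: le_trans (ler_wpM2l Z1 xr) _; rewrite ler_pdivrMr //.
    by move: rs; rewrite ler_pdivrMr //; lra.
  have rN : B * rho n / n.+1%:R <= s0 / 2.
    have -> : B * rho n / n.+1%:R = B * ((rho n * b n) * z n).
      rewrite /z; have := ltr0n R n.+1; move: (n.+1%:R : R) => N N0.
      by field; rewrite !gt_eqF.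
    have rb00 : 0 <= rho n * b n by rewrite mulr_ge0 // ltW.
    apply: (@le_trans _ _ ((B + 1) * (s0 / (2 * (B + 1))))).
      apply: ler_pM => //; [by rewrite mulr_ge0 | by rewrite lerDl |].
      by apply: le_trans rbs; rewrite ler_piMr.
    by rewrite le_eqVlt; apply/orP; left; apply/eqP; field; rewrite gt_eqF.
  have := ler_normB (spectral_density C l0) (sampled_density C (rho n) l0 n.+1 - (sampled_density C (rho n) l0 n.+1 - spectral_density C l0)).
  have t1 : `|sampled_density C (rho n) l0 n.+1 - spectral_density C l0| <= s0.
    have -> : sampled_density C (rho n) l0 n.+1 - spectral_density C l0 =
     (sampled_density C (rho n) l0 n.+1 - spectral_density C l0 - Z * x n) + Z * x n by ring.
    apply: le_trans (ler_normD _ _) _; rewrite [X in _ + X]ger0_norm ?mulr_ge0 ?(ltW Z0) //.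
    by move: h xs rN; move: (`|_|) (B * _ / _) => u v; rewrite mulrDl mul1r; lra.
  move=> _; have := ler_normB (sampled_density C (rho n) l0 n.+1)
    (sampled_density C (rho n) l0 n.+1 - spectral_density C l0).
  rewrite opprB addrC subrK => h'.
  have e2 : `|spectral_density C l0| = s0 + s0 by rewrite /s0 -splitr.
  by rewrite e2 in h'; move: h' t1; move: (`|_|) (`|_|) => u v; lra.
have vl := hVl (b n) (rho n) l0 n r1 (b0 n) be rbe nD sl.
have [d0 v0] := decomp l0 n rl0 r1; have [d1 v1] := decomp l1 n rl1 r1.
have [d2 v2] := decomp l2 n rl2 r1.
have tb1 : `|expected_density C K (b n) (rho n) l1 n.+1 - spectral_density C l1 -
  (Z * x n - k * psi C q l1 * y n)| <= e * (x n + y n + z n) by near: n; exact: E2.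
have tb2 : `|expected_density C K (b n) (rho n) l2 n.+1 - spectral_density C l2 -
  (Z * x n - k * psi C q l2 * y n)| <= e * (x n + y n + z n) by near: n; exact: E3.
set t1 := expected_density C K (b n) (rho n) l1 n.+1 - spectral_density C l1 in d1 tb1.
set t2 := expected_density C K (b n) (rho n) l2 n.+1 - spectral_density C l2 in d2 tb2.
have tw := two _ _ _ _ _ (x0 n) (y0 n) (z0 n) z1 tb1 tb2.
have zr : z n <= cv^-1 * risk b rho l0 n.
  by rewrite ler_pdivlMl // d0; apply: le_trans vl _; rewrite lerDl sqr_ge0.
have t1r : t1 ^+ 2 <= risk b rho l1 n by rewrite d1 lerDr.
have t2r : t2 ^+ 2 <= risk b rho l2 n by rewrite d2 lerDr.
have k0 : 0 <= risk b rho l0 n by rewrite d0 addr_ge0 // sqr_ge0.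
have k1 : 0 <= risk b rho l1 n by rewrite d1 addr_ge0 // sqr_ge0.
have k2 : 0 <= risk b rho l2 n by rewrite d2 addr_ge0 // sqr_ge0.
rewrite sE; apply: (@le_trans _ _ (c * (risk b rho l1 n + risk b rho l2 n) + (c + 1) * (cv^-1 * risk b rho l0 n))).
  apply: (@le_trans _ _ (c * (t1 ^+ 2 + t2 ^+ 2) + (c + 1) * z n)).
    rewrite (_ : c * (t1 ^+ 2 + t2 ^+ 2) + (c + 1) * z n = c * (t1 ^+ 2 + t2 ^+ 2 + z n) + z n); last by ring.
    by rewrite lerD2r.
  apply: lerD; first by rewrite ler_wpM2l // lerD.
  by rewrite ler_wpM2l // addr_ge0.
have cw : 0 <= (c + 1) / cv by rewrite divr_ge0 ?(ltW cv0) // addr_ge0.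
have -> : (c + 1) * (cv^-1 * risk b rho l0 n) = (c + 1) / cv * risk b rho l0 n by ring.
move: cw; move: ((c + 1) / cv) => w w0.
rewrite -subr_ge0.
have -> : (c + w) * (risk b rho l0 n + risk b rho l1 n + risk b rho l2 n) -
  (c * (risk b rho l1 n + risk b rho l2 n) + w * risk b rho l0 n) =
  c * risk b rho l0 n + w * (risk b rho l1 n + risk b rho l2 n) by ring.
by rewrite addr_ge0 // mulr_ge0 // addr_ge0.
Unshelve. all: by end_near. Qed.

End TwoSided.

(** * Power choices of the width and of the rate *)

Section Rates.
Context {R : realType}.
Implicit Types (f g : nat -> R).

Lemma bigO_seqP f g : (f : nat -> R^o) =O_\oo (g : nat -> R^o) <->
  exists2 k : R, 0 < k & \forall n \near \oo, `|f n| <= k * `|g n|.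
Proof. exact: eqO_exP. Qed.

Lemma near_shiftS (P : nat -> Prop) : (\forall n \near \oo, P n.+1) -> \forall n \near \oo, P n.
Proof. by move=> [N _ hN]; exists N.+1 => // -[//|n] /= Nn; exact: hN. Qed.

Lemma near_unshiftS (P : nat -> Prop) : (\forall n \near \oo, P n) -> \forall n \near \oo, P n.+1.
Proof. by move=> [N _ hN]; exists N => // n /= Nn; apply: hN => /=; exact: leqW. Qed.

Lemma natpow_cvgy (e : R) : 0 < e -> (fun n => n%:R `^ e) @ \oo --> +oo.
Proof.
move=> e0; apply/cvgryPge => A; have := nbhs_infty_ger ((`|A| + 1) `^ e^-1).
apply: filterS => n hn; apply: le_trans (ler_norm A) _.
apply: (@le_trans _ _ (`|A| + 1)); first by rewrite lerDl.
have -> : `|A| + 1 = ((`|A| + 1) `^ e^-1) `^ e.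
  by rewrite -powRrM mulVf ?gt_eqF // powRr1 // addr_ge0.
by apply: ge0_ler_powR; rewrite ?nnegrE ?powR_ge0 ?(ltW e0).
Qed.

Lemma natpow_cvg0 (e : R) : 0 < e -> (fun n => n%:R `^ (- e)) @ \oo --> (0 : R).
Proof.
move=> e0; under eq_cvg do rewrite powRN.
apply/gtr0_cvgV0; last exact: natpow_cvgy.
by exists 1%N => // n /= n0; rewrite powR_gt0 // ltr0n.
Qed.

Lemma scale_cvgy (c : R) f : 0 < c -> f @ \oo --> +oo -> (fun n => c * f n) @ \oo --> +oo.
Proof.
move=> c0 /cvgryPge fy; apply/cvgryPge => A; have := fy (A / c).
by apply: filterS => n; rewrite ler_pdivrMr // mulrC.
Qed.

Section Exponents.
Variables (p q P Q : R).
Hypotheses (p0 : 0 < p) (q0 : 0 < q) (P0 : 0 < P) (Q0 : 0 < Q).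
Let D := p + q + 2 * p * q.
Let rho (n : nat) := P * n%:R `^ (q / D).
Let b (n : nat) := Q * n%:R `^ (- ((p + q) / D)).
Let D0 : 0 < D. Proof. by rewrite !addr_gt0 // !mulr_gt0. Qed.
Let Dn : D != 0. Proof. by rewrite gt_eqF. Qed.

Lemma rhobE n : (0 < n)%N -> rho n * b n = P * Q * n%:R `^ (- (p / D)).
Proof.
move=> n0; rewrite /rho /b mulrACA -powRD; last by rewrite pnatr_eq0 -lt0n n0 implybT.
by congr (_ * _ `^ _); field.
Qed.

Lemma nbE n : (0 < n)%N -> n%:R * b n = Q * n%:R `^ (2 * p * q / D).
Proof.
move=> n0; rewrite /b mulrCA -{1}(powRr1 (ler0n R n)) -powRD; last by rewrite pnatr_eq0 -lt0n n0 implybT.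
by congr (_ * _ `^ _); rewrite /D; field.
Qed.

Lemma power_admissible : admissible b rho.
Proof.
split.
- by move=> n n0; split; rewrite mulr_gt0 // powR_gt0 // ltr0n.
- rewrite -(mulr0 Q); apply: cvgMl_tmp; apply: natpow_cvg0.
  by rewrite divr_gt0 // addr_gt0.
- have h : (fun n => Q * n%:R `^ (2 * p * q / D)) @ \oo --> +oo.
    by apply: scale_cvgy => //; apply: natpow_cvgy; rewrite divr_gt0 // !mulr_gt0.
  apply: cvg_trans h; apply: near_eq_cvg; exists 1%N => // n /= n0; exact/esym/nbE.
- by apply: scale_cvgy => //; apply: natpow_cvgy; rewrite divr_gt0.
have h : (fun n => P * Q * n%:R `^ (- (p / D))) @ \oo --> (0 : R).
  rewrite -(mulr0 (P * Q)); apply: cvgMl_tmp; apply: natpow_cvg0; exact: divr_gt0.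
apply: cvg_trans h; apply: near_eq_cvg; exists 1%N => // n /= n0; exact/esym/rhobE.
Qed.

(** The exponents are those for which the three terms have the same order. *)
Lemma power_scale n : risk_scale p q (b \o S) (rho \o S) n =
  ((P `^ (- p)) ^+ 2 + ((P * Q) `^ q) ^+ 2 + Q^-1) * n.+1%:R `^ (- (2 * p * q / D)).
Proof.
rewrite /risk_scale /= nbE // rhobE //; set N : R := n.+1%:R.
have N0 : 0 <= N by exact: ler0n.
rewrite /rho -/N powRM ?(ltW P0) ?powR_ge0 // [(_ * _ `^ (- (p / D))) `^ q]powRM ?mulr_ge0 ?(ltW P0) ?(ltW Q0) ?powR_ge0 //.
rewrite -!powRrM !exprMn invfM powRN -(powR_mulrn 2 (powR_ge0 N (q / D * - p))).
rewrite -(powR_mulrn 2 (powR_ge0 N (- (p / D) * q))) -!powRrM.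
have -> : q / D * - p * 2%:R = - (2 * p * q / D) by ring.
have -> : - (p / D) * q * 2%:R = - (2 * p * q / D) by ring.
by rewrite !powRN; ring.
Qed.

End Exponents.
End Rates.

Theorem theorem4 (d : measure_display) (T : measurableType d) (R : realType)
    (Pr : probability T R) (X : R -> {RV Pr >-> R}) (C K : R -> R) (p q A : R)
    (hX : wide_sense_stationary X C)
    (hXcont : mean_square_continuous X)
    (hq : 1 < q)
    (h1A : lebesgue_measure.-integrable setT (decay_envelope C q))
    (hp : 1 < p) (hA : 0 < A)
    (h1B : `|lam| `^ p * spectral_density C lam @[lam --> +oo] --> A)
    (h2 : kernel_condition K)
    (h2A : characteristic_exponent K q)
    (h5 : fourth_order_condition X C) :
  let D := p + q + 2 * p * q in
  let rate := fun n : nat => n%:R `^ (- (2 * p * q / D)) : R in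
  optimal_mse_rate X C K rate /\
  forall P Q : R, 0 < P -> 0 < Q ->
    let rho := fun n : nat => P * n%:R `^ (q / D) in
    let b := fun n : nat => Q * n%:R `^ (- ((p + q) / D)) in
    admissible b rho /\ mse_rate X C K b rho rate.
Proof.
move=> D rate.
have p0 : 0 < p by apply: lt_trans hp.
have q0 : 0 < q by apply: lt_trans hq.
(* Widths and rates are positive only at positive indices, so the bounds apply
   to the shifted sequences. *)
have bounds (b rho : nat -> R) : admissible b rho -> _ :=
  fun adm => risk_bounds hX hXcont hq h1A hp hA h1B h2 h2A h5
   (fun n => proj1 (adm_pos adm (ltn0Sn n))) (fun n => proj2 (adm_pos adm (ltn0Sn n))).
have shift (u : nat -> R) (l : set_system R) : u @ \oo --> l -> (fun n => u n.+1) @ \oo --> l.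
  by move=> ul; rewrite (cvg_shiftS u).
have {}bounds b rho (adm : admissible b rho) :=
  bounds b rho adm (shift _ _ (adm_b adm)) (shift _ _ (adm_nb adm)) (shift _ _ (adm_rho adm))
    (shift _ _ (adm_rhob adm)).
have mseE b rho lam n : risk X C K (b \o S) (rho \o S) lam n = mse X C K b rho lam n.+1 by [].
have achieve P Q : 0 < P -> 0 < Q ->
    let rho := fun n : nat => P * n%:R `^ (q / D) in
    let b := fun n : nat => Q * n%:R `^ (- ((p + q) / D)) in
    admissible b rho /\ mse_rate X C K b rho rate.
  move=> P0 Q0 rho b; have adm : admissible b rho := power_admissible p0 q0 P0 Q0.
  split => // lam; apply/bigO_seqP; have [up _] := bounds b rho adm.
  have [E E0 hE] := up lam.
  set c := (P `^ (- p)) ^+ 2 + ((P * Q) `^ q) ^+ 2 + Q^-1.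
  have c0 : 0 < c by rewrite ltr_wpDl ?invr_gt0 // addr_ge0 // sqr_ge0.
  exists (E * c + 1); first by rewrite ltr_wpDl // mulr_ge0 // ltW.
  apply: near_shiftS; move: hE; apply: filterS => n /andP[r0 rE].
  rewrite -mseE ger0_norm // ger0_norm ?powR_ge0 //; apply: le_trans rE _.
  rewrite power_scale // mulrA ler_wpM2r ?powR_ge0 //.
  by rewrite lerDl.
split => //; split.
  exists (fun n => 1 * n%:R `^ (- ((p + q) / D))), (fun n => 1 * n%:R `^ (q / D)).
  exact: achieve.
move=> b rho adm a ha; apply/bigO_seqP.
have [_ [l0 [l1 [l2 [E E0 hE]]]]] := bounds b rho adm.
have [k0 k00 h0] := (iffLR (bigO_seqP _ _) (ha l0)).
have [k1 k10 h1] := (iffLR (bigO_seqP _ _) (ha l1)).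
have [k2 k20 h2'] := (iffLR (bigO_seqP _ _) (ha l2)).
exists (E * (k0 + k1 + k2) + 1); first by rewrite ltr_wpDl // mulr_ge0 // !addr_ge0 // ltW.
apply: near_shiftS.
have h0' := near_unshiftS h0; have h1' := near_unshiftS h1; have h2'' := near_unshiftS h2'.
near=> n.
have B0 : `|mse X C K b rho l0 n.+1| <= k0 * `|a n.+1| by near: n; exact: h0'.
have B1 : `|mse X C K b rho l1 n.+1| <= k1 * `|a n.+1| by near: n; exact: h1'.
have B2 : `|mse X C K b rho l2 n.+1| <= k2 * `|a n.+1| by near: n; exact: h2''.
have Bs : risk_scale p q (b \o S) (rho \o S) n <=
   E * (risk X C K (b \o S) (rho \o S) l0 n + risk X C K (b \o S) (rho \o S) l1 n +
        risk X C K (b \o S) (rho \o S) l2 n) by near: n; exact: hE.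
have [b0 r0] := adm_pos adm (ltn0Sn n).
have Br := rate_le_max p0 q0 r0 b0 (ltr0Sn R n).
rewrite ger0_norm ?powR_ge0 //; apply: le_trans Br _; apply: le_trans Bs _.
rewrite !mseE; apply: (@le_trans _ _ (E * (k0 * `|a n.+1| + k1 * `|a n.+1| + k2 * `|a n.+1|))).
  rewrite ler_wpM2l // !lerD //; exact: le_trans (ler_norm _) _.
by rewrite -!mulrDl mulrA mulrDl mul1r lerDl.
Unshelve. all: by end_near. Qed.
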